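(* Let $m=m(n)\to\infty$ as $n\to\infty$ and let $p=p(n)\le 0.1$. Let $N_E$ be the number of edges of the random intersection graph $\mathcal G(n,m,p)$, $\hat p=1-(1-p^2)^m$, and $\mathcal N\sim\mathcal N(0,1)$. Then $$\frac{N_E-\mathbb E[N_E]}{\sqrt{\operatorname{Var}[N_E]}}\xrightarrow{\mathcal D}\mathcal N\quad\Longleftrightarrow\quad n^2\hat p(1-\hat p)\to\infty,$$ and there exist constants $C,n_0,m_0>0$ such that $$d_{K/W}\left(\frac{N_E-\mathbb E[N_E]}{\sqrt{\operatorname{Var}[N_E]}},\mathcal N\right)\le C\left(\frac{1}{n^2\hat p(1-\hat p)}\right)^{1/4},\qquad n\ge n_0,\ m\ge m_0.$$ Moreover, if additionally $mp^3\le1$, then $$d_{K/W}\left(\frac{N_E-\mathbb E[N_E]}{\sqrt{\operatorname{Var}[N_E]}},\mathcal N\right)\le C\left(\frac{1}{n^2\hat p(1-\hat p)}+\frac1n+\frac1m\right)^{1/2}.$$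
   Context: Random intersection graph $\mathcal G(n,m,p)$: vertex set $\{v_1,\ldots,v_n\}$, attribute set $\{a_1,\ldots,a_m\}$; each vertex chooses each attribute independently with probability $p$, and two vertices are adjacent iff they chose at least one common attribute. The probability of a given edge is $\hat p=1-(1-p^2)^m$. Distances: $d_K(X,Y)=\sup_t|\mathbb P(X\le t)-\mathbb P(Y\le t)|$, $d_W(X,Y)=\sup_{\mathrm{Lip}(\phi)\le1}|\mathbb E[\phi(X)-\phi(Y)]|$, $d_{K/W}=\max\{d_K,d_W\}$. *)

(* Defs.v *)
From HB Require Import structures.
From mathcomp Require Import all_boot all_order all_algebra.
From mathcomp Require Import all_classical all_reals all_analysis.
Set Implicit Arguments. Unset Strict Implicit. Unset Printing Implicit Defensive.
Import Order.TTheory GRing.Theory Num.Theory.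
Import numFieldNormedType.Exports.
Local Open Scope classical_set_scope.
Local Open Scope ring_scope.

Section RIG.
Variable R : realType.

(* Outcome of G(n,m,p): the incidence relation vertex v_i chooses attribute a_k. *)
Definition rig_outcome (n m : nat) := {ffun 'I_n * 'I_m -> bool}.

Definition rig_weight (n m : nat) (p : R) (w : rig_outcome n m) : R :=
  \prod_(x : 'I_n * 'I_m) (if w x then p else 1 - p).

Definition rig_E (n m : nat) (p : R) (X : rig_outcome n m -> R) : R :=
  \sum_(w : rig_outcome n m) rig_weight p w * X w.

Definition rig_edges (n m : nat) (w : rig_outcome n m) : nat :=
  #|[set e : 'I_n * 'I_n | (e.1 < e.2)%N &&
       [exists a : 'I_m, w (e.1, a) && w (e.2, a)]]|.

Definition rig_NE (n m : nat) (w : rig_outcome n m) : R := (rig_edges w)%:R.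

Definition rig_mean (n m : nat) (p : R) : R := rig_E p (@rig_NE n m).

Definition rig_var (n m : nat) (p : R) : R :=
  rig_E p (fun w => (@rig_NE n m w - rig_mean n m p) ^+ 2).

Definition rig_Z (n m : nat) (p : R) (w : rig_outcome n m) : R :=
  (rig_NE w - rig_mean n m p) / Num.sqrt (rig_var n m p).

Definition rig_cdf (n m : nat) (p : R) (t : R) : R :=
  rig_E p (fun w => if @rig_Z n m p w <= t then 1 else 0).

(* hat p = 1 - (1 - p^2)^m, the edge probability. *)
Definition phat (m : nat) (p : R) : R := 1 - (1 - p ^+ 2) ^+ m.

Definition Phi (t : R) : R := fine (normal_prob 0 1 `]-oo, t]).

Definition normal_expect (phi : R -> R) : \bar R :=
  (\int[normal_prob (0 : R) 1]_x (phi x)%:E)%E.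

Definition lipschitz1 (phi : R -> R) : Prop :=
  forall x y, `|phi x - phi y| <= `|x - y|.

Definition dK_rig (n m : nat) (p : R) : \bar R :=
  ereal_sup [set (`|rig_cdf n m p t - Phi t|)%:E | t in [set: R]].

Definition dW_rig (n m : nat) (p : R) : \bar R :=
  ereal_sup [set abse ((rig_E p (fun w => phi (@rig_Z n m p w)))%:E
                   - normal_expect phi)%E | phi in lipschitz1].

Definition dKW_rig (n m : nat) (p : R) : \bar R :=
  Order.max (dK_rig n m p) (dW_rig n m p).

End RIG.

(* Main.v *)
(** Let F be the centred edge count, and resample the attribute set X_i of a vertex
    i. With D_i the increment of F and G_i half the sum of D_i and of its average
    over the other vertices, Stein's identity
    E[F f(F)] = 1/2 sum_i E[G_i (f(F) - f(F^(i)))] holds. Hence the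
    distance to the normal law is controlled by the fluctuations of
    V = 1/2 sum_i E'[G_i D_i] and, in the Kolmogorov case, by those of
    sum_i E'[|G_i| D_i]: the monotonicity of w f(w) and of the indicator bounds the
    Taylor remainder of the Stein solution by an increment, and antisymmetry under
    the resampling turns that increment into a single term. Centred over X_i, the
    summands are almost orthogonal, because resampling X_l hardly changes the
    i-th one; their means over X_i form a degenerate quadratic form plus a linear
    one.

    This reduces both bounds to moments of u(x) = (1-p)^|x|, namely
    E u^k = (1-p+p(1-p)^k)^m. After division by q^k, where q = 1 - phat = E u, they
    are (1+b)^m with b = O(p^3); they are expanded to second
    order when m p^3 <= 1 and bounded by the fourth moment otherwise.

    Conversely, when n^2 phat (1-phat) stays bounded along a subsequence, so does the
    variance, and the normalised count lives on a lattice of non-vanishing spacing,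
    which is incompatible with the strict monotonicity of Phi. *)
Require Import Defs.
From HB Require Import structures.
From mathcomp Require Import all_boot all_order all_algebra.
From mathcomp Require Import all_classical all_reals all_analysis.
From mathcomp Require Import measurable_realfun ring lra.
Set Implicit Arguments. Unset Strict Implicit. Unset Printing Implicit Defensive.
Import Order.TTheory GRing.Theory Num.Theory.
Import numFieldNormedType.Exports.
Local Open Scope classical_set_scope.
Local Open Scope ring_scope.

(** * Resampling one coordinate of a product measure *)

(** The factor one half in [G_i] is dictated by the Hoeffding decomposition of F into functions of
    one vertex and degenerate functions of two. Resampling every vertex in turn meets a pair part
    twice and a one-vertex part once; averaging [D_i] with its mean over the other vertices halves
    the former and keeps the latter, so the conditional means of the [G_i] add up to F exactly. The
    variance may be governed by single pairs, through [al] = n^2 q (1-q), or by pairs sharing a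
    vertex, through [be] = n^3 Var u. No regime is singled out: the fluctuation bound [Qall] is
    compared with (al + be)^2 Y, and since the variance is at least (al + be)/4, the distance is at
    most a constant times sqrt Y. The exponent 1/2 stems from Y = 1/al + 1/n + 1/m. For m p^3 >= 1
    the first-order expansion is lost and only Y = al^(-1/2) is reached, whence the exponent 1/4;
    [M4_le] is the inequality behind it. In the converse a bounded [al] has to force a bounded [be],
    by different arguments for q <= 1/2 and q > 1/2. *)

Section Expectation.
Variable R : realFieldType.

Definition Ew (T : finType) (mu : T -> R) (f : T -> R) : R :=
  \sum_t mu t * f t.

Definition is_prob (T : finType) (mu : T -> R) : Prop :=
  (forall t, 0 <= mu t) /\ \sum_t mu t = 1.

Section Basics.
Variables (T : finType) (mu : T -> R).
Implicit Types f g : T -> R.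

Lemma eq_Ew f g : f =1 g -> Ew mu f = Ew mu g.
Proof. by move=> fg; apply: eq_bigr => t _; rewrite fg. Qed.

Lemma EwD f g : Ew mu (fun t => f t + g t) = Ew mu f + Ew mu g.
Proof. by rewrite /Ew -big_split; apply: eq_bigr => t _; rewrite mulrDr. Qed.

Lemma EwZ c f : Ew mu (fun t => c * f t) = c * Ew mu f.
Proof. by rewrite /Ew mulr_sumr; apply: eq_bigr => t _; rewrite mulrCA. Qed.

Lemma EwZr c f : Ew mu (fun t => f t * c) = Ew mu f * c.
Proof. by rewrite mulrC -EwZ; apply: eq_Ew => t; rewrite mulrC. Qed.

Lemma EwN f : Ew mu (fun t => - f t) = - Ew mu f.
Proof. by rewrite /Ew -sumrN; apply: eq_bigr => t _; rewrite mulrN. Qed.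

Lemma EwB f g : Ew mu (fun t => f t - g t) = Ew mu f - Ew mu g.
Proof. by rewrite EwD EwN. Qed.

Lemma Ew_sum (I : Type) (r : seq I) (P : pred I) (f : I -> T -> R) :
  Ew mu (fun t => \sum_(i <- r | P i) f i t) = \sum_(i <- r | P i) Ew mu (f i).
Proof.
rewrite /Ew exchange_big /=.
by apply: eq_bigr => t _; rewrite mulr_sumr.
Qed.

Lemma exchange_Ew (U : finType) (nu : U -> R) (f : T -> U -> R) :
  Ew mu (fun t => Ew nu (f t)) = Ew nu (fun u => Ew mu (f^~ u)).
Proof.
rewrite Ew_sum; apply: eq_bigr => u _.
by rewrite EwZ.
Qed.

Hypothesis mu_prob : is_prob mu.

Lemma Ew_cst c : Ew mu (fun=> c) = c.
Proof. by rewrite /Ew -mulr_suml mu_prob.2 mul1r. Qed.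

Lemma Ew_ge0 f : (forall t, 0 <= f t) -> 0 <= Ew mu f.
Proof. by move=> f0; apply: sumr_ge0 => t _; rewrite mulr_ge0 ?mu_prob.1. Qed.

Lemma Ew_le f g : (forall t, f t <= g t) -> Ew mu f <= Ew mu g.
Proof. by move=> fg; apply: ler_sum => t _; rewrite ler_wpM2l ?mu_prob.1. Qed.

Lemma Ew_norm f : `|Ew mu f| <= Ew mu (fun t => `|f t|).
Proof.
rewrite ler_norml -EwN; apply/andP; split; apply: Ew_le => t.
  by rewrite lerNl -normrN ler_norm.
exact: ler_norm.
Qed.

Lemma Ew_var f : Ew mu (fun t => (f t - Ew mu f) ^+ 2) =
  Ew mu (fun t => f t ^+ 2) - Ew mu f ^+ 2.
Proof.
set a := Ew mu f.
rewrite (eq_Ew (g := fun t => f t ^+ 2 + ((- 2 * a) * f t + a ^+ 2))); last first.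
  by move=> t; ring.
by rewrite !EwD EwZ Ew_cst -/a; ring.
Qed.

Lemma Ew_sqr f : Ew mu f ^+ 2 <= Ew mu (fun t => f t ^+ 2).
Proof.
rewrite -subr_ge0 -Ew_var; apply: Ew_ge0 => t; exact: sqr_ge0.
Qed.
End Basics.

Section Product.
Variables (I T : finType) (mu : T -> R).
Hypothesis mu_prob : is_prob mu.

Definition prod_weight (w : {ffun I -> T}) : R := \prod_i mu (w i).

Lemma prod_weight_prob : is_prob prod_weight.
Proof.
split=> [w|]; first by apply: prodr_ge0 => i _; exact: mu_prob.1.
rewrite /prod_weight -(bigA_distr_bigA (fun=> mu)) /=.
by rewrite big1 // => i _; exact: mu_prob.2.
Qed.

Definition upd (w : {ffun I -> T}) (i : I) (s : T) : {ffun I -> T} :=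
  [ffun j => if j == i then s else w j].

Notation Ex := (Ew prod_weight).

Lemma upd_same w i s : upd w i s i = s.
Proof. by rewrite ffunE eqxx. Qed.

Lemma upd_other w i s j : j != i -> upd w i s j = w j.
Proof. by rewrite ffunE => /negbTE ->. Qed.

Lemma upd_upd w i s t : upd (upd w i s) i t = upd w i t.
Proof. by apply/ffunP => j; rewrite !ffunE; case: eqP. Qed.

Lemma upd_id w i : upd w i (w i) = w.
Proof. by apply/ffunP => j; rewrite ffunE; case: eqP => [->|]. Qed.

Lemma updC w i j s t : i != j -> upd (upd w i s) j t = upd (upd w j t) i s.
Proof.
move=> ij; apply/ffunP => k; rewrite !ffunE.
by have [->|//] := eqVneq k j; rewrite eq_sym (negbTE ij).
Qed.

(** Detailed balance in multiplied form: without a quotient, values of weight zero need no separate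
    treatment. *)
Lemma prod_weight_upd w i s :
  prod_weight (upd w i s) * mu (w i) = prod_weight w * mu s.
Proof.
rewrite /prod_weight (bigD1 i) //= [in RHS](bigD1 i) //= upd_same.
rewrite [in LHS](eq_bigr (fun j => mu (w j))); last first.
  by move=> j ji; rewrite upd_other.
by rewrite mulrC mulrA mulrAC.
Qed.

(* The pair (w, upd w i s) is exchangeable. *)
Lemma Ex_swap i (K : {ffun I -> T} -> {ffun I -> T} -> R) :
  Ex (fun w => Ew mu (fun s => K w (upd w i s))) =
  Ex (fun w => Ew mu (fun s => K (upd w i s) w)).
Proof.
have E (L : {ffun I -> T} -> T -> R) :
  Ex (fun w => Ew mu (L w)) =
  \sum_(x : {ffun I -> T} * T) (prod_weight x.1 * mu x.2) * L x.1 x.2.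
  rewrite /Ew (eq_bigr (fun w => \sum_s (prod_weight w * mu s) * L w s)).
    by rewrite pair_big.
  by move=> w _; rewrite mulr_sumr; apply: eq_bigr => s _; rewrite mulrA.
rewrite !E.
pose h (x : {ffun I -> T} * T) := (upd x.1 i x.2, x.1 i).
have hK : involutive h.
  by move=> [w s]; rewrite /h /= upd_upd upd_id upd_same.
rewrite (reindex_inj (inv_inj hK)) /=; apply: eq_bigr => -[w s] _ /=.
by rewrite upd_upd upd_id prod_weight_upd.
Qed.

Definition Ei (i : I) (X : {ffun I -> T} -> R) (w : {ffun I -> T}) : R :=
  Ew mu (fun s => X (upd w i s)).

Lemma Ex_Ei i X : Ex (Ei i X) = Ex X.
Proof.
rewrite (Ex_swap i (fun _ w => X w)).
by apply: eq_Ew => w; rewrite Ew_cst.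
Qed.

Lemma Ei_upd i X w s : Ei i X (upd w i s) = Ei i X w.
Proof. by apply: eq_Ew => t; rewrite upd_upd. Qed.

Lemma Ei_inv i X w : (forall s, X (upd w i s) = X w) -> Ei i X w = X w.
Proof. by move=> h; rewrite /Ei (eq_Ew _ h) Ew_cst. Qed.

Lemma Ei_idem i X : Ei i (Ei i X) =1 Ei i X.
Proof. by move=> w; apply: Ei_inv => s; exact: Ei_upd. Qed.

Lemma EiB i X Y w : Ei i (fun w => X w - Y w) w = Ei i X w - Ei i Y w.
Proof. exact: EwB. Qed.

Lemma EiC i j X : Ei i (Ei j X) =1 Ei j (Ei i X).
Proof.
move=> w; have [->//|ij] := eqVneq i j.
rewrite /Ei exchange_Ew; apply: eq_Ew => t; apply: eq_Ew => s.
by rewrite updC.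
Qed.

(** [Ei i] is a conditional expectation, hence an orthogonal projection: [Ei i Y] ignores coordinate
    i, so X may be averaged over it first. *)
Lemma Ex_mul_Ei i X Y : Ex (fun w => X w * Ei i Y w) =
  Ex (fun w => Ei i X w * Ei i Y w).
Proof.
rewrite -(Ex_Ei i); apply: eq_Ew => w.
rewrite {1}/Ei (eq_Ew _ (g := fun s => X (upd w i s) * Ei i Y w)).
  by rewrite EwZr.
by move=> s; rewrite Ei_upd.
Qed.

Lemma Ex_sub_Ei_sqr i X :
  Ex (fun w => (X w - Ei i X w) ^+ 2) <= Ex (fun w => X w ^+ 2).
Proof.
rewrite (eq_Ew _ (g := fun w => X w ^+ 2 + (- 2 * (X w * Ei i X w) + Ei i X w * Ei i X w))).
  rewrite !EwD EwZ Ex_mul_Ei.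
  have : 0 <= Ex (fun w => Ei i X w * Ei i X w).
    by apply: Ew_ge0 => [|w]; [exact: prod_weight_prob|rewrite -expr2 sqr_ge0].
  by lra.
by move=> w; ring.
Qed.

Lemma Ex_sub_Ei_upd i X : Ex (fun w => (X w - Ei i X w) ^+ 2) <=
  Ex (fun w => Ew mu (fun s => (X w - X (upd w i s)) ^+ 2)).
Proof.
apply: Ew_le => [|w]; first exact: prod_weight_prob.
rewrite (_ : X w - Ei i X w = Ew mu (fun s => X w - X (upd w i s))).
  exact: Ew_sqr.
by rewrite EwB Ew_cst.
Qed.

(** * Sums of centred functions that are almost orthogonal *)

Section QuasiOrthogonal.
Variable phi : I -> {ffun I -> T} -> R.
Hypothesis phi0 : forall i w, Ei i (phi i) w = 0.

Let Ei0 i (X : {ffun I -> T} -> R) : (forall w, X w = 0) -> forall w, Ei i X w = 0.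
Proof. by move=> h w; rewrite /Ei (eq_Ew _ (g := fun=> 0)) ?Ew_cst. Qed.

(** Each subtracted projection is orthogonal to the other factor, because [Ei i] kills [phi i] and
    the projections commute. The correlation is thus governed by how much resampling l changes
    [phi i], and conversely. *)
Lemma Ex_phi_mul i l : Ex (fun w => phi i w * phi l w) =
  Ex (fun w => (phi i w - Ei l (phi i) w) * (phi l w - Ei i (phi l) w)).
Proof.
have h1 : Ex (fun w => phi i w * Ei i (phi l) w) = 0.
  by rewrite Ex_mul_Ei (eq_Ew _ (g := fun=> 0)) ?Ew_cst//; [exact: prod_weight_prob
    |move=> w; rewrite phi0 mul0r].
have h2 : Ex (fun w => phi l w * Ei l (phi i) w) = 0.
  by rewrite Ex_mul_Ei (eq_Ew _ (g := fun=> 0)) ?Ew_cst//; [exact: prod_weight_prob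
    |move=> w; rewrite phi0 mul0r].
have h3 : Ex (fun w => Ei l (phi i) w * Ei i (phi l) w) = 0.
  rewrite Ex_mul_Ei (eq_Ew _ (g := fun=> 0)) ?Ew_cst//; first exact: prod_weight_prob.
  by move=> w; rewrite EiC (Ei0 l (phi0 i)) mul0r.
rewrite [RHS](eq_Ew _ (g := fun w => phi i w * phi l w +
   (- (phi i w * Ei i (phi l) w) + (- (phi l w * Ei l (phi i) w) +
     Ei l (phi i) w * Ei i (phi l) w)))); last by move=> w; ring.
by rewrite !EwD !EwN h1 h2 h3; ring.
Qed.

Lemma Ex_sum_sqr_le a b :
  (forall i, Ex (fun w => phi i w ^+ 2) <= a) ->
  (forall i l, i != l -> Ex (fun w => (phi i w - Ei l (phi i) w) ^+ 2) <= b) ->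
  0 <= b ->
  Ex (fun w => (\sum_i phi i w) ^+ 2) <= #|I|%:R * a + #|I|%:R ^+ 2 * b.
Proof.
move=> ha hb b0.
rewrite (eq_Ew _ (g := fun w => \sum_i \sum_l phi i w * phi l w)); last first.
  by move=> w; rewrite expr2 mulr_suml; apply: eq_bigr => i _; rewrite mulr_sumr.
rewrite Ew_sum.
apply: le_trans (_ : \sum_(i : I) (a + #|I|%:R * b) <= _); last first.
  by rewrite sumr_const -[leLHS]mulr_natl mulrDr mulrA -expr2.
apply: ler_sum => i _; rewrite Ew_sum (bigD1 i) //=; apply: lerD.
  by rewrite -(eq_Ew _ (f := fun w => phi i w ^+ 2)) ?ha// => w; rewrite expr2.
apply: le_trans (_ : \sum_(l | l != i) b <= _); last first.
  by rewrite sumr_const -[leLHS]mulr_natl ler_wpM2r// ler_nat max_card.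
apply: ler_sum => l li; rewrite Ex_phi_mul.
apply: le_trans (_ : Ex (fun w => 2^-1 * (phi i w - Ei l (phi i) w) ^+ 2 +
   2^-1 * (phi l w - Ei i (phi l) w) ^+ 2) <= _).
  apply: Ew_le => [|w]; first exact: prod_weight_prob.
  have := sqr_ge0 ((phi i w - Ei l (phi i) w) - (phi l w - Ei i (phi l) w)).
  by nra.
rewrite EwD !EwZ; have := hb l i li; have := hb i l; rewrite eq_sym => /(_ li).
by lra.
Qed.

End QuasiOrthogonal.

(** * Moments of sums over independent coordinates *)

Section IidSums.
Variable eta : T -> R.
Hypothesis eta0 : Ew mu eta = 0.
Let N2 := Ew mu (fun y => eta y ^+ 2).
Let N3 := Ew mu (fun y => eta y ^+ 3).
Let N4 := Ew mu (fun y => eta y ^+ 4).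

Lemma sum_upd_notin (r : seq I) l w s : l \notin r ->
  \sum_(j <- r) eta (upd w l s j) = \sum_(j <- r) eta (w j).
Proof.
move=> lr; apply: eq_big_seq => j jr; rewrite upd_other//.
by apply: contraNneq lr => <-.
Qed.

(** Averaging over the newest coordinate first removes its odd contributions; the cross term with
    the third moment disappears because the remaining sum has mean zero. The fourth moment is only
    bounded, with s^2 in place of s (s-1). *)
Lemma iid_sum_moments (r : seq I) : uniq r ->
  [/\ Ex (fun w => \sum_(j <- r) eta (w j)) = 0,
      Ex (fun w => (\sum_(j <- r) eta (w j)) ^+ 2) = (size r)%:R * N2 &
      Ex (fun w => (\sum_(j <- r) eta (w j)) ^+ 4) <=
        (size r)%:R * N4 + 3 * (size r)%:R ^+ 2 * N2 ^+ 2].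
Proof.
elim: r => [_|l r IH /= /andP[lr ur]].
  have P := prod_weight_prob.
  by split; rewrite (eq_Ew _ (g := fun=> 0)) ?Ew_cst ?mul0r//
    ?expr0n ?mulr0 ?mul0r ?addr0// => w; rewrite big_nil// expr0n.
have [h1 h2 h4] := IH ur.
pose S (w : {ffun I -> T}) := \sum_(j <- r) eta (w j).
have sE w s : \sum_(j <- l :: r) eta (upd w l s j) = eta s + S w.
  by rewrite big_cons upd_same sum_upd_notin.
split.
- rewrite -(Ex_Ei l) -[RHS]h1; apply: eq_Ew => w.
  rewrite /Ei (eq_Ew _ (g := fun s => eta s + S w)); last exact: sE.
  by rewrite EwD eta0 add0r Ew_cst.
- rewrite -(Ex_Ei l) (eq_Ew _ (g := fun w => N2 + S w ^+ 2)); last first.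
    move=> w; rewrite /Ei (eq_Ew _ (g := fun s => eta s ^+ 2 + ((2 * S w) * eta s + S w ^+ 2))).
      by rewrite !EwD EwZ eta0 Ew_cst// mulr0 add0r.
    by move=> s; rewrite sE; ring.
  by rewrite EwD Ew_cst ?h2; [rewrite -natr1; ring|exact: prod_weight_prob].
- rewrite -(Ex_Ei l) (eq_Ew _ (g := fun w => N4 + ((4 * N3) * S w + (6 * N2 * S w ^+ 2 + S w ^+ 4)))); last first.
    move=> w; rewrite /Ei (eq_Ew _ (g := fun s => eta s ^+ 4 + ((4 * S w) * eta s ^+ 3 +
       ((6 * S w ^+ 2) * eta s ^+ 2 + ((4 * S w ^+ 3) * eta s + S w ^+ 4))))).
      by rewrite !EwD !EwZ eta0 Ew_cst// /N2 /N3 /N4; ring.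
    by move=> s; rewrite sE; ring.
  rewrite !EwD !EwZ Ew_cst; last exact: prod_weight_prob.
  rewrite h1 h2 -natr1 mulr0 add0r.
  have N20 : 0 <= N2 by apply: Ew_ge0 => // t; exact: sqr_ge0.
  have : 0 <= N2 ^+ 2 by exact: sqr_ge0.
  by move: h4; rewrite -/(S _); set s := (size r)%:R; nra.
Qed.

End IidSums.

End Product.
End Expectation.

(** * Resampling fluctuations of the edge count *)

Section Fluctuations.
Variables (R : realFieldType) (n : nat) (T : finType) (mu : T -> R).
Hypothesis mu_prob : is_prob mu.
Variable e : T -> T -> R.
Hypothesis e_sym : forall x y, e x y = e y x.
Hypothesis e01 : forall x y, 0 <= e x y <= 1.

Notation Om := {ffun 'I_n -> T}.
Notation Ex := (Ew (prod_weight mu)).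
Notation Pex := (prod_weight_prob 'I_n mu_prob).

Definition deg1 x := Ew mu (e x).
Definition gam := Ew mu deg1.
Definition cdeg x := deg1 x - gam.
Definition vdeg x := Ew mu (fun y => (e x y - deg1 x) ^+ 2).

(* Increment of the edge count when the attribute set of vertex i becomes s,
   and the same increment averaged over the other vertices. *)
Definition dif x s y := e x y - e s y.
Definition Dc x s i (w : Om) := \sum_(j | j != i) dif x s (w j).
Definition Gc x s i (w : Om) := (Dc x s i w + n.-1%:R * (deg1 x - deg1 s)) / 2.
Definition Dinc i (w : Om) s := Dc (w i) s i w.
Definition Ginc i (w : Om) s := Gc (w i) s i w.

(** This is why [Dc] and [Gc] take the old and new attribute sets as arguments: with x and s frozen,
    the other vertices contribute an i.i.d. sum. *)
Lemma Ex_cond i (L : T -> T -> Om -> R) :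
  (forall x s w t, L x s (upd w i t) = L x s w) ->
  Ex (fun w : Om => Ew mu (fun s => L (w i) s w)) =
  Ew mu (fun x => Ew mu (fun s => Ex (L x s))).
Proof.
move=> hL; rewrite -(Ex_Ei mu_prob i).
rewrite (eq_Ew _ (g := fun w => Ew mu (fun x => Ew mu (fun s => L x s w)))).
  by rewrite exchange_Ew; apply: eq_Ew => x; rewrite exchange_Ew.
by move=> w; apply: eq_Ew => x; apply: eq_Ew => s; rewrite upd_same hL.
Qed.

(** * Conditional moments for a frozen pair of attribute sets *)

Section FixedPair.
Variables x s : T.
Let d := deg1 x - deg1 s.
Let eta y := dif x s y - d.
Definition pair_m2 := Ew mu (fun y => eta y ^+ 2).
Definition pair_m4 := Ew mu (fun y => eta y ^+ 4).

Lemma eta_mean0 : Ew mu eta = 0.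
Proof. by rewrite EwB Ew_cst// EwB subrr. Qed.

Lemma pair_m2_ge0 : 0 <= pair_m2.
Proof. by apply: Ew_ge0 => // y; exact: sqr_ge0. Qed.

Lemma pair_m2_sqr : pair_m2 ^+ 2 <= pair_m4.
Proof.
apply: le_trans (Ew_sqr mu_prob _) _.
by apply: Ew_le => // y; rewrite -exprM.
Qed.

Lemma pair_m4_le : pair_m4 <= 4 * pair_m2.
Proof.
rewrite -EwZ; apply: Ew_le => // y.
have b z : -1 <= e x z - e s z <= 1.
  have /andP[? ?] := e01 x z; have /andP[? ?] := e01 s z.
  by apply/andP; split; lra.
have h1 := b y.
have h2 : -1 <= d <= 1.
  rewrite /d -EwB -{1}(Ew_cst mu_prob (-1)) -{2}(Ew_cst mu_prob 1).
  by apply/andP; split; apply: Ew_le => // z; case/andP: (b z).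
have : -2 <= eta y <= 2.
  by move: h1 h2; rewrite /eta /dif => /andP[? ?] /andP[? ?]; apply/andP; split; lra.
case/andP => ? ?; have h : eta y ^+ 2 <= 4 by nra.
rewrite (_ : eta y ^+ 4 = eta y ^+ 2 * eta y ^+ 2); last by ring.
by rewrite ler_wpM2r// sqr_ge0.
Qed.

Lemma pair_m2_le : pair_m2 <= 2 * vdeg x + 2 * vdeg s.
Proof.
rewrite -!EwZ -EwD; apply: Ew_le => // y; rewrite /eta /dif /d.
have := sqr_ge0 ((e x y - deg1 x) + (e s y - deg1 s)); nra.
Qed.

Lemma sum_dif_shift (w : Om) (A : pred 'I_n) :
  \sum_(j | A j) dif x s (w j) = #|A|%:R * d + \sum_(j | A j) eta (w j).
Proof.
rewrite /eta [in RHS]sumrB sumr_const -mulr_natl; ring.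
Qed.

Lemma iid_moments (A : pred 'I_n) :
  [/\ Ex (fun w : Om => \sum_(j | A j) eta (w j)) = 0,
      Ex (fun w : Om => (\sum_(j | A j) eta (w j)) ^+ 2) = #|A|%:R * pair_m2 &
      Ex (fun w : Om => (\sum_(j | A j) eta (w j)) ^+ 4) <=
        #|A|%:R * pair_m4 + 3 * #|A|%:R ^+ 2 * pair_m2 ^+ 2].
Proof.
have := iid_sum_moments mu_prob eta_mean0 (enum_uniq A).
rewrite -cardE => -[h1 h2 h4].
split.
- by rewrite -[RHS]h1; apply: eq_Ew => w; rewrite big_enum.
- by rewrite -[RHS]h2; apply: eq_Ew => w; rewrite big_enum.
- by apply: le_trans h4; rewrite le_eqVlt; apply/orP; left; apply/eqP/eq_Ew => w;
    rewrite big_enum.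
Qed.

Lemma card_neq (i : 'I_n) : #|(fun j : 'I_n => j != i)| = n.-1.
Proof. by rewrite (cardC1 i) card_ord. Qed.

(** Fourth moment of drift plus centred sum: 8 comes from (a + b)^4 <= 8 (a^4 + b^4), the rest from
    [iid_moments]. *)
Definition single_bd :=
  8 * (n.-1%:R ^+ 4 * d ^+ 4 + n.-1%:R * pair_m4 + 3 * n.-1%:R ^+ 2 * pair_m2 ^+ 2).

Definition resample_bd :=
  32 * (n.-1%:R ^+ 2 * (d ^+ 2 * pair_m2) + n.-1%:R * pair_m2 ^+ 2 + 2 * pair_m4).

Lemma cond_D4 i :
  Ex (fun w : Om => Dc x s i w ^+ 4) <= single_bd.
Proof.
rewrite /single_bd.
have /= [_ _ h] := iid_moments (fun j => j != i).
move: h; rewrite card_neq => h.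
apply: le_trans (_ : Ex (fun w : Om => 8 * (n.-1%:R ^+ 4 * d ^+ 4) +
   8 * (\sum_(j | j != i) eta (w j)) ^+ 4) <= _); last first.
  by rewrite EwD (Ew_cst Pex) EwZ; move: h; lra.
apply: Ew_le => [|w]; first exact: Pex.
rewrite /Gc /Dc (sum_dif_shift w (fun j => j != i)) card_neq -/d.
set a := _ * d; set b := \sum_(_ | _) _.
rewrite (_ : n.-1%:R ^+ 4 * d ^+ 4 = a ^+ 4); last by rewrite /a; ring.
have H : (a + b) ^+ 2 <= 2 * (a ^+ 2 + b ^+ 2) by have := sqr_ge0 (a - b); nra.
have H2 : 0 <= (a + b) ^+ 2 by exact: sqr_ge0.
have := sqr_ge0 (a ^+ 2 - b ^+ 2); nra.
Qed.

Lemma cond_G2D2 i :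
  Ex (fun w : Om => Gc x s i w ^+ 2 * Dc x s i w ^+ 2) <= single_bd.
Proof.
rewrite /single_bd.
have /= [_ _ h] := iid_moments (fun j => j != i).
move: h; rewrite card_neq => h.
apply: le_trans (_ : Ex (fun w : Om => 8 * (n.-1%:R ^+ 4 * d ^+ 4) +
   8 * (\sum_(j | j != i) eta (w j)) ^+ 4) <= _); last first.
  by rewrite EwD (Ew_cst Pex) EwZ; move: h; lra.
apply: Ew_le => [|w]; first exact: Pex.
rewrite /Gc /Dc (sum_dif_shift w (fun j => j != i)) card_neq -/d.
set a := _ * d; set b := \sum_(_ | _) _.
rewrite (_ : n.-1%:R ^+ 4 * d ^+ 4 = a ^+ 4); last by rewrite /a; ring.
have H1 : ((a + b + a) / 2) ^+ 2 <= 2 * (a ^+ 2 + b ^+ 2) by have := sqr_ge0 (a - b / 2); nra.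
have H : (a + b) ^+ 2 <= 2 * (a ^+ 2 + b ^+ 2) by have := sqr_ge0 (a - b); nra.
apply: le_trans (ler_pM (sqr_ge0 _) (sqr_ge0 _) H1 H) _.
have := sqr_ge0 (a ^+ 2 - b ^+ 2); nra.
Qed.

(* Used with kap a b = a * b (conditional variance) and kap a b = `|a| * b
   (Kolmogorov remainder). *)
Variable kap : R -> R -> R.
Hypothesis kap_lip : forall a b a' b', (kap a b - kap a' b') ^+ 2 <=
  2 * (a ^+ 2 * (b - b') ^+ 2 + (a - a') ^+ 2 * b' ^+ 2).

(** Resampling l replaces a single summand r of D by an independent copy t, and moves G by half as
    much. Only the factor (r - t)^2 times a second moment of D and G survives, one order of n below
    [single_bd]. *)
Lemma cond_resample i l : i != l ->
  Ex (fun w : Om => Ew mu (fun t => (kap (Gc x s i w) (Dc x s i w) -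
      kap (Gc x s i (upd w l t)) (Dc x s i (upd w l t))) ^+ 2)) <= resample_bd.
Proof.
move=> il; rewrite /resample_bd.
pose A (w : Om) := \sum_(j | (j != i) && (j != l)) eta (w j).
have DcE w : Dc x s i w = n.-1%:R * d + (eta (w l) + A w).
  rewrite /Dc (sum_dif_shift w (fun j => j != i)) card_neq; congr (_ + _).
  by rewrite (bigD1 l) //= eq_sym.
have A_upd w t : A (upd w l t) = A w.
  by apply: eq_bigr => j /andP[_ jl]; rewrite upd_other.
set a := n.-1%:R * d.
apply: le_trans (_ : Ex (fun w : Om => Ew mu (fun t => 16 * ((eta (w l) ^+ 2 + eta t ^+ 2) *
    (a ^+ 2 + A w ^+ 2 + eta (w l) ^+ 2 + eta t ^+ 2)))) <= _).
  apply: Ew_le => [|w]; first exact: Pex.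
  apply: Ew_le => // t.
  apply: le_trans (kap_lip _ _ _ _) _.
  rewrite /Gc !DcE A_upd upd_same -/d -/a.
  set r := eta (w l); set tt := eta t; set S := A w.
  have h0 : (r - tt) ^+ 2 <= 2 * (r ^+ 2 + tt ^+ 2) by have := sqr_ge0 (r + tt); nra.
  have h1 : ((a + (r + S) + a) / 2) ^+ 2 + (a + (tt + S)) ^+ 2 / 4 <=
     4 * (a ^+ 2 + S ^+ 2 + r ^+ 2 + tt ^+ 2).
    have := sqr_ge0 (a - r / 2); have := sqr_ge0 (a - S / 2); have := sqr_ge0 (r - S).
    have := sqr_ge0 (a - tt); have := sqr_ge0 (a - S); have := sqr_ge0 (tt - S).
    have := sqr_ge0 a; have := sqr_ge0 r; have := sqr_ge0 tt; have := sqr_ge0 S.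
    by nra.
  rewrite (_ : 2 * _ = 2 * (r - tt) ^+ 2 * (((a + (r + S) + a) / 2) ^+ 2 + (a + (tt + S)) ^+ 2 / 4)); last by field.
  apply: le_trans (ler_wpM2l _ h1) _; first by have := sqr_ge0 (r - tt); lra.
  have h2 : 0 <= a ^+ 2 + S ^+ 2 + r ^+ 2 + tt ^+ 2.
    by have := sqr_ge0 a; have := sqr_ge0 r; have := sqr_ge0 tt; have := sqr_ge0 S; lra.
  by nra.
rewrite -(Ex_Ei mu_prob l).
rewrite (eq_Ew _ (g := fun w => 32 * (a ^+ 2 * pair_m2 + pair_m4 + pair_m2 ^+ 2)
   + (32 * pair_m2) * A w ^+ 2)); last first.
  move=> w; rewrite /Ei.
  rewrite (eq_Ew _ (g := fun r => 16 * eta r ^+ 4 + ((16 * (a ^+ 2 + A w ^+ 2) + 32 * pair_m2) * eta r ^+ 2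
     + (16 * ((a ^+ 2 + A w ^+ 2) * pair_m2 + pair_m4))))).
    by rewrite !EwD !EwZ Ew_cst// -/pair_m4 -/pair_m2; ring.
  move=> r; rewrite (eq_Ew _ (g := fun t => (16 * eta r ^+ 2 * (a ^+ 2 + A w ^+ 2 + eta r ^+ 2))
     + ((16 * (a ^+ 2 + A w ^+ 2) + 32 * eta r ^+ 2) * eta t ^+ 2 + 16 * eta t ^+ 4))).
    by rewrite !EwD !EwZ Ew_cst// -/pair_m4 -/pair_m2; ring.
  by move=> t; rewrite upd_same A_upd; ring.
rewrite EwD (Ew_cst Pex) EwZ.
have /= [_ h _] := iid_moments (fun j => (j != i) && (j != l)).
rewrite h.
have c : (#|(fun j => (j != i) && (j != l))|%:R : R) <= n.-1%:R.
  by rewrite ler_nat -(card_neq i); apply: subset_leq_card; apply/fintype.subsetP => j; rewrite !unfold_in => /andP[].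
rewrite (_ : a ^+ 2 = n.-1%:R ^+ 2 * d ^+ 2); last by rewrite /a; ring.
have m2 := pair_m2_ge0; have := pair_m2_sqr; have := sqr_ge0 pair_m2.
have := ler_wpM2r (sqr_ge0 pair_m2) c.
move: #|_|%:R c => k; set m := n.-1%:R; nra.
Qed.

End FixedPair.


Lemma Dc_upd x s i w t : Dc x s i (upd w i t) = Dc x s i w.
Proof. by apply: eq_bigr => j ji; rewrite upd_other. Qed.

Lemma Gc_upd x s i w t : Gc x s i (upd w i t) = Gc x s i w.
Proof. by rewrite /Gc Dc_upd. Qed.

Notation E2 f := (Ew mu (fun x => Ew mu (fun s => f x s))).

Lemma E2_le (f g : T -> T -> R) : (forall x s, f x s <= g x s) -> E2 f <= E2 g.
Proof. by move=> fg; apply: Ew_le => // x; apply: Ew_le => // s. Qed.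

Lemma E2_sum_le (f : T -> T -> R) (c : R) (g : T -> R) :
  (forall x s, f x s <= c * g x + c * g s) -> E2 f <= 2 * c * Ew mu g.
Proof.
move=> fg; apply: le_trans (E2_le fg) _.
rewrite (eq_Ew _ (g := fun x => c * g x + c * Ew mu g)).
  by rewrite EwD EwZ (Ew_cst mu_prob); lra.
by move=> x; rewrite EwD !EwZ (Ew_cst mu_prob).
Qed.

Lemma E2_diff4 : E2 (fun x s => (deg1 x - deg1 s) ^+ 4) <=
  16 * Ew mu (fun x => cdeg x ^+ 4).
Proof.
rewrite (_ : 16 = 2 * 8); last by ring.
apply: E2_sum_le => x s; rewrite (_ : deg1 x - deg1 s = cdeg x - cdeg s); last first.
  by rewrite /cdeg; ring.
set a := cdeg x; set b := cdeg s.
have H : (a - b) ^+ 2 <= 2 * (a ^+ 2 + b ^+ 2) by have := sqr_ge0 (a + b); nra.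
have H2 : 0 <= (a - b) ^+ 2 by exact: sqr_ge0.
have := sqr_ge0 (a ^+ 2 - b ^+ 2); nra.
Qed.

Lemma E2_m4 : E2 pair_m4 <= 16 * Ew mu vdeg.
Proof.
rewrite (_ : 16 = 2 * 8); last by ring.
by apply: E2_sum_le => x s; have := pair_m4_le x s; have := pair_m2_le x s; lra.
Qed.

Lemma E2_m2_sqr : E2 (fun x s => pair_m2 x s ^+ 2) <= 16 * Ew mu (fun x => vdeg x ^+ 2).
Proof.
rewrite (_ : 16 = 2 * 8); last by ring.
apply: E2_sum_le => x s; have h := pair_m2_le x s; have h0 := pair_m2_ge0 x s.
apply: le_trans (_ : (2 * vdeg x + 2 * vdeg s) ^+ 2 <= _).
  by rewrite ler_sqr// nnegrE; apply: le_trans h.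
by have := sqr_ge0 (vdeg x - vdeg s); nra.
Qed.

(** The powers of n are those of n times [single_bd], the diagonal part of the variance of a sum
    over vertices; n^2 times [resample_bd] fits in as well. *)
Definition Qfluct : R := n%:R ^+ 5 * Ew mu (fun x => cdeg x ^+ 4) +
  n%:R ^+ 3 * Ew mu (fun x => vdeg x ^+ 2) + n%:R ^+ 2 * Ew mu vdeg.

Definition bound_single := 8 * (n.-1%:R ^+ 4 * E2 (fun x s => (deg1 x - deg1 s) ^+ 4) +
  n.-1%:R * E2 pair_m4 + 3 * n.-1%:R ^+ 2 * E2 (fun x s => pair_m2 x s ^+ 2)).

Lemma E2_lin a b c (f g h : T -> T -> R) :
  E2 (fun x s => a * f x s + b * g x s + c * h x s) = a * E2 f + b * E2 g + c * E2 h.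
Proof.
rewrite (eq_Ew _ (g := fun x => a * Ew mu (f x) + b * Ew mu (g x) + c * Ew mu (h x))).
  by rewrite !EwD !EwZ.
by move=> x; rewrite !EwD !EwZ.
Qed.

Lemma E2Z c (f : T -> T -> R) : E2 (fun x s => c * f x s) = c * E2 f.
Proof. by rewrite -EwZ; apply: eq_Ew => x; rewrite EwZ. Qed.

Lemma E2D (f g : T -> T -> R) : E2 (fun x s => f x s + g x s) = E2 f + E2 g.
Proof. by rewrite -EwD; apply: eq_Ew => x; rewrite EwD. Qed.

Lemma E2_single_bd : E2 single_bd = bound_single.
Proof. by rewrite /bound_single -E2_lin -E2Z. Qed.

Lemma pred_natr_le : 0 <= (n.-1%:R : R) <= n%:R.
Proof. by rewrite ler0n ler_nat leq_pred. Qed.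

Lemma E2_ge0 (f : T -> T -> R) : (forall x s, 0 <= f x s) -> 0 <= E2 f.
Proof. by move=> f0; apply: Ew_ge0 => // x; apply: Ew_ge0 => // s. Qed.

Lemma exprn_even4_ge0 (a : R) : 0 <= a ^+ 4.
Proof. by rewrite (_ : 4 = 2 * 2)%N // exprM sqr_ge0. Qed.

Let m4_ge0 : 0 <= E2 pair_m4.
Proof. by apply: E2_ge0 => x s; apply: Ew_ge0 => // y; exact: exprn_even4_ge0. Qed.

Let m22_ge0 : 0 <= E2 (fun x s => pair_m2 x s ^+ 2).
Proof. by apply: E2_ge0 => x s; exact: sqr_ge0. Qed.

Let d4_ge0 : 0 <= E2 (fun x s => (deg1 x - deg1 s) ^+ 4).
Proof. by apply: E2_ge0 => x s; exact: exprn_even4_ge0. Qed.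

(** The constant is 8 * 3 * 16: the prefactor of [bound_single], its largest coefficient, and the
    loss in passing from differences to centred moments. *)
Lemma bound_single_le : n%:R * bound_single <= 384 * Qfluct.
Proof.
have /andP[k0 kn] := pred_natr_le.
rewrite /bound_single /Qfluct.
have [n0|n0] := posnP n; first by rewrite !n0 mulr0n !expr0n /= !mul0r !addr0 mulr0.
have n1 : 1 <= (n%:R : R) by rewrite ler1n.
have h1 : n.-1%:R ^+ 4 <= n%:R ^+ 4 :> R by rewrite lerXn2r ?nnegrE.
have h2 : n.-1%:R ^+ 2 <= n%:R ^+ 2 :> R by rewrite lerXn2r ?nnegrE.
have i1 := ler_wpM2r d4_ge0 h1.
have i2 := ler_wpM2r m22_ge0 h2.
have i3 := ler_wpM2r m4_ge0 kn.
have j1 := ler_wpM2l (exprn_ge0 5 (ler0n R n)) E2_diff4.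
have j2 := ler_wpM2l (exprn_ge0 3 (ler0n R n)) E2_m2_sqr.
have j3 := ler_wpM2l (exprn_ge0 2 (ler0n R n)) E2_m4.
have := ler_wpM2l (ler0n R n) i1; have := ler_wpM2l (ler0n R n) i2.
have := ler_wpM2l (ler0n R n) i3.
move: (n%:R) n1 => N n1 in j1 j2 j3 *.
have p0 : 0 <= N ^+ 5 * Ew mu (fun x => cdeg x ^+ 4).
  by rewrite mulr_ge0 ?exprn_ge0 ?Ew_ge0//; [lra|move=> t; exact: exprn_even4_ge0].
have p1 : 0 <= N ^+ 3 * Ew mu (fun x => vdeg x ^+ 2).
  by rewrite mulr_ge0 ?exprn_ge0 ?Ew_ge0//; [lra|move=> t; exact: sqr_ge0].
have p2 : 0 <= N ^+ 2 * Ew mu vdeg.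
  rewrite mulr_ge0 ?exprn_ge0 ?Ew_ge0//; [lra|move=> t].
  by apply: Ew_ge0 => // y; exact: sqr_ge0.
lra.
Qed.

Lemma sum_D4 : \sum_i Ex (fun w : Om => Ew mu (fun s => Dinc i w s ^+ 4)) <= 384 * Qfluct.
Proof.
apply: le_trans bound_single_le.
apply: le_trans (_ : \sum_(i < n) bound_single <= _); last first.
  by rewrite sumr_const card_ord mulr_natl.
apply: ler_sum => i _.
rewrite (Ex_cond (i := i) (L := fun x s w => Dc x s i w ^+ 4)); last first.
  by move=> x s w t; rewrite Dc_upd.
apply: le_trans (E2_le (g := single_bd) _) _; first by move=> x s; exact: (cond_D4 x s i).
by rewrite E2_single_bd.
Qed.

Section Kap.
Variable kap : R -> R -> R.
Hypothesis kap_lip : forall a b a' b', (kap a b - kap a' b') ^+ 2 <=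
  2 * (a ^+ 2 * (b - b') ^+ 2 + (a - a') ^+ 2 * b' ^+ 2).
Hypothesis kap_le : forall a b, kap a b ^+ 2 <= a ^+ 2 * b ^+ 2.

Definition Kf i (w : Om) := Ew mu (fun s => kap (Ginc i w s) (Dinc i w s)).

Lemma Kf_fluct : Ex (fun w => (\sum_i (Kf i w - Ei mu i (Kf i) w)) ^+ 2) <=
  4000 * Qfluct.
Proof.
pose b := 32 * (n.-1%:R ^+ 2 * E2 (fun x s => (deg1 x - deg1 s) ^+ 2 * pair_m2 x s) +
  n.-1%:R * E2 (fun x s => pair_m2 x s ^+ 2) + 2 * E2 pair_m4).
have dm_ge0 : 0 <= E2 (fun x s => (deg1 x - deg1 s) ^+ 2 * pair_m2 x s).
  by apply: E2_ge0 => x s; rewrite mulr_ge0 ?sqr_ge0 ?pair_m2_ge0.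
have /andP[k0 kn] := pred_natr_le.
have b0 : 0 <= b.
  by rewrite /b mulr_ge0// !addr_ge0// ?mulr_ge0 ?exprn_ge0.
apply: le_trans (Ex_sum_sqr_le mu_prob (phi := fun i w => Kf i w - Ei mu i (Kf i) w)
  (a := bound_single) (b := b) _ _ _ b0) _.
- by move=> i w; rewrite EiB Ei_idem// subrr.
- move=> i; apply: le_trans (Ex_sub_Ei_sqr mu_prob _ _) _.
  apply: le_trans (_ : Ex (fun w => Ew mu (fun s => Ginc i w s ^+ 2 * Dinc i w s ^+ 2)) <= _).
    apply: Ew_le => [|w]; first exact: Pex.
    apply: le_trans (Ew_sqr mu_prob _) _.
    by apply: Ew_le => // s; exact: kap_le.
  rewrite (Ex_cond (i := i) (L := fun x s w => Gc x s i w ^+ 2 * Dc x s i w ^+ 2)); last first.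
    by move=> x s w t; rewrite Dc_upd Gc_upd.
  apply: le_trans (E2_le (g := single_bd) _) _; first by move=> x s; exact: (cond_G2D2 x s i).
  by rewrite E2_single_bd.
- move=> i l il.
  (* As [Ei i] and [Ei l] commute, the change of the centred function under averaging over l is [Y]
     minus its own projection; removing that projection only decreases the second moment. *)
  pose Y w := Kf i w - Ei mu l (Kf i) w.
  rewrite (eq_Ew _ (g := fun w => (Y w - Ei mu i Y w) ^+ 2)); last first.
    by move=> w; rewrite /Y !EiB EiC; congr (_ ^+ 2); ring.
  apply: le_trans (Ex_sub_Ei_sqr mu_prob _ _) _.
  apply: le_trans (Ex_sub_Ei_upd mu_prob _ _) _.
  apply: le_trans (_ : Ex (fun w => Ew mu (fun s => Ew mu (fun t =>
     (kap (Ginc i w s) (Dinc i w s) -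
      kap (Gc (w i) s i (upd w l t)) (Dc (w i) s i (upd w l t))) ^+ 2))) <= _).
    apply: Ew_le => [|w]; first exact: Pex.
    rewrite exchange_Ew; apply: Ew_le => // t.
    rewrite /Kf -EwB; apply: le_trans (Ew_sqr mu_prob _) _.
    apply: Ew_le => // s.
    by rewrite /Ginc /Dinc upd_other.
  rewrite (Ex_cond (i := i) (L := fun x s w => Ew mu (fun t =>
     (kap (Gc x s i w) (Dc x s i w) -
      kap (Gc x s i (upd w l t)) (Dc x s i (upd w l t))) ^+ 2))); last first.
    by move=> x s w u; apply: eq_Ew => t; rewrite updC// !Dc_upd !Gc_upd.
  apply: le_trans (E2_le (g := resample_bd) _) _; first by move=> x s; exact: cond_resample.
  by rewrite /b -E2_lin -E2Z.
rewrite card_ord.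
have := bound_single_le.
rewrite /b /Qfluct.
have [n0|n0] := posnP n; first by rewrite !n0 mulr0n !expr0n /= !mul0r; lra.
have n1 : 1 <= (n%:R : R) by rewrite ler1n.
have h2 : n.-1%:R ^+ 2 <= n%:R ^+ 2 :> R by rewrite lerXn2r ?nnegrE.
have i1 := ler_wpM2r dm_ge0 h2.
have i2 := ler_wpM2r m22_ge0 kn.
have j1 := ler_wpM2l (exprn_ge0 5 (ler0n R n)) E2_diff4.
have j2 := ler_wpM2l (exprn_ge0 3 (ler0n R n)) E2_m2_sqr.
have j3 := ler_wpM2l (exprn_ge0 2 (ler0n R n)) E2_m4.
(* The mixed term of [resample_bd] is absorbed by the geometric mean of the n^5 and n^3 terms. *)
have am : 2 * n%:R ^+ 4 * E2 (fun x s => (deg1 x - deg1 s) ^+ 2 * pair_m2 x s) <=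
   n%:R ^+ 5 * E2 (fun x s => (deg1 x - deg1 s) ^+ 4) + n%:R ^+ 3 * E2 (fun x s => pair_m2 x s ^+ 2).
  rewrite -!E2Z -E2D; apply: E2_le => x s.
  set D := deg1 x - deg1 s; set m := pair_m2 x s; set N := n%:R.
  have N0 : 0 <= N ^+ 3 by rewrite exprn_ge0.
  have := mulr_ge0 N0 (sqr_ge0 (N * D ^+ 2 - m)); nra.
have := ler_wpM2l (exprn_ge0 2 (ler0n R n)) i1; have := ler_wpM2l (exprn_ge0 2 (ler0n R n)) i2.
move: (n%:R) n1 => N n1 in j1 j2 j3 am *.
have p0 : 0 <= N ^+ 5 * Ew mu (fun x => cdeg x ^+ 4).
  by rewrite mulr_ge0 ?exprn_ge0 ?Ew_ge0//; [lra|move=> t; exact: exprn_even4_ge0].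
have p1 : 0 <= N ^+ 3 * Ew mu (fun x => vdeg x ^+ 2).
  by rewrite mulr_ge0 ?exprn_ge0 ?Ew_ge0//; [lra|move=> t; exact: sqr_ge0].
have p2 : 0 <= N ^+ 2 * Ew mu vdeg.
  rewrite mulr_ge0 ?exprn_ge0 ?Ew_ge0//; [lra|move=> t].
  by apply: Ew_ge0 => // y; exact: sqr_ge0.
lra.
Qed.

End Kap.


(** * The conditional means: a quadratic form in the covariance kernel *)

Definition cov y z := Ew mu (fun x => e y x * e z x) - deg1 y * deg1 z.
Definition tau y := Ew mu (cov y).
Definition cov1 := Ew mu tau.

Lemma cov_sym y z : cov y z = cov z y.
Proof. by rewrite /cov mulrC; congr (_ - _); apply: eq_Ew => x; rewrite mulrC. Qed.

Lemma cov_diag y : cov y y = vdeg y.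
Proof. by rewrite /vdeg /deg1 Ew_var. Qed.

Lemma Ew_sym y : Ew mu (fun x => e x y) = deg1 y.
Proof. by apply: eq_Ew => x. Qed.

(** x and s are independent copies, so the product of differences averages to twice the covariance
    of the adjacencies of y and z to one random vertex. *)
Lemma E2_dif_dif y z : E2 (fun x s => dif x s y * dif x s z) = 2 * cov y z.
Proof.
rewrite (eq_Ew _ (g := fun x => e y x * e z x + (- deg1 z * e y x + (- deg1 y * e z x + Ew mu (fun s => e y s * e z s))))).
  by rewrite !EwD !EwZ (Ew_cst mu_prob) /cov /deg1; ring.
move=> x; rewrite (eq_Ew _ (g := fun s => e y x * e z x + (- e y x * e z s + (- e z x * e y s + e y s * e z s)))).
  by rewrite !EwD (Ew_cst mu_prob) !EwZ /deg1; ring.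
by move=> s; rewrite /dif (e_sym x) (e_sym s) (e_sym x) (e_sym s); ring.
Qed.

Lemma E2_deg_dif y : E2 (fun x s => (deg1 x - deg1 s) * dif x s y) = 2 * tau y.
Proof.
rewrite /tau -EwZ [RHS](eq_Ew _ (g := fun z => E2 (fun x s => dif x s y * dif x s z))).
  rewrite [RHS]exchange_Ew; apply: eq_Ew => x; rewrite [RHS]exchange_Ew; apply: eq_Ew => s.
  by rewrite EwZ /dif EwB mulrC.
by move=> z; rewrite E2_dif_dif.
Qed.

Definition Umean i (w : Om) := E2 (fun x s => Gc x s i w * Dc x s i w).

Lemma Ei_Kf kap i (w : Om) : Ei mu i (Kf kap i) w =
  E2 (fun x s => kap (Gc x s i w) (Dc x s i w)).
Proof.
apply: eq_Ew => x; apply: eq_Ew => s.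
by rewrite /Ginc /Dinc upd_same Gc_upd Dc_upd.
Qed.

(** As G is half of D plus its drift, D times D yields the quadratic form and drift times D the
    linear one; the factor 2 of [E2_dif_dif] and [E2_deg_dif] cancels the half. *)
Lemma UmeanE i (w : Om) : Umean i w =
  \sum_(j | j != i) \sum_(k | k != i) cov (w j) (w k) +
  n.-1%:R * \sum_(j | j != i) tau (w j).
Proof.
rewrite /Umean.
transitivity (2^-1 * E2 (fun x s => Dc x s i w * Dc x s i w) +
   (2^-1 * n.-1%:R) * E2 (fun x s => (deg1 x - deg1 s) * Dc x s i w)).
  rewrite -!E2Z -E2D; apply: eq_Ew => x; apply: eq_Ew => s.
  by rewrite /Gc; field.
have -> : E2 (fun x s => Dc x s i w * Dc x s i w) =
   2 * \sum_(j | j != i) \sum_(k | k != i) cov (w j) (w k).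
  transitivity (\sum_(j | j != i) \sum_(k | k != i) E2 (fun x s => dif x s (w j) * dif x s (w k))).
    under [RHS]eq_bigr => j _.
      rewrite -Ew_sum (eq_Ew _ (g := fun x => Ew mu (fun s => dif x s (w j) * Dc x s i w))).
        over.
      by move=> x; rewrite -Ew_sum; apply: eq_Ew => s; rewrite mulr_sumr.
    rewrite -Ew_sum; apply: eq_Ew => x; rewrite -Ew_sum; apply: eq_Ew => s.
    by rewrite -mulr_suml.
  rewrite mulr_sumr; apply: eq_bigr => j _; rewrite mulr_sumr; apply: eq_bigr => k _.
  by rewrite E2_dif_dif.
have -> : E2 (fun x s => (deg1 x - deg1 s) * Dc x s i w) = 2 * \sum_(j | j != i) tau (w j).
  rewrite mulr_sumr; under [RHS]eq_bigr => j _ do rewrite -E2_deg_dif.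
  rewrite -Ew_sum; apply: eq_Ew => x; rewrite -Ew_sum; apply: eq_Ew => s.
  by rewrite mulr_sumr.
by field.
Qed.

Lemma Ex_cond1 i (L : T -> Om -> R) : (forall x w t, L x (upd w i t) = L x w) ->
  Ex (fun w : Om => L (w i) w) = Ew mu (fun x => Ex (L x)).
Proof.
move=> hL; rewrite -(Ex_Ei mu_prob i) exchange_Ew; apply: eq_Ew => w.
by apply: eq_Ew => x; rewrite upd_same hL.
Qed.

Lemma Ex_coord i (f : T -> R) : Ex (fun w : Om => f (w i)) = Ew mu f.
Proof.
rewrite (Ex_cond1 (i := i) (L := fun x _ => f x))//.
by apply: eq_Ew => x; rewrite (Ew_cst Pex).
Qed.

Lemma Ex_coord2 i j (f : T -> T -> R) : i != j ->
  Ex (fun w : Om => f (w i) (w j)) = E2 f.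
Proof.
move=> ij; rewrite (Ex_cond1 (i := i) (L := fun x w => f x (w j))).
  by apply: eq_Ew => x; rewrite Ex_coord.
by move=> x w t; rewrite upd_other// eq_sym.
Qed.

(* The completely degenerate Hoeffding component of [cov]. *)
Definition cov0 y z := cov y z - tau y - tau z + cov1.

Lemma cov0_mean0 y : Ew mu (fun x => cov0 x y) = 0.
Proof.
transitivity (Ew mu (fun x => cov y x + (- tau x + (cov1 - tau y)))).
  by apply: eq_Ew => x; rewrite /cov0 cov_sym; ring.
rewrite EwD (EwD _ (fun x => - tau x)) EwN (Ew_cst mu_prob) -/(tau y) -/cov1; ring.
Qed.

Lemma cov0_sym y z : cov0 y z = cov0 z y.
Proof. by rewrite /cov0 cov_sym; ring. Qed.

Lemma E2_cov0_sqr : E2 (fun y z => cov0 y z ^+ 2) <= 16 * E2 (fun y z => cov y z ^+ 2).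
Proof.
have t2 : Ew mu (fun y => tau y ^+ 2) <= E2 (fun y z => cov y z ^+ 2).
  by apply: Ew_le => // y; exact: Ew_sqr.
have s2 : cov1 ^+ 2 <= Ew mu (fun y => tau y ^+ 2) by exact: Ew_sqr.
apply: le_trans (E2_le (g := fun y z => (4 * cov y z ^+ 2 + 4 * tau y ^+ 2) +
  (4 * tau z ^+ 2 + 4 * cov1 ^+ 2)) _) _.
  move=> y z; rewrite /cov0.
  set a := cov y z; set b := tau y; set c := tau z; set d := cov1.
  have := sqr_ge0 (a + b); have := sqr_ge0 (a + c); have := sqr_ge0 (a - d).
  have := sqr_ge0 (b - c); have := sqr_ge0 (b + d); have := sqr_ge0 (c + d); nra.
have cst : E2 (fun x s => 4 * cov1 ^+ 2) = 4 * cov1 ^+ 2.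
  by rewrite -[RHS](Ew_cst mu_prob); apply: eq_Ew => x; rewrite (Ew_cst mu_prob).
rewrite !E2D cst !E2Z; set X := E2 (fun y z => cov y z ^+ 2) in t2 *.
have -> : E2 (fun x s => tau x ^+ 2) = Ew mu (fun y => tau y ^+ 2).
  by apply: eq_Ew => x; rewrite (Ew_cst mu_prob).
have -> : E2 (fun x s => tau s ^+ 2) = Ew mu (fun y => tau y ^+ 2).
  by rewrite (Ew_cst mu_prob).
lra.
Qed.

Lemma iid_sum_sqr (eta : T -> R) (A : pred 'I_n) : Ew mu eta = 0 ->
  Ex (fun w : Om => (\sum_(j | A j) eta (w j)) ^+ 2) = #|A|%:R * Ew mu (fun y => eta y ^+ 2).
Proof.
move=> eta0; have := iid_sum_moments mu_prob eta0 (enum_uniq A).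
rewrite -cardE => -[_ h2 _].
by rewrite -[RHS]h2; apply: eq_Ew => w; rewrite big_enum.
Qed.

Lemma card_le (A : pred 'I_n) : (#|A|%:R : R) <= n%:R.
Proof. by rewrite ler_nat -[leqRHS]card_ord max_card. Qed.

(** A degenerate U-statistic: the part attached to k has mean zero in [w k], and resampling l
    affects only its term [cov0 (w l) (w k)]. The almost-orthogonality bound applies once more, with
    n * X on the diagonal and X off it. *)
Lemma cov0_double_sum i :
  Ex (fun w : Om => (\sum_(k | k != i) \sum_(j | (j != i) && (j != k)) cov0 (w j) (w k)) ^+ 2)
  <= 2 * n%:R ^+ 2 * E2 (fun y z => cov0 y z ^+ 2).
Proof.
(* The excluded vertex gets the value 0, so that the family is indexed by all of ['I_n]. *)
pose phi k (w : Om) := if k == i then 0 else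
  \sum_(j | (j != i) && (j != k)) cov0 (w j) (w k).
set X := E2 _; have X0 : 0 <= X by apply: E2_ge0 => x s; exact: sqr_ge0.
rewrite (eq_Ew _ (g := fun w : Om => (\sum_k phi k w) ^+ 2)); last first.
  move=> w; congr (_ ^+ 2); rewrite [RHS](bigD1 i)//= {1}/phi eqxx add0r.
  by apply: eq_bigr => k /negbTE ki; rewrite /phi ki.
apply: le_trans (Ex_sum_sqr_le mu_prob (phi := phi) (a := n%:R * X) (b := X) _ _ _ X0) _.
- move=> k w; rewrite /Ei /phi; case: eqP => [_|_]; first by rewrite (Ew_cst mu_prob).
  rewrite Ew_sum big1 // => j /andP[_ jk].
  rewrite -[RHS](cov0_mean0 (w j)); apply: eq_Ew => s.
  by rewrite upd_same upd_other// cov0_sym.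
- move=> k; rewrite /phi; case: eqP => [_|_].
    by rewrite (eq_Ew _ (g := fun=> 0)) ?(Ew_cst Pex) ?mulr_ge0// => w; rewrite expr0n.
  rewrite (Ex_cond1 (i := k) (L := fun x w => (\sum_(j | (j != i) && (j != k)) cov0 (w j) x) ^+ 2)).
    rewrite /X [in leRHS]exchange_Ew -EwZ; apply: Ew_le => // x.
    rewrite (iid_sum_sqr (fun j => (j != i) && (j != k)) (cov0_mean0 x)).
    by apply: ler_wpM2r; rewrite ?card_le// Ew_ge0// => y; exact: sqr_ge0.
  move=> x w t; congr (_ ^+ 2); apply: eq_bigr => j /andP[_ jk].
  by rewrite upd_other.
- move=> k l kl.
  have [ki|ki] := boolP (k == i).
    rewrite (eq_Ew _ (g := fun=> 0)) ?(Ew_cst Pex)// => w.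
    by rewrite /Ei /phi ki (Ew_cst mu_prob) subrr expr0n.
  have [/eqP li|li] := boolP (l == i).
    rewrite (eq_Ew _ (g := fun=> 0)) ?(Ew_cst Pex)// => w.
    rewrite Ei_inv ?subrr ?expr0n// => s; rewrite /phi (negbTE ki).
    apply: eq_bigr => j /andP[ji jk].
    by rewrite !upd_other// li.
  rewrite (eq_Ew _ (g := fun w : Om => cov0 (w l) (w k) ^+ 2)).
    by rewrite (Ex_coord2 (fun x y => cov0 x y ^+ 2)) // eq_sym.
  move=> w; congr (_ ^+ 2); rewrite -[LHS](Ew_cst mu_prob) (Ew_cst mu_prob).
  rewrite /Ei {2}/phi (negbTE ki) /phi (negbTE ki).
  rewrite (bigD1 l) /=; last by rewrite li eq_sym kl.
  rewrite (eq_Ew _ (g := fun s => cov0 s (w k) + \sum_(j | (j != i) && (j != k) && (j != l)) cov0 (w j) (w k))).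
    by rewrite EwD cov0_mean0 (Ew_cst mu_prob); ring.
  move=> s; rewrite (bigD1 l) /=; last by rewrite li eq_sym kl.
  rewrite upd_same upd_other//; congr (_ + _).
  by apply: eq_bigr => j /andP[/andP[_ jk] jl]; rewrite !upd_other.
- by rewrite card_ord le_eqVlt; apply/orP; left; apply/eqP; ring.
Qed.

Hypothesis n_ge2 : (2 <= n)%N.

Definition Uconst := n.-1%:R * (Ew mu vdeg + (2 * n.-1%:R - 1) * cov1).

Lemma Umean_decomp i (w : Om) : Umean i w - Uconst =
  \sum_(k | k != i) \sum_(j | (j != i) && (j != k)) cov0 (w j) (w k) +
  ((3 * n.-1%:R - 2) * \sum_(j | j != i) (tau (w j) - cov1) +
   \sum_(j | j != i) (vdeg (w j) - Ew mu vdeg)).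
Proof.
have card1 : #|(fun j : 'I_n => j != i)| = n.-1 by rewrite (card_neq i).
have card2 k : k != i -> (#|[pred j : 'I_n | (j != i) && (j != k)]|%:R : R) = n.-1%:R - 1.
  move=> ki; have := cardD1 k (fun j => j != i); rewrite card1 unfold_in ki /=.
  move=> ->; rewrite natrD /= addrAC subrr add0r; congr _%:R; apply: eq_card => j.
  by rewrite !inE unfold_in andbC.
rewrite UmeanE !sumrB !sumr_const card1.
have -> : \sum_(j | j != i) \sum_(k | k != i) cov (w j) (w k) =
   \sum_(j | j != i) vdeg (w j) +
   \sum_(k | k != i) \sum_(j | (j != i) && (j != k)) cov0 (w j) (w k) +
   2 * (n.-1%:R - 1) * \sum_(j | j != i) tau (w j) - n.-1%:R * (n.-1%:R - 1) * cov1.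
  rewrite exchange_big /=.
  transitivity (\sum_(k | k != i) (vdeg (w k) + (\sum_(j | (j != i) && (j != k)) cov0 (w j) (w k)
      + (\sum_(j | j != i) tau (w j) - tau (w k) + (n.-1%:R - 1) * (tau (w k) - cov1))))).
    apply: eq_bigr => k ki; rewrite (bigD1 k)//= cov_diag; congr (_ + _).
    rewrite (bigD1 (P := fun j => j != i) k)//= [tau (w k) + _ - _]addrAC subrr add0r.
    have cs (c : R) : (n.-1%:R - 1) * c = \sum_(j | (j != i) && (j != k)) c.
      by rewrite -(card2 k)// mulr_natl -sumr_const; apply: eq_bigl.
    rewrite cs -!big_split /=; apply: eq_bigr => j _.
    by rewrite /cov0; ring.
  rewrite !big_split /= -mulr_sumr !sumrB !sumr_const card1 -(mulr_natl cov1) -(mulr_natl (\sum_(j | j != i) tau (w j))) sumrN.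
  ring.
rewrite -(mulr_natl cov1) -(mulr_natl (Ew mu vdeg)) /Uconst; ring.
Qed.

Lemma sum_sqr_le (I : finType) (b : I -> R) :
  (\sum_i b i) ^+ 2 <= #|I|%:R * \sum_i b i ^+ 2.
Proof.
rewrite expr2 mulr_suml.
apply: le_trans (_ : \sum_i \sum_j 2^-1 * (b i ^+ 2 + b j ^+ 2) <= _).
  apply: ler_sum => i _; rewrite mulr_sumr; apply: ler_sum => j _.
  by have := sqr_ge0 (b i - b j); nra.
rewrite (eq_bigr (fun i => 2^-1 * (#|I|%:R * b i ^+ 2 + \sum_j b j ^+ 2))).
  rewrite -mulr_sumr big_split /= -mulr_sumr sumr_const.
  by rewrite -(mulr_natl (\sum_i b i ^+ 2)); lra.
by move=> i _; rewrite -mulr_sumr big_split /= sumr_const -(mulr_natl (b i ^+ 2)).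
Qed.

(** 96 = 3 * 2 * 16 and 27 = 3 * 9: splitting a square in three costs 3, [cov0_double_sum] costs 2,
    [E2_cov0_sqr] costs 16, and the squared coefficient of [tau] is at most 9 n^2. *)
Lemma Umean_var i : Ex (fun w : Om => (Umean i w - Uconst) ^+ 2) <=
  96 * (n%:R ^+ 2 * E2 (fun y z => cov y z ^+ 2)) +
  (27 * (n%:R ^+ 3 * Ew mu (fun y => tau y ^+ 2)) + 3 * (n%:R * Ew mu (fun y => vdeg y ^+ 2))).
Proof.
have tau0 : Ew mu (fun y => tau y - cov1) = 0 by rewrite EwB (Ew_cst mu_prob) subrr.
have v0 : Ew mu (fun y => vdeg y - Ew mu vdeg) = 0 by rewrite EwB (Ew_cst mu_prob) subrr.
pose A (w : Om) := \sum_(k | k != i) \sum_(j | (j != i) && (j != k)) cov0 (w j) (w k).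
pose B (w : Om) := \sum_(j | j != i) (tau (w j) - cov1).
pose C (w : Om) := \sum_(j | j != i) (vdeg (w j) - Ew mu vdeg).
pose c : R := 3 * n.-1%:R - 2.
apply: le_trans (_ : Ex (fun w : Om => 3 * A w ^+ 2 + (3 * c ^+ 2 * B w ^+ 2 + 3 * C w ^+ 2)) <= _).
  apply: Ew_le => [|w]; first exact: Pex.
  rewrite Umean_decomp -/(A w) -/(B w) -/(C w) -/c.
  move: (A w) (C w) (B w) => a b d.
  have := sqr_ge0 (a - c * d); have := sqr_ge0 (a - b); have := sqr_ge0 (c * d - b); nra.
rewrite EwD EwD !EwZ.
have hA := cov0_double_sum i; rewrite -/(A _) in hA.
have hA2 := ler_wpM2l (sqr_ge0 (n%:R : R)) E2_cov0_sqr.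
have hB := iid_sum_sqr (fun j => j != i) tau0.
have hC := iid_sum_sqr (fun j => j != i) v0.
have /andP[k0 kn] := pred_natr_le.
have vB := Ew_var mu_prob tau; have vC := Ew_var mu_prob vdeg.
rewrite -/cov1 in vB.
rewrite -/(B _) in hB; rewrite -/(C _) in hC.
rewrite (card_neq i) in hB hC.
have t0 : 0 <= Ew mu (fun y => tau y ^+ 2) by apply: Ew_ge0 => // t; exact: sqr_ge0.
have w0 : 0 <= Ew mu (fun y => vdeg y ^+ 2) by apply: Ew_ge0 => // t; exact: sqr_ge0.
have c2 : c ^+ 2 <= 9 * n%:R ^+ 2.
  have k1 : 1 <= (n.-1%:R : R) by rewrite ler1n -ltnS prednK// ltnW.
  by rewrite /c; nra.
have hB' : Ex (fun w : Om => B w ^+ 2) <= n%:R * Ew mu (fun y => tau y ^+ 2).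
  rewrite hB vB; apply: ler_pM => //; last by have := sqr_ge0 cov1; lra.
  by rewrite -vB; apply: Ew_ge0 => // t; exact: sqr_ge0.
have hC' : Ex (fun w : Om => C w ^+ 2) <= n%:R * Ew mu (fun y => vdeg y ^+ 2).
  rewrite hC vC; apply: ler_pM => //; last by have := sqr_ge0 (Ew mu vdeg); lra.
  by rewrite -vC; apply: Ew_ge0 => // t; exact: sqr_ge0.
have B0 : 0 <= Ex (fun w : Om => B w ^+ 2) by apply: Ew_ge0 => [|t]; [exact: Pex|exact: sqr_ge0].
have := ler_pM (sqr_ge0 c) B0 c2 hB'.
lra.
Qed.

Lemma Ex_Umean i : Ex (Umean i) = Uconst.
Proof.
apply/eqP; rewrite -subr_eq0 -[X in _ - X](Ew_cst Pex) -EwB; apply/eqP.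
rewrite (eq_Ew _ (Umean_decomp i)) EwD EwD EwZ.
have -> : Ex (fun w : Om => \sum_(k | k != i) \sum_(j | (j != i) && (j != k)) cov0 (w j) (w k)) = 0.
  rewrite Ew_sum big1// => k _; rewrite Ew_sum big1// => j /andP[_ jk].
  rewrite (Ex_coord2 cov0)// exchange_Ew -[RHS](Ew_cst mu_prob).
  by apply: eq_Ew => y; rewrite cov0_mean0.
have -> : Ex (fun w : Om => \sum_(j | j != i) (tau (w j) - cov1)) = 0.
  rewrite Ew_sum big1// => j _; rewrite (Ex_coord j (fun y => tau y - cov1)).
  by rewrite EwB (Ew_cst mu_prob) subrr.
have -> : Ex (fun w : Om => \sum_(j | j != i) (vdeg (w j) - Ew mu vdeg)) = 0.
  rewrite Ew_sum big1// => j _; rewrite (Ex_coord j (fun y => vdeg y - Ew mu vdeg)).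
  by rewrite EwB (Ew_cst mu_prob) subrr.
by rewrite mulr0 !addr0.
Qed.

Definition Vf (w : Om) := 2^-1 * \sum_i Kf ( *%R) i w.
Definition Vconst := 2^-1 * (n%:R * Uconst).
Definition Qall := Qfluct + n%:R ^+ 4 * E2 (fun y z => cov y z ^+ 2) +
  n%:R ^+ 5 * Ew mu (fun y => tau y ^+ 2).

Lemma mul_lip (a b a' b' : R) : (a * b - a' * b') ^+ 2 <=
  2 * (a ^+ 2 * (b - b') ^+ 2 + (a - a') ^+ 2 * b' ^+ 2).
Proof.
rewrite (_ : a * b - a' * b' = a * (b - b') + (a - a') * b'); last by ring.
have := sqr_ge0 (a * (b - b') - (a - a') * b'); nra.
Qed.

Lemma norm_mul_lip (a b a' b' : R) : (`|a| * b - `|a'| * b') ^+ 2 <=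
  2 * (a ^+ 2 * (b - b') ^+ 2 + (a - a') ^+ 2 * b' ^+ 2).
Proof.
apply: le_trans (mul_lip _ _ _ _) _; rewrite real_normK ?num_real//.
rewrite ler_wpM2l// lerD2l ler_wpM2r ?sqr_ge0//.
rewrite -[leLHS]real_normK ?num_real// -[leRHS]real_normK ?num_real//.
by rewrite ler_sqr ?nnegrE// ler_dist_dist.
Qed.

Lemma norm_mul_le (a b : R) : (`|a| * b) ^+ 2 <= a ^+ 2 * b ^+ 2.
Proof. by rewrite exprMn real_normK ?num_real. Qed.

Lemma mul_le (a b : R) : (a * b) ^+ 2 <= a ^+ 2 * b ^+ 2.
Proof. by rewrite exprMn. Qed.

Lemma Qfluct_le : Qfluct <= Qall.
Proof.
rewrite /Qall -addrA lerDl; apply: addr_ge0; rewrite mulr_ge0 ?exprn_ge0//.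
  by apply: E2_ge0 => x s; exact: sqr_ge0.
by apply: Ew_ge0 => // t; exact: sqr_ge0.
Qed.

(** Two sources of fluctuation: the summands around their means over the resampled vertex ([A], by
    almost orthogonality), and these means around the constant ([B], by Cauchy-Schwarz over the
    vertices). *)
Lemma Vf_fluct : Ex (fun w : Om => (Vf w - Vconst) ^+ 2) <= 2100 * Qall.
Proof.
pose A (w : Om) := \sum_i (Kf ( *%R) i w - Ei mu i (Kf ( *%R) i) w).
pose B (w : Om) := \sum_i (Umean i w - Uconst) ^+ 2.
apply: le_trans (_ : Ex (fun w : Om => 2^-1 * A w ^+ 2 + (2^-1 * n%:R) * B w) <= _).
  apply: Ew_le => [|w]; first exact: Pex.
  have h := sum_sqr_le (fun i : 'I_n => Umean i w - Uconst).
  rewrite card_ord -/(B w) in h.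
  have -> : Vf w - Vconst = 2^-1 * (A w + \sum_i (Umean i w - Uconst)).
    rewrite -big_split /= (eq_bigr (fun i => Kf ( *%R) i w - Uconst)).
      by rewrite sumrB sumr_const card_ord mulrBr /Vconst mulr_natl.
    by move=> i _; rewrite Ei_Kf /Umean; ring.
  move: (\sum_i _) h => b h; have := sqr_ge0 (A w - b); nra.
rewrite EwD !EwZ.
have hA := Kf_fluct mul_lip mul_le; rewrite -/(A _) in hA.
have hB : Ex B <= n%:R * (96 * (n%:R ^+ 2 * E2 (fun y z => cov y z ^+ 2)) +
  (27 * (n%:R ^+ 3 * Ew mu (fun y => tau y ^+ 2)) + 3 * (n%:R * Ew mu (fun y => vdeg y ^+ 2)))).
  rewrite Ew_sum; apply: le_trans (ler_sum _ (fun i _ => Umean_var i)) _.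
  by rewrite sumr_const card_ord -[leLHS]mulr_natl.
have := ler_wpM2l (ler0n R n) hB.
have q0 := Qfluct_le.
have p0 : 0 <= n%:R ^+ 5 * Ew mu (fun x => cdeg x ^+ 4).
  by rewrite mulr_ge0 ?exprn_ge0 ?Ew_ge0//; move=> t; exact: exprn_even4_ge0.
have p1 : 0 <= n%:R ^+ 3 * Ew mu (fun x => vdeg x ^+ 2).
  by rewrite mulr_ge0 ?exprn_ge0 ?Ew_ge0//; move=> t; exact: sqr_ge0.
have p2 : 0 <= n%:R ^+ 2 * Ew mu vdeg.
  rewrite mulr_ge0 ?exprn_ge0 ?Ew_ge0//; move=> t.
  by apply: Ew_ge0 => // y; exact: sqr_ge0.
have p3 : 0 <= n%:R ^+ 4 * E2 (fun y z => cov y z ^+ 2).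
  by rewrite mulr_ge0 ?exprn_ge0//; apply: E2_ge0 => x s; exact: sqr_ge0.
have p4 : 0 <= n%:R ^+ 5 * Ew mu (fun y => tau y ^+ 2).
  by rewrite mulr_ge0 ?exprn_ge0//; apply: Ew_ge0 => // x; exact: sqr_ge0.
move: q0 hA; rewrite /Qall /Qfluct; lra.
Qed.

(** * Stein's identity for the edge count *)

Definition Ncount (w : Om) := 2^-1 * \sum_i \sum_(j | j != i) e (w i) (w j).
Definition Fc (w : Om) := Ncount w - Ex Ncount.

Lemma Ex_Ncount : Ex Ncount = 2^-1 * (n%:R * n.-1%:R * gam).
Proof.
rewrite EwZ Ew_sum; congr (_ * _).
rewrite (eq_bigr (fun=> n.-1%:R * gam)); first by rewrite sumr_const card_ord -mulrA [RHS]mulr_natl.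
move=> i _; rewrite Ew_sum (eq_bigr (fun=> gam)).
  by rewrite sumr_const (card_neq i) mulr_natl.
by move=> j ji; rewrite (Ex_coord2 e)// eq_sym.
Qed.

Lemma Ncount_upd (w : Om) i s : Ncount w - Ncount (upd w i s) = Dinc i w s.
Proof.
have E (v : Om) : \sum_k \sum_(j | j != k) e (v k) (v j) =
  2 * \sum_(j | j != i) e (v i) (v j) + \sum_(k | k != i) \sum_(j | (j != k) && (j != i)) e (v k) (v j).
  rewrite (bigD1 i)//= mulr_natl mulr2n -addrA; congr (_ + _).
  rewrite -big_split /=; apply: eq_bigr => k ki; rewrite (bigD1 i) 1?eq_sym//=.
  by rewrite e_sym.
rewrite /Ncount !E [in X in _ - X](eq_bigr (fun j => e s (w j))); last first.
  by move=> j ji; rewrite upd_same upd_other.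
have -> : \sum_(k | k != i) \sum_(j | (j != k) && (j != i)) e (upd w i s k) (upd w i s j) =
  \sum_(k | k != i) \sum_(j | (j != k) && (j != i)) e (w k) (w j).
  by apply: eq_bigr => k ki; apply: eq_bigr => j /andP[_ ji]; rewrite !upd_other.
by rewrite /Dinc /Dc /dif sumrB; field.
Qed.

(** Each edge appears in the increments of both endpoints. The half in [Gc] corrects this, and the
    drift part restores the one-vertex terms that the half alone would undercount. *)
Lemma Fc_decomp (w : Om) : Fc w = \sum_i Ew mu (fun s => Ginc i w s).
Proof.
rewrite (eq_bigr (fun i => 2^-1 * (\sum_(j | j != i) e (w i) (w j) - \sum_(j | j != i) deg1 (w j) +
   n.-1%:R * deg1 (w i) - n.-1%:R * gam))); last first.
  move=> i _; transitivity (Ew mu (fun s => 2^-1 * (\sum_(j | j != i) e (w i) (w j) + n.-1%:R * deg1 (w i))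
    + ((- 2^-1) * \sum_(j | j != i) e s (w j) + (- 2^-1 * n.-1%:R) * deg1 s))).
    by apply: eq_Ew => s; rewrite /Ginc /Gc /Dc /dif sumrB; field.
  rewrite EwD EwD (Ew_cst mu_prob) !EwZ Ew_sum -/gam.
  have -> : \sum_(j | j != i) Ew mu (fun s => e s (w j)) = \sum_(j | j != i) deg1 (w j).
    by apply: eq_bigr => j _; exact: Ew_sym.
  by field.
rewrite -mulr_sumr sumrB big_split /= sumrB -mulr_sumr sumr_const card_ord.
have -> : \sum_i \sum_(j | j != i) deg1 (w j) = n.-1%:R * \sum_i deg1 (w i).
  rewrite (exchange_big_dep predT)//= mulr_sumr; apply: eq_bigr => j _.
  rewrite sumr_const mulr_natl -(card_neq j); congr (_ *+ _).
  by apply: eq_card => i; rewrite !unfold_in eq_sym.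
rewrite /Fc Ex_Ncount /Ncount -mulr_natl; ring.
Qed.

(** Exchanging the old and the new value at i flips the sign of A and moves h to the resampled
    point, so both halves of the increment contribute equally. Read one way it yields Stein's
    identity, read the other way it removes the increment in the Kolmogorov remainder. *)
Lemma Ex_antisym i (A : T -> T -> Om -> R) (h : Om -> R) :
  (forall x s w, A s x w = - A x s w) ->
  (forall x s w t, A x s (upd w i t) = A x s w) ->
  Ex (fun w : Om => Ew mu (fun s => A (w i) s w * (h w - h (upd w i s)))) =
  2 * Ex (fun w : Om => Ew mu (fun s => A (w i) s w) * h w).
Proof.
move=> anti inv.
have sw : Ex (fun w : Om => Ew mu (fun s => A (w i) s w * h w)) =
  - Ex (fun w : Om => Ew mu (fun s => A (w i) s w * h (upd w i s))).
  rewrite -EwN.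
  pose K (v v' : Om) := A (v i) (v' i) v * h v.
  transitivity (Ex (fun w : Om => Ew mu (fun s => K w (upd w i s)))).
    by apply: eq_Ew => w; apply: eq_Ew => s; rewrite /K upd_same.
  rewrite Ex_swap; apply: eq_Ew => w; rewrite -EwN; apply: eq_Ew => s; rewrite /K.
  by rewrite upd_same anti inv mulNr.
rewrite (eq_Ew _ (g := fun w : Om => Ew mu (fun s => A (w i) s w * h w) -
   Ew mu (fun s => A (w i) s w * h (upd w i s)))); last first.
  by move=> w; rewrite -EwB; apply: eq_Ew => s; ring.
have E : Ex (fun w : Om => Ew mu (fun s => A (w i) s w) * h w) =
    Ex (fun w : Om => Ew mu (fun s => A (w i) s w * h w)).
  by apply: eq_Ew => w; rewrite EwZr.
by rewrite EwB E; move: sw; lra.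
Qed.

Lemma Dc_anti i x s (w : Om) : Dc s x i w = - Dc x s i w.
Proof. by rewrite /Dc -sumrN; apply: eq_bigr => j _; rewrite /dif opprB. Qed.

Lemma Gc_anti i x s (w : Om) : Gc s x i w = - Gc x s i w.
Proof. by rewrite /Gc Dc_anti; field. Qed.

Lemma stein_identity (h : Om -> R) : Ex (fun w : Om => Fc w * h w) =
  2^-1 * \sum_i Ex (fun w : Om => Ew mu (fun s => Ginc i w s * (h w - h (upd w i s)))).
Proof.
rewrite (eq_Ew _ (g := fun w : Om => \sum_i Ew mu (fun s => Ginc i w s) * h w)); last first.
  by move=> w; rewrite Fc_decomp mulr_suml.
rewrite Ew_sum mulr_sumr; apply: eq_bigr => i _.
rewrite (Ex_antisym (i := i) (A := fun x s w => Gc x s i w)).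
- by rewrite [RHS]mulrA mulVf ?pnatr_eq0// [RHS]mul1r.
- by move=> x s w; exact: Gc_anti.
- by move=> x s w t; rewrite Gc_upd.
Qed.

Definition sig2 := Ex (fun w : Om => Fc w ^+ 2).

Lemma sum_GD : \sum_i Ex (fun w : Om => Ew mu (fun s => Ginc i w s * Dinc i w s)) = 2 * sig2.
Proof.
have := stein_identity Fc.
rewrite (eq_Ew _ (g := fun w : Om => Fc w ^+ 2)); last by move=> w; rewrite expr2.
rewrite -/sig2 => ->; rewrite [RHS]mulrA mulfV ?pnatr_eq0// [RHS]mul1r; apply: eq_bigr => i _.
apply: eq_Ew => w; apply: eq_Ew => s; rewrite -Ncount_upd /Fc; ring.
Qed.

(** Stein's identity applied to F itself identifies the centring of [Vf] with the variance, and
    gives the exact variance formula used for the graph. *)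
Lemma sig2_Vconst : sig2 = Vconst.
Proof.
have := sum_GD; rewrite (eq_bigr (fun=> Uconst)).
  by rewrite sumr_const card_ord -(mulr_natl Uconst) /Vconst => ->; field.
move=> i _; rewrite -(Ex_Umean i) -[LHS](Ex_Ei mu_prob i).
by apply: eq_Ew => w; rewrite (Ei_Kf ( *%R)).
Qed.

(** With d the conditional mean of D, G = (D + d)/2 gives G D - G^2 = (D^2 - d^2)/4, whose
    conditional mean is a quarter of a variance. *)
Lemma sum_G2 : \sum_i Ex (fun w : Om => Ew mu (fun s => Ginc i w s ^+ 2)) <= 2 * sig2.
Proof.
rewrite -sum_GD; apply: ler_sum => i _.
rewrite (Ex_cond (i := i) (L := fun x s w => Gc x s i w ^+ 2)); last first.
  by move=> x s w t; rewrite Gc_upd.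
rewrite (Ex_cond (i := i) (L := fun x s w => Gc x s i w * Dc x s i w)); last first.
  by move=> x s w t; rewrite Gc_upd Dc_upd.
apply: E2_le => x s.
have m : Ex (Dc x s i) = n.-1%:R * (deg1 x - deg1 s).
  rewrite Ew_sum (eq_bigr (fun=> deg1 x - deg1 s)).
    by rewrite sumr_const (card_neq i) mulr_natl.
  by move=> j _; rewrite (Ex_coord j (fun y => dif x s y)) EwB.
have := Ew_sqr Pex (Dc x s i); rewrite m => h.
rewrite -subr_ge0 -EwB (eq_Ew _ (g := fun w : Om => 4^-1 * (Dc x s i w ^+ 2 - (n.-1%:R * (deg1 x - deg1 s)) ^+ 2))).
  by rewrite EwZ EwB (Ew_cst Pex); lra.
by move=> w; rewrite /Gc; field.
Qed.

(** * Bounds for Stein's expression in terms of the fluctuations *)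

Section SteinBounds.
Variables sig r : R.
Hypothesis sig_gt0 : 0 < sig.
Hypothesis sig_sqr : sig ^+ 2 = sig2.
Hypothesis r_gt0 : 0 < r.
Hypothesis Qall_le : Qall <= r ^+ 2.

Definition Wc (w : Om) := Fc w / sig.

Let sig_neq0 : sig != 0. Proof. by rewrite gt_eqF. Qed.

Lemma Ex_abs_le (Y : Om -> R) (c : R) : 0 <= c -> Ex (fun w : Om => Y w ^+ 2) <= c ^+ 2 ->
  Ex (fun w : Om => `|Y w|) <= c.
Proof.
move=> c0 h; rewrite -ler_sqr ?nnegrE//; last first.
  by apply: Ew_ge0 => [|w]; [exact: Pex|exact: normr_ge0].
apply: le_trans (Ew_sqr Pex _) _.
apply: le_trans h; apply: Ew_le => [|w]; first exact: Pex.
by rewrite real_normK ?num_real.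
Qed.

(** 46 is an integer whose square exceeds 2100; likewise 64^2 exceeds 4000 in [Psi_dev]. *)
Lemma Vf_dev : Ex (fun w : Om => `|Vf w - sig2|) <= 46 * r.
Proof.
apply: Ex_abs_le; first by rewrite mulr_ge0// ltW.
rewrite sig2_Vconst; apply: le_trans Vf_fluct _.
rewrite exprMn; have := sqr_ge0 r; move: Qall_le; nra.
Qed.

Definition Psi (w : Om) := \sum_i Kf (fun a b => `|a| * b) i w.

Lemma Psi_dev : Ex (fun w : Om => `|Psi w|) <= 64 * r.
Proof.
apply: Ex_abs_le; first by rewrite mulr_ge0// ltW.
have h := Kf_fluct norm_mul_lip norm_mul_le.
rewrite (eq_Ew _ (g := fun w : Om => (\sum_i (Kf (fun a b => `|a| * b) i w -
  Ei mu i (Kf (fun a b => `|a| * b) i) w)) ^+ 2)); last first.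
  move=> w; congr (_ ^+ 2); apply: eq_bigr => i _; rewrite Ei_Kf.
  (* Nothing has to be subtracted: the summand is antisymmetric in (x, s), so its mean over both
     vanishes. *)
  suff -> : E2 (fun x s => `|Gc x s i w| * Dc x s i w) = 0 by rewrite subr0.
  have : E2 (fun x s => `|Gc x s i w| * Dc x s i w) =
    - E2 (fun x s => `|Gc x s i w| * Dc x s i w).
    rewrite {1}exchange_Ew -EwN; apply: eq_Ew => x; rewrite -EwN; apply: eq_Ew => s.
    by rewrite Gc_anti Dc_anti normrN mulrN.
  by lra.
apply: le_trans h _; rewrite exprMn; have := sqr_ge0 r; have := Qfluct_le.
by move: Qall_le; nra.
Qed.

Variables f fp : R -> R.
Variable B : R.
Hypothesis fp_le : forall x, `|fp x| <= B.

Let rem i (w : Om) s :=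
  f (Wc w) - f (Wc (upd w i s)) - (Wc w - Wc (upd w i s)) * fp (Wc w).

Lemma Wc_upd (w : Om) i s : Wc w - Wc (upd w i s) = Dinc i w s / sig.
Proof. by rewrite -Ncount_upd /Wc /Fc; field. Qed.

Lemma stein_expand : Ex (fun w : Om => Wc w * f (Wc w)) =
  sig ^- 2 * Ex (fun w : Om => fp (Wc w) * Vf w) +
  (2 * sig)^-1 * \sum_i Ex (fun w : Om => Ew mu (fun s => Ginc i w s * rem i w s)).
Proof.
transitivity (sig^-1 * Ex (fun w : Om => Fc w * f (Wc w))).
  by rewrite -EwZ; apply: eq_Ew => w; rewrite /Wc; ring.
rewrite stein_identity.
transitivity (sig^-1 * (2^-1 * (\sum_i Ex (fun w : Om => Ew mu (fun s =>
  sig^-1 * (Ginc i w s * Dinc i w s) * fp (Wc w))) +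
  \sum_i Ex (fun w : Om => Ew mu (fun s => Ginc i w s * rem i w s))))).
  congr (_ * (_ * _)); rewrite -big_split /=; apply: eq_bigr => i _.
  rewrite -EwD; apply: eq_Ew => w; rewrite -EwD; apply: eq_Ew => s.
  by rewrite /rem Wc_upd; ring.
have -> : \sum_i Ex (fun w : Om => Ew mu (fun s => sig^-1 * (Ginc i w s * Dinc i w s) * fp (Wc w))) =
  2 * sig^-1 * Ex (fun w : Om => fp (Wc w) * Vf w).
  rewrite -Ew_sum -EwZ; apply: eq_Ew => w.
  rewrite (eq_bigr (fun i => (sig^-1 * fp (Wc w)) * Kf ( *%R) i w)).
    by rewrite -mulr_sumr /Vf; field.
  move=> i _; rewrite -EwZ; apply: eq_Ew => s; ring.
by field.
Qed.

Lemma stein_bound (c : R) :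
  \sum_i Ex (fun w : Om => Ew mu (fun s => `|Ginc i w s| * `|rem i w s|)) <= c ->
  `|Ex (fun w : Om => fp (Wc w) - Wc w * f (Wc w))| <= 46 * B * (r / sig ^+ 2) + (2 * sig)^-1 * c.
Proof.
move=> hc; rewrite EwB stein_expand.
have -> : Ex (fun w : Om => fp (Wc w)) = sig ^- 2 * Ex (fun w : Om => fp (Wc w) * sig2).
  by rewrite EwZr -sig_sqr mulrA mulrAC mulVf ?mul1r// sqrf_eq0.
rewrite opprD addrA -mulrBr -EwB.
apply: le_trans (ler_normB _ _) _.
have s2 : 0 < sig ^- 2 by rewrite invr_gt0 exprn_gt0.
apply: lerD.
  rewrite normrM gtr0_norm//.
  rewrite (_ : 46 * B * _ = sig ^- 2 * (B * (46 * r))); last by ring.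
  apply: ler_wpM2l; first exact: ltW.
  apply: le_trans (Ew_norm Pex _) _.
  apply: le_trans (_ : Ex (fun w : Om => B * `|Vf w - sig2|) <= _).
    apply: Ew_le => [|w]; first exact: Pex.
    by rewrite -mulrBr normrM distrC ler_wpM2r.
  rewrite EwZ; apply: ler_wpM2l Vf_dev.
  exact: le_trans (fp_le 0).
rewrite normrM gtr0_norm ?invr_gt0 ?mulr_gt0//.
apply: ler_wpM2l; first by rewrite invr_ge0 mulr_ge0 ?ltW.
apply: le_trans hc; apply: le_trans (ler_norm_sum _ _ _) _.
apply: ler_sum => i _; apply: le_trans (Ew_norm Pex _) _.
apply: Ew_le => [|w]; first exact: Pex.
apply: le_trans (Ew_norm mu_prob _) _.
by apply: Ew_le => // s; rewrite normrM.
Qed.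

(** The remainder bound contains an increment of H weighted by the antisymmetric [|G| * D]. By
    [Ex_antisym] the sum becomes twice the expectation of [Psi] times H, so a bound on H suffices
    although f is not twice differentiable. *)
Lemma stein_kolmogorov (H : R -> R) (C : R) :
  (forall a b, `|f a - f b - (a - b) * fp a| <= (a - b) * (H a - H b)) ->
  (forall a, `|H a| <= C) ->
  `|Ex (fun w : Om => fp (Wc w) - Wc w * f (Wc w))| <= (46 * B + 64 * C) * (r / sig ^+ 2).
Proof.
move=> hf hH.
apply: le_trans (stein_bound (c := 2 * sig^-1 * (C * (64 * r))) _) _; last first.
  by rewrite le_eqVlt; apply/orP; left; apply/eqP; field.
apply: le_trans (_ : \sum_i Ex (fun w : Om => Ew mu (fun s => sig^-1 * (`|Ginc i w s| * Dinc i w s *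
   (H (Wc w) - H (Wc (upd w i s)))))) <= _).
  apply: ler_sum => i _; apply: Ew_le => [|w]; first exact: Pex.
  apply: Ew_le => // s; apply: le_trans (ler_wpM2l (normr_ge0 _) (hf _ _)) _.
  by rewrite Wc_upd le_eqVlt; apply/orP; left; apply/eqP; ring.
rewrite (eq_bigr (fun i => 2 * sig^-1 * Ex (fun w : Om => Kf (fun a b => `|a| * b) i w * H (Wc w)))); last first.
  move=> i _; rewrite mulrAC -(@Ex_antisym i (fun x s w => `|Gc x s i w| * Dc x s i w) (fun w : Om => H (Wc w))).
  - by rewrite mulrC -EwZ; apply: eq_Ew => w; rewrite -EwZ.
  - by move=> x s w; rewrite Gc_anti Dc_anti normrN mulrN.
  - by move=> x s w t; rewrite Gc_upd Dc_upd.
rewrite -mulr_sumr; apply: ler_wpM2l; first by rewrite mulr_ge0 ?invr_ge0 ?ltW.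
rewrite -Ew_sum; apply: le_trans (_ : Ex (fun w : Om => C * `|Psi w|) <= _).
  apply: Ew_le => [|w]; first exact: Pex.
  rewrite -mulr_suml -/(Psi w); apply: le_trans (ler_norm _) _.
  by rewrite normrM mulrC ler_wpM2r.
by rewrite EwZ ler_wpM2l ?Psi_dev//; exact: le_trans (hH 0).
Qed.

Lemma stein_wasserstein (L : R) : 0 <= L ->
  (forall a b, `|f a - f b - (a - b) * fp a| <= L * (a - b) ^+ 2) ->
  `|Ex (fun w : Om => fp (Wc w) - Wc w * f (Wc w))| <= (46 * B + 97 * L) * (r / sig ^+ 2).
Proof.
move=> L0 hf.
apply: le_trans (stein_bound (c := L / sig ^+ 2 * (193 * sig * r)) _) _; last first.
  rewrite [leRHS]mulrDl lerD2l.
  have -> : (2 * sig)^-1 * (L / sig ^+ 2 * (193 * sig * r)) = (193 / 2) * L * (r / sig ^+ 2).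
    by field.
  apply: ler_wpM2r; first by rewrite mulr_ge0 ?invr_ge0 ?exprn_ge0 ?ltW.
  by move: L0; lra.
have Ls0 : 0 <= L / sig ^+ 2 by rewrite divr_ge0// exprn_ge0// ltW.
(* Weight for |G| D^2 <= t/2 G^2 + D^4/(2t): it balances [sum_G2] against [sum_D4], giving (1 + 192)
   sig r. *)
pose t := r / sig.
have t0 : 0 < t by rewrite divr_gt0.
have t1 : 0 <= (2 * t)^-1 by rewrite invr_ge0 mulr_ge0// ltW.
apply: le_trans (_ : \sum_i Ex (fun w : Om => Ew mu (fun s => L / sig ^+ 2 * (t / 2 * Ginc i w s ^+ 2 +
   (2 * t)^-1 * Dinc i w s ^+ 4))) <= _).
  apply: ler_sum => i _; apply: Ew_le => [|w]; first exact: Pex.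
  apply: Ew_le => // s; apply: le_trans (ler_wpM2l (normr_ge0 _) (hf _ _)) _.
  rewrite Wc_upd (_ : _ * (L * _) = L / sig ^+ 2 * (`|Ginc i w s| * Dinc i w s ^+ 2)); last by field.
  apply: ler_wpM2l => //.
  set d := Dinc i w s; rewrite -[X in t / 2 * X]real_normK ?num_real//.
  set g := `|_|; rewrite -subr_ge0.
  rewrite (_ : _ - _ = (2 * t)^-1 * (t * g - d ^+ 2) ^+ 2); last by field; rewrite gt_eqF.
  exact: mulr_ge0 t1 (sqr_ge0 _).
rewrite (eq_bigr (fun i => L / sig ^+ 2 * (t / 2 * Ex (fun w : Om => Ew mu (fun s => Ginc i w s ^+ 2)) +
   (2 * t)^-1 * Ex (fun w : Om => Ew mu (fun s => Dinc i w s ^+ 4))))); last first.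
  move=> i _; rewrite -!EwZ -EwD -EwZ; apply: eq_Ew => w.
  by rewrite -!EwZ -EwD -EwZ.
rewrite -mulr_sumr; apply: ler_wpM2l => //.
rewrite big_split /= -!mulr_sumr.
have h1 : t / 2 * \sum_i Ex (fun w : Om => Ew mu (fun s => Ginc i w s ^+ 2)) <= t / 2 * (2 * sig ^+ 2).
  by rewrite sig_sqr ler_wpM2l ?sum_G2// divr_ge0 ?ltW.
have h2 : (2 * t)^-1 * \sum_i Ex (fun w : Om => Ew mu (fun s => Dinc i w s ^+ 4)) <= (2 * t)^-1 * (384 * r ^+ 2).
  apply: ler_wpM2l => //; apply: le_trans sum_D4 _.
  by rewrite ler_wpM2l//; apply: le_trans Qfluct_le _.
apply: le_trans (lerD h1 h2) _.
rewrite le_eqVlt; apply/orP; left; apply/eqP; rewrite /t; field.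
by rewrite sig_neq0 gt_eqF.
Qed.

End SteinBounds.

End Fluctuations.

(** * Gaussian calculus *)

Section RealDerivatives.
Variable R : realType.
Implicit Types f g : R -> R.

Lemma derD f g (df dg x : R) : is_derive x 1 f df -> is_derive x 1 g dg ->
  is_derive x 1 (fun t => f t + g t) (df + dg).
Proof. by move=> hf hg; exact: is_deriveD. Qed.

Lemma derM f g (df dg x : R) : is_derive x 1 f df -> is_derive x 1 g dg ->
  is_derive x 1 (fun t => f t * g t) (df * g x + f x * dg).
Proof.
move=> hf hg; apply: (is_derive_eq (is_deriveM hf hg)).
by rewrite /GRing.scale /= addrC [df * _]mulrC.
Qed.

Lemma derN f (df x : R) : is_derive x 1 f df -> is_derive x 1 (fun t => - f t) (- df).
Proof. by move=> hf; exact: is_deriveN. Qed.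

Lemma derB f g (df dg x : R) : is_derive x 1 f df -> is_derive x 1 g dg ->
  is_derive x 1 (fun t => f t - g t) (df - dg).
Proof. by move=> hf hg; apply: derD => //; exact: derN. Qed.

Lemma derC (c x : R) : is_derive x 1 (fun _ : R => c) 0.
Proof. exact: is_derive_cst. Qed.

Lemma derX (x : R) : is_derive x 1 (fun t : R => t) 1.
Proof. exact: is_derive_id. Qed.

Lemma derZ (c : R) f (df x : R) : is_derive x 1 f df ->
  is_derive x 1 (fun t => c * f t) (c * df).
Proof.
move=> hf; apply: (is_derive_eq (derM (derC c x) hf)).
by rewrite mul0r add0r.
Qed.

Lemma derV f (df x : R) : f x != 0 -> is_derive x 1 f df ->
  is_derive x 1 (fun t => (f t)^-1) (- df / f x ^+ 2).
Proof.
move=> fx hf; apply: (is_derive_eq (is_deriveV fx hf)).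
by rewrite /GRing.scale /=; field.
Qed.

Lemma der_comp f g (df dg x : R) : is_derive x 1 g dg -> is_derive (g x) 1 f df ->
  is_derive x 1 (fun t => f (g t)) (df * dg).
Proof.
move=> hg hf; apply: (is_derive_eq (is_derive1_comp hf hg)).
by rewrite /GRing.scale /=.
Qed.

Lemma der_opp f (df x : R) : is_derive (- x) 1 f df ->
  is_derive x 1 (fun t => f (- t)) (- df).
Proof.
move=> hf; apply: (is_derive_eq (der_comp (derN (derX x)) hf)).
by rewrite mulrN1.
Qed.

Lemma der_continuous f (df x : R) : is_derive x 1 f df -> {for x, continuous f}.
Proof. by move=> [hf _]; exact/differentiable_continuous/derivable1_diffP. Qed.

Lemma der_MVT f (df : R -> R) (a b : R) : a < b ->
  (forall x, a <= x <= b -> is_derive x 1 f (df x)) ->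
  exists2 c, a < c < b & f b - f a = df c * (b - a).
Proof.
move=> ab h.
have h1 x : x \in `]a, b[ -> is_derive x 1 f (df x).
  by rewrite in_itv /= => /andP[/ltW ax /ltW xb]; apply: h; rewrite ax xb.
have h2 : {within `[a, b], continuous f}.
  apply: continuous_in_subspaceT => x; rewrite inE /= in_itv /= => xab.
  exact: der_continuous (h x xab).
have [c hc e] := MVT ab h1 h2.
by exists c => //; move: hc; rewrite in_itv.
Qed.

Lemma der_ge0_le f (df : R -> R) (a b : R) : a <= b ->
  (forall x, a <= x <= b -> is_derive x 1 f (df x)) ->
  (forall x, a <= x <= b -> 0 <= df x) -> f a <= f b.
Proof.
rewrite le_eqVlt => /orP[/eqP->//|ab] h h0.
have [c /andP[/ltW ac /ltW cb] e] := der_MVT ab h.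
rewrite -subr_ge0 e mulr_ge0 ?subr_ge0 ?(ltW ab)// h0// ac cb //.
Qed.

(** All Gaussian tail inequalities below are proved this way: a nondecreasing function vanishing at
    minus infinity is nonnegative. Monotonicity makes a limit along the integers sufficient. *)
Lemma ge0_of_limNy f (df : R -> R) (w : R) :
  (forall x, x <= w -> is_derive x 1 f (df x)) ->
  (forall x, x <= w -> 0 <= df x) ->
  f (- n%:R) @[n --> \oo] --> (0 : R) -> 0 <= f w.
Proof.
move=> h h0 l.
apply: (cvgr_to_le l); near=> n.
have nw : - n%:R <= w by rewrite lerNl; near: n; exact: nbhs_infty_ger.
by apply: (der_ge0_le nw) => x /andP[_ xw]; [exact: h|exact: h0].
Unshelve. all: by end_near. Qed.

Lemma cvg_seq_eq (u v : nat -> R) (k l : R) : (forall n, u n = v n) -> k = l ->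
  v @ \oo --> k -> u @ \oo --> l.
Proof. by move=> /funext -> ->. Qed.

Lemma cvg_seqZ (c : R) (u : nat -> R) (l : R) :
  u @ \oo --> l -> c * u n @[n --> \oo] --> c * l.
Proof. by move=> h; apply: cvgM => //; exact: cvg_cst. Qed.

End RealDerivatives.

(** * Primitives and tails of the Gaussian density *)

Section GaussianPrimitives.
Variable R : realType.
Notation mu := (@lebesgue_measure R).

Definition gpdf : R -> R := normal_pdf 0 1.

Lemma gpdfE x : gpdf x = normal_peak 1 * expR (- (2^-1 * (x * x))).
Proof.
rewrite /gpdf normal_pdfE ?oner_eq0// /normal_fun subr0 expr1n.
by congr (_ * expR _); field.
Qed.

Lemma gpdf_gt0 x : 0 < gpdf x.
Proof. by rewrite gpdfE mulr_gt0 ?normal_peak_gt0 ?oner_neq0 ?expR_gt0. Qed.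

Lemma gpdf_ge0 x : 0 <= gpdf x.
Proof. exact/ltW/gpdf_gt0. Qed.

Lemma gpdf_neq0 x : gpdf x != 0.
Proof. by rewrite gt_eqF ?gpdf_gt0. Qed.

Lemma gpdfN x : gpdf (- x) = gpdf x.
Proof. by rewrite !gpdfE mulrNN. Qed.

Lemma der_gpdf (x : R) : is_derive x 1 gpdf (- x * gpdf x).
Proof.
have -> : gpdf = fun x => normal_peak 1 * expR (- (2^-1 * (x * x))).
  by apply/funext => y; exact: gpdfE.
apply: (is_derive_eq (derZ _ (der_comp (derN (derZ _ (derM (derX x) (derX x)))) (is_derive_expR _)))).
by field.
Qed.

Definition prim (f : R -> R) (t : R) : R := (\int[mu]_(x in `]-oo, t]) f x)%R.

Section Primitive.
Variable f : R -> R.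
Hypothesis cf : continuous f.
Hypothesis intf : mu.-integrable setT (EFin \o f).

Lemma der_prim (t : R) : is_derive t 1 (prim f) (f t).
Proof.
have intu : mu.-integrable `]-oo, (t + 1)] (EFin \o f).
  exact: integrableS intf.
have t1 : t < t + 1 by rewrite ltrDl.
have [d e] := @continuous_FTC1 R f -oo%O t (t + 1) t1 intu (ltNyr _) (@cf t).
by apply: DeriveDef => //; rewrite -e derive1E.
Qed.

Lemma prim_dominated (a : nat -> R) (l : R -> R) :
  mu.-integrable setT (EFin \o l) ->
  (forall x, (f \_ `]-oo, a n]) x @[n --> \oo] --> l x) ->
  prim f (a n) @[n --> \oo] --> (\int[mu]_x l x)%R.
Proof.
move=> il hl.
have mf : measurable_fun setT f by apply/measurable_EFinP; exact: measurable_int intf.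
have h : (\int[mu]_x (EFin \o (f \_ `]-oo, a n])) x)%E @[n --> \oo] --> (\int[mu]_x (EFin \o l) x)%E.
  apply: (@dominated_cvg _ _ _ mu setT measurableT _ _ (EFin \o (fun x => `|f x|))).
  - move=> n; apply/measurable_EFinP.
    by apply/(measurable_restrictT _ _).1 => //; apply: measurable_funTS.
  - by move=> x _; apply: cvg_EFin; [exact: nearW|exact: hl].
  - by [].
  - exact: integrable_norm.
  - move=> n x _ /=; rewrite lee_fin /patch; case: ifP => //.
    by rewrite normr0.
rewrite -[X in _ --> X](fineK (integrable_fin_num measurableT il)) in h.
have -> : (fun n => prim f (a n)) =
    fine \o (fun n => \int[mu]_x (EFin \o (f \_ `]-oo, a n])) x)%E.
  by apply/funext => n; rewrite /prim Rintegral_mkcond.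
exact: fine_cvg h.
Qed.

Lemma prim_cvgNy : prim f (- n%:R) @[n --> \oo] --> (0 : R).
Proof.
have -> : (0 : R) = (\int[mu]_x (cst 0 : R -> R) x)%R.
  by rewrite Rintegral_cst// mul0r.
apply: prim_dominated; first exact: integrable0.
move=> x; apply: cvg_near_cst; near=> n.
rewrite patchE ifF//; apply/negbTE; rewrite notin_setE /= in_itv /=.
apply/negP; rewrite -ltNge ltrNl; near: n; exact: nbhs_infty_gtr.
Unshelve. all: by end_near. Qed.

Lemma prim_cvgy : prim f n%:R @[n --> \oo] --> (\int[mu]_x f x)%R.
Proof.
apply: prim_dominated => //.
move=> x; apply: cvg_near_cst; near=> n.
rewrite patchE ifT//; rewrite inE /= in_itv /=.
by near: n; exact: nbhs_infty_ger.
Unshelve. all: by end_near. Qed.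

End Primitive.

Lemma continuous_gpdf : continuous gpdf.
Proof. by apply: continuous_normal_pdf; rewrite oner_eq0. Qed.

Lemma integrable_gpdf : mu.-integrable setT (EFin \o gpdf).
Proof. exact: integrable_normal_pdf. Qed.

Lemma der_Phi (t : R) : is_derive t 1 (@Phi R) (gpdf t).
Proof. exact: der_prim continuous_gpdf integrable_gpdf t. Qed.

Lemma Phi_cvgNy : Phi (- n%:R) @[n --> \oo] --> (0 : R).
Proof. exact: prim_cvgNy integrable_gpdf. Qed.

Lemma Phi_cvgy : Phi n%:R @[n --> \oo] --> (1 : R).
Proof.
have e : (\int[mu]_x gpdf x)%R = 1 by rewrite /Rintegral integral_normal_pdf.
have := prim_cvgy integrable_gpdf; rewrite e; exact.
Qed.

Lemma Phi_lt (a b : R) : a < b -> Phi a < Phi b.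
Proof.
move=> ab; have [c _ e] := der_MVT ab (fun x _ => der_Phi x).
by rewrite -subr_gt0 e mulr_gt0 ?gpdf_gt0 ?subr_gt0.
Qed.

Lemma Phi_ge0 (t : R) : 0 <= Phi t.
Proof.
by apply: (ge0_of_limNy (df := gpdf) (w := t) _ _ Phi_cvgNy) => x _;
  [exact: der_Phi|exact/ltW/gpdf_gt0].
Qed.

Lemma PhiN (t : R) : Phi (- t) = 1 - Phi t.
Proof.
pose F (x : R) := Phi x + Phi (- x).
have dF (x : R) : is_derive x 1 F 0.
  apply: (is_derive_eq (derD (der_Phi x) (der_opp (der_Phi (- x))))).
  by rewrite gpdfN subrr.
have FE : F t = 1.
  have l : F n%:R @[n --> \oo] --> (1 + 0 : R).
    by apply: cvgD; [exact: Phi_cvgy|exact: Phi_cvgNy].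
  have l' : F n%:R @[n --> \oo] --> F t.
    by apply: cvg_near_cst; apply: nearW => n; exact: is_derive_0_is_cst.
  by rewrite -[LHS](cvg_lim (@Rhausdorff R) l') (cvg_lim (@Rhausdorff R) l) addr0.
by rewrite -FE /F addrC addKr.
Qed.

Lemma Phi_le1 (t : R) : Phi t <= 1.
Proof. by have := Phi_ge0 (- t); rewrite PhiN subr_ge0. Qed.

Lemma sqr_gpdf_cvg : n%:R ^+ 2 * gpdf (- n%:R) @[n --> \oo] --> (0 : R).
Proof.
(* For n >= 1, n^2 (n+1) <= 2 n^4 = 32 (n^2/4)^2, and (n^2/4)^2 <= exp(n^2/2) since exp(n^2/4)
   exceeds n^2/4. *)
pose C : R := 32 * normal_peak 1.
have l : C * harmonic n @[n --> \oo] --> (0 : R).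
  by rewrite -[X in _ --> X](mulr0 C); apply: cvg_seqZ; exact: cvg_harmonic.
apply: (squeeze_cvgr _ (cvg_cst (0 : R)) l).
apply: nearW => n /=; rewrite mulr_ge0 ?exprn_ge0 ?gpdf_ge0//=.
rewrite gpdfN gpdfE expRN mulrCA (_ : C * _ = normal_peak 1 * (32 * n.+1%:R^-1)); last by rewrite /C; ring.
apply: ler_wpM2l; first exact: normal_peak_ge0.
set y := 2^-1 * _; rewrite ler_pdivrMr ?expR_gt0// /harmonic /=.
have [->|n0] := posnP n; first by rewrite expr0n /= mulr_ge0 ?expR_ge0 ?mulr_ge0.
have n1 : 1 <= (n%:R : R) by rewrite ler1n.
rewrite mulrAC ler_pdivlMr ?ltr0n// -[in leLHS]natr1.
have h : (n%:R ^+ 2 / 4 : R) ^+ 2 <= expR y.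
  rewrite (_ : y = y / 2 + y / 2); last by field.
  rewrite expRD -expr2 ler_sqr ?nnegrE ?expR_ge0 ?divr_ge0 ?exprn_ge0//.
  apply: le_trans (expR_ge1Dx _); rewrite /y; lra.
have h2 : (n%:R : R) ^+ 2 <= n%:R ^+ 3 by rewrite ler_weXn2l.
have h3 : (n%:R : R) ^+ 3 <= n%:R ^+ 4 by rewrite ler_weXn2l.
by move: h; nra.
Qed.

Lemma lin_gpdf_cvg : n%:R * gpdf (- n%:R) @[n --> \oo] --> (0 : R).
Proof.
apply: (squeeze_cvgr _ (cvg_cst (0 : R)) sqr_gpdf_cvg).
apply: nearW => n /=; rewrite mulr_ge0 ?gpdf_ge0//= ler_wpM2r ?gpdf_ge0//.
by rewrite -natrX ler_nat; case: n => // n; rewrite leq_pmulr.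
Qed.

Lemma gpdf_cvg : gpdf (- n%:R) @[n --> \oo] --> (0 : R).
Proof.
apply: (squeeze_cvgr _ (cvg_cst (0 : R)) lin_gpdf_cvg).
near=> n => /=; rewrite gpdf_ge0//= ler_peMl ?gpdf_ge0//.
by near: n; exact: nbhs_infty_ger.
Unshelve. all: by end_near. Qed.

Lemma Phi_le_gpdf (t : R) : t <= -1 -> Phi t <= gpdf t.
Proof.
move=> t1; rewrite -subr_ge0.
apply: (ge0_of_limNy (f := fun x => gpdf x - Phi x) (df := fun x => - x * gpdf x - gpdf x)).
- by move=> x _; apply: derB (der_gpdf x) (der_Phi x).
- move=> x xt; have := gpdf_gt0 x; have : 0 <= - x - 1 by move: xt t1; lra.
  by nra.
- exact: cvg_seq_eq (fun=> erefl) (subr0 0) (cvgB gpdf_cvg Phi_cvgNy).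
Qed.

Lemma sqr_Phi_cvg : n%:R ^+ 2 * Phi (- n%:R) @[n --> \oo] --> (0 : R).
Proof.
apply: (squeeze_cvgr _ (cvg_cst (0 : R)) sqr_gpdf_cvg).
near=> n => /=; rewrite mulr_ge0 ?Phi_ge0 ?exprn_ge0//= ler_wpM2l ?exprn_ge0//.
by apply: Phi_le_gpdf; rewrite lerN2; near: n; exact: nbhs_infty_ger.
Unshelve. all: by end_near. Qed.

Lemma lin_Phi_cvg : n%:R * Phi (- n%:R) @[n --> \oo] --> (0 : R).
Proof.
apply: (squeeze_cvgr _ (cvg_cst (0 : R)) sqr_Phi_cvg).
apply: nearW => n /=; rewrite mulr_ge0 ?Phi_ge0//= ler_wpM2r ?Phi_ge0//.
by rewrite -natrX ler_nat; case: n => // n; rewrite leq_pmulr.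
Qed.

Lemma mills1 (t : R) : 0 <= t * Phi t + gpdf t.
Proof.
apply: (ge0_of_limNy (f := fun x => x * Phi x + gpdf x) (df := @Phi R)).
- move=> x _; apply: (is_derive_eq (derD (derM (derX x) (der_Phi x)) (der_gpdf x))); ring.
- by move=> x _; exact: Phi_ge0.
- apply: cvg_seq_eq (cvgD (cvgN lin_Phi_cvg) gpdf_cvg); last by ring.
  by move=> n; rewrite !fctE; ring.
Qed.

(** Its derivative is twice the function of [mills1], whose derivative in turn is [Phi]: a ladder of
    iterated primitives of the density. *)
Lemma mills2 (t : R) : 0 <= (1 + t * t) * Phi t + t * gpdf t.
Proof.
apply: (ge0_of_limNy (f := fun x => (1 + x * x) * Phi x + x * gpdf x)
  (df := fun x => 2 * (x * Phi x + gpdf x))).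
- move=> x _; apply: (is_derive_eq (derD (derM (derD (derC 1 x) (derM (derX x) (derX x))) (der_Phi x))
   (derM (derX x) (der_gpdf x)))); ring.
- by move=> x _; rewrite mulr_ge0 ?mills1.
- apply: cvg_seq_eq (cvgB (cvgD Phi_cvgNy sqr_Phi_cvg) lin_gpdf_cvg); last by ring.
  by move=> n; rewrite !fctE; ring.
Qed.

End GaussianPrimitives.

(** * Stein's equation *)

Section SteinIndicator.
Variable R : realType.

(** Mills ratio of the lower tail; up to constant factors both branches of the Stein solution are
    this function, one of them reflected. *)
Definition mills (w : R) : R := Phi w / gpdf w.

Lemma mills_ge0 w : 0 <= mills w.
Proof. by rewrite divr_ge0 ?Phi_ge0 ?gpdf_ge0. Qed.

Lemma der_mills (w : R) : is_derive w 1 mills (1 + w * mills w).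
Proof.
apply: (is_derive_eq (derM (der_Phi w) (derV (gpdf_neq0 w) (der_gpdf w)))).
by rewrite /mills; field; exact: gpdf_neq0.
Qed.

Lemma mills_lb w : 0 <= 1 + w * mills w.
Proof.
rewrite (_ : _ + _ = (w * Phi w + gpdf w) / gpdf w).
  by rewrite divr_ge0 ?mills1 ?gpdf_ge0.
by rewrite /mills; field; exact: gpdf_neq0.
Qed.

Lemma mills_lb2 w : 0 <= (1 + w * w) * mills w + w.
Proof.
rewrite (_ : _ + _ = ((1 + w * w) * Phi w + w * gpdf w) / gpdf w).
  by rewrite divr_ge0 ?mills2 ?gpdf_ge0.
by rewrite /mills; field; exact: gpdf_neq0.
Qed.

(** The derivative is exactly the quantity of [mills_lb2]. This is the source of the monotonicity of
    w f(w). *)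
Lemma id_mills_mono a b : a <= b -> a * mills a <= b * mills b.
Proof.
move=> ab.
apply: (@der_ge0_le _ (fun x => x * mills x) (fun x => (1 + x * x) * mills x + x) _ _ ab).
- by move=> x _; apply: (is_derive_eq (derM (derX x) (der_mills x))); ring.
- by move=> x _; exact: mills_lb2.
Qed.

Variable z : R.
Notation P := (Phi z).

(** The two branches are kept as globally differentiable functions, so that the mean value theorem
    applies up to z, where they meet. *)
Definition solL (w : R) := mills w * (1 - P).
Definition solR (w : R) := mills (- w) * P.
Definition sol (w : R) := if w <= z then solL w else solR w.
Definition ind (w : R) : R := if w <= z then 1 else 0.

Let P01 : 0 <= P <= 1. Proof. by rewrite Phi_ge0 Phi_le1. Qed.

Lemma der_solL (w : R) : is_derive w 1 solL (w * solL w + 1 - P).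
Proof.
apply: (is_derive_eq (derM (der_mills w) (derC (1 - P) w))).
by rewrite /solL; ring.
Qed.

Lemma der_solR (w : R) : is_derive w 1 solR (w * solR w - P).
Proof.
apply: (is_derive_eq (derM (der_opp (der_mills (- w))) (derC P w))).
by rewrite /solR; ring.
Qed.

Lemma solLR : solL z = solR z.
Proof. by rewrite /solL /solR /mills PhiN gpdfN; ring. Qed.

Lemma id_solL_mono a b : a <= b -> a * solL a <= b * solL b.
Proof.
move=> ab; rewrite /solL mulrA [leRHS]mulrA; apply: ler_wpM2r; last exact: id_mills_mono.
by have /andP[_] := P01; lra.
Qed.

Lemma id_solR_mono a b : a <= b -> a * solR a <= b * solR b.
Proof.
move=> ab; rewrite /solR mulrA [leRHS]mulrA; apply: ler_wpM2r; first by have /andP[] := P01.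
by have := @id_mills_mono (- b) (- a); rewrite lerN2 => /(_ ab); rewrite !mulNr lerN2.
Qed.

Lemma id_sol_mono a b : a <= b -> a * sol a <= b * sol b.
Proof.
move=> ab; rewrite /sol; case: (leP a z) => az; case: (leP b z) => bz.
- exact: id_solL_mono.
- apply: le_trans (id_solL_mono az) _; rewrite solLR; exact: id_solR_mono (ltW bz).
- by have := le_lt_trans bz az; rewrite ltNge ab.
- exact: id_solR_mono.
Qed.

Lemma id_sol_bound w : `|w * sol w| <= 1.
Proof.
have /andP[p0 p1] := P01.
have lo x : x <= z -> -1 <= x * sol x.
  move=> xz; rewrite /sol xz /solL mulrA; have := mills_lb x; nra.
have hi x : z <= x -> x * solR x <= 1.
  move=> _; rewrite /solR mulrA; have := mills_lb (- x); nra.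
rewrite ler_norml; case: (leP w z) => wz.
  rewrite lo//= /sol wz; apply: le_trans (id_solL_mono wz) _.
  by rewrite solLR hi.
apply/andP; split; last by rewrite /sol [w <= z]leNgt wz hi// ltW.
by apply: le_trans (lo z (lexx z)) _; exact: id_sol_mono (ltW wz).
Qed.

Lemma slopeL b a : b <= a ->
  (a - b) * (b * solL b + 1 - P) <= solL a - solL b <= (a - b) * (a * solL a + 1 - P).
Proof.
rewrite le_eqVlt => /orP[/eqP->|ba]; first by rewrite !subrr !mul0r lexx.
have [c /andP[/ltW bc /ltW ca] ->] := der_MVT ba (fun x _ => der_solL x).
have := id_solL_mono bc; have := id_solL_mono ca; move: ba; rewrite -subr_gt0 => ba.
by move=> h1 h2; rewrite [_ * (a - b)]mulrC; apply/andP; split; apply: ler_wpM2l; lra.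
Qed.

Lemma slopeR b a : b <= a ->
  (a - b) * (b * solR b - P) <= solR a - solR b <= (a - b) * (a * solR a - P).
Proof.
rewrite le_eqVlt => /orP[/eqP->|ba]; first by rewrite !subrr !mul0r lexx.
have [c /andP[/ltW bc /ltW ca] ->] := der_MVT ba (fun x _ => der_solR x).
have := id_solR_mono bc; have := id_solR_mono ca; move: ba; rewrite -subr_gt0 => ba.
by move=> h1 h2; rewrite [_ * (a - b)]mulrC; apply/andP; split; apply: ler_wpM2l; lra.
Qed.

(** The derivative w f + ind - P has an increasing part and a decreasing one, so each bound takes
    the two at opposite ends of the interval. If z lies inside, the slopes on both sides are added,
    with monotonicity moving the values at z to the ends. *)
Lemma slope b a : b <= a ->
  (a - b) * (b * sol b + ind a - P) <= sol a - sol b <= (a - b) * (a * sol a + ind b - P).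
Proof.
move=> ba; rewrite /ind; have := @id_sol_mono; rewrite /sol => mono.
case: (leP b z) => bz; case: (leP a z) => az.
- exact: slopeL.
- have /andP[h1 h2] := slopeL bz; have /andP[h3 h4] := slopeR (ltW az).
  have m1 := mono _ _ ba; rewrite bz [a <= z]leNgt az /= in m1.
  have m2 := mono _ _ bz; rewrite bz lexx in m2.
  have m3 := mono _ _ (ltW az); rewrite lexx [a <= z]leNgt az /= in m3.
  rewrite -solLR in h3 h4.
  move: (solL b) (solL z) (solR a) h1 h2 h3 h4 m1 m2 m3 => B Z A h1 h2 h3 h4 m1 m2 m3.
  have zb : 0 <= z - b by rewrite subr_ge0.
  have az' : 0 <= a - z by rewrite subr_ge0 ltW.
  have q1 := ler_wpM2l az' m2; have q2 := ler_wpM2l zb m3.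
  by apply/andP; split; lra.
- by have := le_lt_trans az bz; rewrite ltNge ba.
- by rewrite !addr0; exact: slopeR.
Qed.

(* [solp] is the derivative f' given by Stein's equation f' - w f = ind - P, with
   [sol] for f; [solH] is nondecreasing, since w * sol w is. *)
Definition solp w := w * sol w + ind w - P.
Definition solH w := w * sol w - ind w.

Lemma ind01 w : 0 <= ind w <= 1.
Proof. by rewrite /ind; case: ifP; rewrite ?lexx ?ler01. Qed.

Lemma ind_anti a b : a <= b -> ind b <= ind a.
Proof.
move=> ab; rewrite /ind; case: (leP b z) => bz; first by rewrite (le_trans ab bz).
by case: ifP.
Qed.

Lemma solp_bound w : `|solp w| <= 2.
Proof.
have /andP[p0 p1] := P01; have /andP[i0 i1] := ind01 w.
have := id_sol_bound w; rewrite !ler_norml => /andP[a b].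
by rewrite /solp; apply/andP; split; lra.
Qed.

Lemma solH_bound w : `|solH w| <= 2.
Proof.
have /andP[i0 i1] := ind01 w.
have := id_sol_bound w; rewrite !ler_norml => /andP[a b].
by rewrite /solH; apply/andP; split; lra.
Qed.

Lemma sol_remainder a b :
  `|sol a - sol b - (a - b) * solp a| <= (a - b) * (solH a - solH b).
Proof.
rewrite /solp /solH ler_norml; have [ba|ab] := leP b a.
  have /andP[h1 h2] := slope ba.
  have m := id_sol_mono ba; have i := ind_anti ba.
  move: ba; rewrite -subr_ge0 => ba.
  have q1 := ler_wpM2l ba m; have q2 := ler_wpM2l ba i.
  by apply/andP; split; lra.
have /andP[h1 h2] := slope (ltW ab).
have m := id_sol_mono (ltW ab); have i := ind_anti (ltW ab).
move: ab; rewrite -subr_gt0 => /ltW ab.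
have q1 := ler_wpM2l ab m; have q2 := ler_wpM2l ab i.
by apply/andP; split; lra.
Qed.

End SteinIndicator.

Section GaussianExpectation.
Variable R : realType.
Notation mu := (@lebesgue_measure R).
Notation nu := (normal_prob (0 : R) 1).

(** The change of variables uses the Radon-Nikodym derivative, which agrees with the density almost
    everywhere because both have the same integrals. *)
Lemma ge0_integral_normal_prob (f : R -> \bar R) :
  (forall x, 0 <= f x)%E -> measurable_fun setT f ->
  (\int[nu]_x f x = \int[mu]_x (f x * (gpdf x)%:E))%E.
Proof.
move=> f0 mf.
have dom := normal_prob_dominates (0 : R) 1.
have mg : measurable_fun setT (EFin \o @gpdf R).
  by apply/measurable_EFinP; exact: measurable_normal_pdf.
rewrite -(Radon_Nikodym_SigmaFinite.change_of_variables dom f0 measurableT mf).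
have mrn : measurable_fun setT (Radon_Nikodym_SigmaFinite.f nu mu).
  exact: measurable_int (Radon_Nikodym_SigmaFinite.f_integrable dom).
apply: ae_eq_integral => //.
- exact: emeasurable_funM.
- exact: emeasurable_funM.
- apply: ae_eqe_mul2l; apply: integral_ae_eq => //.
  + exact: Radon_Nikodym_SigmaFinite.f_integrable.
  + by move=> A _ mA; rewrite -Radon_Nikodym_SigmaFinite.f_integral.
Qed.

Lemma integral_normal_prob (f : R -> R) : measurable_fun setT f ->
  (\int[nu]_x (f x)%:E = \int[mu]_x (f x * gpdf x)%:E)%E.
Proof.
move=> mf; rewrite integralE [RHS]integralE.
have mf' : measurable_fun setT (EFin \o f) by exact/measurable_EFinP.
rewrite !ge0_integral_normal_prob//; last 2 first.
  exact: measurable_funeneg.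
  exact: measurable_funepos.
congr (_ - _)%E; apply: eq_integral => x _.
- rewrite !funeposE -!EFin_max -EFinM; congr _%:E.
  by rewrite maxr_pMl ?gpdf_ge0// mul0r.
- rewrite !funenegE -!EFinN -!EFin_max -EFinM; congr _%:E.
  by rewrite maxr_pMl ?gpdf_ge0// mul0r mulNr.
Qed.

Lemma integrable_abs_gpdf : mu.-integrable setT (EFin \o (fun t => `|t| * gpdf t)).
Proof.
have n2 : (2 : R) != 0 by rewrite pnatr_eq0.
(* The dominating density has standard deviation 2: |t| <= 4/3 + t^2/2 <= 4/3 exp(3 t^2/8), and the
   exponents -1/2 and 3/8 add up to -1/8. *)
pose C : R := normal_peak 1 / normal_peak 2 * (4 / 3).
have p2 : 0 < normal_peak (2 : R) by rewrite normal_peak_gt0.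
apply: (@le_integrable _ _ _ mu setT measurableT _ (fun t => C%:E * (normal_pdf 0 2 t)%:E)%E).
- apply/measurable_EFinP; apply: measurable_funM; first exact: normr_measurable.
  exact: measurable_normal_pdf.
- move=> t _ /=; rewrite lee_fin ger0_norm ?mulr_ge0 ?gpdf_ge0//.
  rewrite [leRHS]ger0_norm; last first.
    by rewrite mulr_ge0 ?normal_pdf_ge0// /C !mulr_ge0 ?invr_ge0 ?normal_peak_ge0.
  rewrite gpdfE normal_pdfE// /normal_fun subr0.
  rewrite (_ : C * _ = normal_peak 1 * (4 / 3 * expR (- t ^+ 2 / (2 ^+ 2 *+ 2)))); last first.
    by rewrite /C; field; rewrite gt_eqF.
  rewrite [leLHS]mulrCA; apply: ler_wpM2l; first exact: normal_peak_ge0.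
  have -> : - t ^+ 2 / (2 ^+ 2 *+ 2) = - (2^-1 * (t * t)) + (3 / 8) * (t * t) by field.
  rewrite expRD [leRHS]mulrCA [leLHS]mulrC; apply: ler_wpM2l; first exact: expR_ge0.
  have := expR_ge1Dx (3 / 8 * (t * t)).
  have := sqr_ge0 (`|t| - 1); have : `|t| ^+ 2 = t * t by rewrite real_normK ?num_real// expr2.
  move: (`|t|) (expR _) => a b h1 h2 h3; nra.
- by apply: integrableZl => //; exact: integrable_normal_pdf.
Qed.

Lemma lipschitz1_continuous (phi : R -> R) : lipschitz1 phi -> continuous phi.
Proof.
move=> hl x; apply/cvgrPdist_lt => e e0; near=> y.
apply: le_lt_trans (hl _ _) _; near: y.
exact: (@cvgr_dist_lt _ _ _ _ _ _ x _ e e0).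
Unshelve. all: by end_near. Qed.

Lemma integrable_lipschitz_gpdf (phi : R -> R) : lipschitz1 phi ->
  mu.-integrable setT (EFin \o (fun t => phi t * gpdf t)).
Proof.
move=> hl; have cphi := lipschitz1_continuous hl.
have i1 : mu.-integrable setT (fun t => (`|phi 0|%:E * (gpdf t)%:E)%E).
  by apply: integrableZl => //; exact: integrable_gpdf.
apply: (le_integrable measurableT _ _ (integrableD measurableT i1 integrable_abs_gpdf)).
- apply/measurable_EFinP; apply: measurable_funM; last exact: measurable_normal_pdf.
  exact: continuous_measurable_fun.
- move=> t _ /=; rewrite lee_fin normrM (ger0_norm (gpdf_ge0 t)).
  rewrite [leRHS]ger0_norm -?mulrDl ?mulr_ge0 ?addr_ge0 ?gpdf_ge0//.
  rewrite ler_wpM2r ?gpdf_ge0//.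
  have := hl t 0; rewrite subr0 => h.
  by have := ler_normD (phi t - phi 0) (phi 0); rewrite subrK; lra.
Qed.

Definition abs_moment : R := (\int[mu]_t (`|t| * gpdf t))%R.

Lemma normal_expect_lipschitz (phi : R -> R) : lipschitz1 phi ->
  exists c : R, normal_expect phi = c%:E /\ `|phi 0 - c| <= abs_moment /\
    c = (\int[mu]_t (phi t * gpdf t))%R.
Proof.
move=> hl; have ip := integrable_lipschitz_gpdf hl.
have mphi : measurable_fun setT phi.
  by apply: continuous_measurable_fun; exact: lipschitz1_continuous.
exists (\int[mu]_t (phi t * gpdf t))%R; split; last split => //.
  rewrite /normal_expect integral_normal_prob// /Rintegral fineK//.
  exact: integrable_fin_num ip.
have e1 : (\int[mu]_t gpdf t)%R = 1 by rewrite /Rintegral integral_normal_pdf.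
have i0 : mu.-integrable setT (EFin \o (fun t => phi 0 * gpdf t)).
  exact: (@integrableZl _ _ _ mu setT measurableT (phi 0) _ (@integrable_gpdf R)).
have -> : phi 0 - (\int[mu]_t (phi t * gpdf t))%R =
  (\int[mu]_t (phi 0 * gpdf t - phi t * gpdf t))%R.
  by rewrite RintegralB// RintegralZl// ?e1 ?mulr1//; exact: integrable_gpdf.
apply: le_trans (le_normr_Rintegral _ _) _ => //.
  exact: (integrableB measurableT i0 ip).
apply: le_Rintegral => //.
- have ib : mu.-integrable setT (EFin \o (fun t => phi 0 * gpdf t - phi t * gpdf t)).
    exact: (integrableB measurableT i0 ip).
  exact: (integrable_norm ib).
- exact: integrable_abs_gpdf.
- move=> t _; rewrite -mulrBl normrM (ger0_norm (gpdf_ge0 t)) ler_wpM2r ?gpdf_ge0//.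
  by have := hl 0 t; rewrite sub0r normrN.
Qed.

End GaussianExpectation.

(** * Stein's equation for Lipschitz test functions *)

Section SteinLipschitz.
Variable R : realType.

Section Solution.
Variables h J : R -> R.
Hypothesis h_lip : lipschitz1 h.
Hypothesis der_J : forall t : R, is_derive t 1 J (h t * gpdf t).

(* Solves Stein's equation f' - w f = h when J is the primitive of h * gpdf vanishing
   at both infinities. *)
Definition solW (w : R) := J w / gpdf w.
Definition solWp (w : R) := w * solW w + h w.

Lemma der_solW (w : R) : is_derive w 1 solW (solWp w).
Proof.
apply: (is_derive_eq (derM (der_J w) (derV (gpdf_neq0 w) (der_gpdf w)))).
by rewrite /solWp /solW; field; exact: gpdf_neq0.
Qed.

Hypothesis J_cvgNy : J (- n%:R) @[n --> \oo] --> (0 : R).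

(* Both sides of the claim vanish at -oo, so it suffices to compare derivatives. *)
Lemma prim_lip_bound w : `|J w - h w * Phi w| <= w * Phi w + gpdf w.
Proof.
have l1 : w * Phi (- n%:R) + gpdf (- n%:R) @[n --> \oo] --> (0 : R).
  apply: (cvg_seq_eq _ _ (cvgD (cvg_seqZ (c := w) (@Phi_cvgNy R)) (@gpdf_cvg R))) => //.
  by rewrite mulr0 addr0.
have l2 : J (- n%:R) - h w * Phi (- n%:R) @[n --> \oo] --> (0 : R).
  apply: (cvg_seq_eq _ _ (cvgB J_cvgNy (cvg_seqZ (c := h w) (@Phi_cvgNy R)))) => //.
  by rewrite mulr0 subr0.
have dG (x : R) : is_derive x 1 (fun t => w * Phi t + gpdf t) ((w - x) * gpdf x).
  apply: (is_derive_eq (derD (derZ w (der_Phi x)) (der_gpdf x))); ring.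
have dF (x : R) : is_derive x 1 (fun t => J t - h w * Phi t) ((h x - h w) * gpdf x).
  apply: (is_derive_eq (derB (der_J x) (derZ (h w) (der_Phi x)))); ring.
have hb x : x <= w -> `|(h x - h w) * gpdf x| <= (w - x) * gpdf x.
  move=> xw; rewrite normrM (ger0_norm (gpdf_ge0 x)) ler_wpM2r ?gpdf_ge0//.
  by apply: le_trans (h_lip _ _) _; rewrite distrC ger0_norm ?subr_ge0.
rewrite ler_norml -subr_ge0 -[X in _ && X]subr_ge0; apply/andP; split.
- apply: (ge0_of_limNy (f := fun t => (J t - h w * Phi t) - (- (w * Phi t + gpdf t)))
    (df := fun x => (h x - h w) * gpdf x - (- ((w - x) * gpdf x)))).
  + by move=> x /hb; rewrite ler_norml => /andP[]; lra.
  + by apply: (cvg_seq_eq _ _ (cvgB l2 (cvgN l1))) => //; rewrite oppr0 subr0.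
- apply: (ge0_of_limNy (f := fun t => (w * Phi t + gpdf t) - (J t - h w * Phi t))
    (df := fun x => (w - x) * gpdf x - (h x - h w) * gpdf x)).
  + by move=> x /hb; rewrite ler_norml => /andP[]; lra.
  + by apply: (cvg_seq_eq _ _ (cvgB l1 l2)) => //; rewrite subr0.
Qed.

(** f is compared with h times the Mills ratio, with error q = 1 + w mills(w). In f' the main parts
    cancel and leave h q plus w times that error; since q (1 + w^2) <= 1, the growth of h and the
    extra factor w are absorbed. *)
Lemma solW_bounds_neg (K w : R) : `|h 0| <= K -> w <= 0 ->
  [/\ `|solW w| <= K * mills 0 + 2, `|solWp w| <= K + 1 & `|w * solWp w| <= K + 2].
Proof.
move=> hK w0; have K0 := le_trans (normr_ge0 _) hK.
set r := mills w; set q := 1 + w * r.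
have r0 : 0 <= r := mills_ge0 w.
have q0 : 0 <= q := mills_lb w.
have rr : r <= mills 0.
  apply: (der_ge0_le w0 (fun x _ => der_mills x)) => x _; exact: mills_lb.
have q1 : q * (1 + w ^+ 2) <= 1.
  by have := mills_lb2 w; rewrite -/r /q; nra.
have hw : `|h w| <= K - w.
  have := h_lip w 0; rewrite subr0 (ler0_norm w0) => hl.
  by have := ler_normD (h w - h 0) (h 0); rewrite subrK; lra.
have fb : `|solW w - h w * r| <= q.
  have -> : solW w - h w * r = (J w - h w * Phi w) / gpdf w.
    by rewrite /solW /r /mills; field; exact: gpdf_neq0.
  rewrite normrM normfV (gtr0_norm (gpdf_gt0 w)) ler_pdivrMr ?gpdf_gt0//.
  apply: le_trans (prim_lip_bound w) _.
  by rewrite le_eqVlt; apply/orP; left; apply/eqP; rewrite /q /r /mills; field; exact: gpdf_neq0.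
have fpb : `|solWp w| <= (K - 2 * w) * q.
  have -> : solWp w = w * (solW w - h w * r) + h w * q by rewrite /solWp /q; ring.
  apply: le_trans (ler_normD _ _) _; rewrite !normrM (ler0_norm w0) (ger0_norm q0).
  have w0' : 0 <= - w by lra.
  have := ler_wpM2l w0' fb; have := ler_wpM2r q0 hw; lra.
have qw : q <= 1 by have := mulr_ge0 q0 (sqr_ge0 w); lra.
have aq : - 2 * w * q <= 1 by have := mulr_ge0 q0 (sqr_ge0 (w + 1)); nra.
have a2q : w ^+ 2 * q <= 1 by lra.
have Kq : K * q <= K by rewrite ler_piMr.
split.
- have h1 : `|solW w| <= q + `|h w| * r.
    have := ler_normD (solW w - h w * r) (h w * r); rewrite subrK (normrM (h w)) (ger0_norm r0); lra.
  have h2 := ler_wpM2r r0 hw; have h3 := ler_wpM2l K0 rr.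
  by apply: le_trans h1 _; move: h2; rewrite /q; lra.
- apply: le_trans fpb _; lra.
- rewrite (normrM w) (ler0_norm w0); have w0' : 0 <= - w by lra.
  have := ler_wpM2l w0' fpb; have Kaq : K * (- 2 * w * q) <= K by rewrite ler_piMr.
  by move=> h1; apply: le_trans h1 _; nra.
Qed.

End Solution.

Section Reflection.
Variables h J : R -> R.
Hypothesis h_lip : lipschitz1 h.
Hypothesis der_J : forall t : R, is_derive t 1 J (h t * gpdf t).
Hypothesis J_cvgNy : J (- n%:R) @[n --> \oo] --> (0 : R).
Hypothesis J_cvgy : J n%:R @[n --> \oo] --> (0 : R).

(** The positive half-line follows by reflection t -> -t, which sends J to -J(-t); vanishing of J at
    plus infinity is what the reflected problem requires. *)
Lemma solW_bounds (K w : R) : `|h 0| <= K ->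
  [/\ `|solW J w| <= K * mills 0 + 2, `|solWp h J w| <= K + 1 & `|w * solWp h J w| <= K + 2].
Proof.
move=> hK; have [w0|w0] := leP w 0; first exact: solW_bounds_neg.
have h_lip' : lipschitz1 (fun t => h (- t)).
  by move=> x y; apply: le_trans (h_lip _ _) _; rewrite opprK addrC distrC.
have der_J' (t : R) : is_derive t 1 (fun t => - J (- t)) (h (- t) * gpdf t).
  apply: (is_derive_eq (derN (der_opp (der_J (- t))))).
  by rewrite gpdfN opprK.
have J_cvgNy' : - J (- - n%:R) @[n --> \oo] --> (0 : R).
  by apply: (cvg_seq_eq _ _ (cvgN J_cvgy)); [move=> n; rewrite opprK|rewrite oppr0].
have hK' : `|h (- 0)| <= K by rewrite oppr0.
have w0' : - w <= 0 by rewrite oppr_le0 ltW.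
have [b1 b2 b3] := solW_bounds_neg h_lip' der_J' J_cvgNy' hK' w0'.
have e1 : solW (fun t => - J (- t)) (- w) = - solW J w.
  by rewrite /solW opprK gpdfN mulNr.
have e2 : solWp (fun t => h (- t)) (fun t => - J (- t)) (- w) = solWp h J w.
  by rewrite /solWp e1 opprK mulrNN.
by move: b1 b2 b3; rewrite e1 e2 mulNr !normrN.
Qed.

(** h need not be differentiable, so f' is split: w f by the mean value theorem, with derivative f +
    w f', and h by its Lipschitz property, which adds the last unit to the constant. *)
Lemma solWp_lip (K a b : R) : `|h 0| <= K ->
  `|solWp h J a - solWp h J b| <= (K * mills 0 + K + 5) * `|a - b|.
Proof.
move=> hK; wlog ab : a b / a < b.
  move=> H; have [->|] := eqVneq a b; first by rewrite !subrr normr0 mulr0.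
  by rewrite neq_lt => /orP[/H//|/H]; rewrite distrC [`|b - a|]distrC.
have dk (x : R) : is_derive x 1 (fun t => t * solW J t) (solW J x + x * solWp h J x).
  by apply: (is_derive_eq (derM (derX x) (der_solW der_J x))); ring.
have [c _ e] := der_MVT ab (fun x _ => dk x).
have [b1 _ b3] := solW_bounds c hK.
have k : `|b * solW J b - a * solW J a| <= (K * mills 0 + K + 4) * `|b - a|.
  rewrite e normrM ler_wpM2r//; apply: le_trans (ler_normD _ _) _; lra.
rewrite distrC [`|a - b|]distrC.
have -> : solWp h J b - solWp h J a = (b * solW J b - a * solW J a) + (h b - h a).
  by rewrite /solWp; ring.
apply: le_trans (ler_normD _ _) _; have := h_lip b a; lra.
Qed.

Lemma solW_remainder (K a b : R) : `|h 0| <= K ->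
  `|solW J a - solW J b - (a - b) * solWp h J a| <= (K * mills 0 + K + 5) * (a - b) ^+ 2.
Proof.
move=> hK; have C0 : 0 <= K * mills 0 + K + 5.
  by have := le_trans (normr_ge0 _) hK; have := mills_ge0 (0 : R); nra.
have [->|] := eqVneq a b; first by rewrite !subrr mul0r expr0n /= mulr0 subrr normr0.
have aux x y : x < y -> exists2 c, x < c < y &
    solW J y - solW J x = solWp h J c * (y - x).
  move=> xy; exact: (der_MVT xy (fun x _ => der_solW der_J x)).
have fin c : `|c - a| <= `|a - b| -> `|(solWp h J c - solWp h J a) * (a - b)| <=
    (K * mills 0 + K + 5) * (a - b) ^+ 2.
  move=> hc; rewrite normrM -real_normK ?num_real// expr2 mulrA ler_wpM2r//.
  by apply: le_trans (solWp_lip _ _ hK) _; rewrite ler_wpM2l.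
rewrite neq_lt => /orP[ab|ba].
- have [c /andP[ac cb] e] := aux _ _ ab.
  rewrite (_ : _ - _ - _ = (solWp h J c - solWp h J a) * (a - b)); last first.
    by rewrite -(opprB (solW J b) (solW J a)) e; ring.
  by apply: fin; rewrite distrC [`|a - b|]distrC ltr0_norm ?gtr0_norm ?subr_gt0 ?subr_lt0//; lra.
- have [c /andP[bc ca] e] := aux _ _ ba.
  rewrite e (_ : _ - _ = (solWp h J c - solWp h J a) * (a - b)); last by ring.
  by apply: fin; rewrite ltr0_norm ?gtr0_norm ?subr_gt0 ?subr_lt0//; lra.
Qed.

End Reflection.

Definition lipB : R := abs_moment R + 1.
Definition lipL : R := abs_moment R * mills 0 + abs_moment R + 5.

Lemma stein_lipschitz (phi : R -> R) : lipschitz1 phi ->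
  exists (c : R) (f fp : R -> R), [/\ normal_expect phi = c%:E,
    forall w, fp w - w * f w = phi w - c, forall w, `|fp w| <= lipB,
    forall a b, `|f a - f b - (a - b) * fp a| <= lipL * (a - b) ^+ 2 &
    `|phi 0 - c| <= abs_moment R].
Proof.
move=> hl; have [c [ec [hc cE]]] := normal_expect_lipschitz hl.
pose h t := phi t - c.
(* Subtracting the mean c makes the primitive vanish at plus infinity too. *)
pose J t := prim (fun x => phi x * gpdf x) t - c * Phi t.
have cphi : continuous (fun x : R => phi x * gpdf x).
  move=> x; apply: cvgM; last exact: continuous_gpdf.
  exact: lipschitz1_continuous.
have ip := integrable_lipschitz_gpdf hl.
have h_lip : lipschitz1 h.
  by move=> x y; rewrite /h opprB addrA subrK.
have dJ (t : R) : is_derive t 1 J (h t * gpdf t).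
  apply: (is_derive_eq (derB (der_prim cphi ip t) (derZ c (der_Phi t)))).
  by rewrite /h; ring.
have l1 : J (- n%:R) @[n --> \oo] --> (0 : R).
  apply: (cvg_seq_eq _ _ (cvgB (prim_cvgNy ip) (cvg_seqZ (c := c) (@Phi_cvgNy R)))) => //.
  by rewrite mulr0 subr0.
have l2 : J n%:R @[n --> \oo] --> (0 : R).
  apply: (cvg_seq_eq _ _ (cvgB (prim_cvgy ip) (cvg_seqZ (c := c) (@Phi_cvgy R)))) => //.
  by rewrite -cE mulr1 subrr.
exists c, (solW J), (solWp h J); split => //.
- by move=> w; rewrite /solWp addrC addKr.
- by move=> w; have [] := solW_bounds h_lip dJ l1 l2 w hc.
- by move=> a b; exact: solW_remainder.
Qed.

End SteinLipschitz.

(** * Moments of random intersection graphs *)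

Section BernoulliMoments.
Variables (R : realFieldType) (m : nat) (p : R).
Hypothesis p_bnd : 0 < p <= 1 / 10.

Notation att := {ffun 'I_m -> bool}.

Definition bern (b : bool) : R := if b then p else 1 - p.
Definition amu : att -> R := prod_weight bern.
Definition meet (x y : att) : R := if [exists a, x a && y a] then 1 else 0.

Lemma p01 : 0 <= p <= 1.
Proof. by case/andP: p_bnd => ? ?; apply/andP; split; lra. Qed.

Lemma bern_prob : is_prob bern.
Proof.
have /andP[? ?] := p01; split=> [[]|]; rewrite /bern; first by lra.
  by lra.
by rewrite big_bool /=; ring.
Qed.

Lemma amu_prob : is_prob amu.
Proof. exact: prod_weight_prob bern_prob. Qed.

Lemma meet_sym x y : meet x y = meet y x.
Proof. by rewrite /meet; congr (if _ then _ else _); apply: eq_existsb => a; rewrite andbC. Qed.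

Lemma meet01 x y : 0 <= meet x y <= 1.
Proof. by rewrite /meet; case: ifP; rewrite lexx ler01. Qed.

(** Attributes are independent, so every moment below becomes an m-th power once its integrand is
    written as a product over attributes. *)
Lemma Ew_amu_prod (g : 'I_m -> bool -> R) :
  Ew amu (fun x => \prod_a g a (x a)) = \prod_a (p * g a true + (1 - p) * g a false).
Proof.
rewrite /Ew /amu /prod_weight.
rewrite (eq_bigr (fun x : att => \prod_a (bern (x a) * g a (x a)))).
  rewrite -(bigA_distr_bigA (fun a b => bern b * g a b)) /=.
  by apply: eq_bigr => a _; rewrite big_bool.
by move=> x _; rewrite big_split.
Qed.

Lemma prod_const (c : R) : \prod_(a < m) c = c ^+ m.
Proof. by rewrite prodr_const card_ord. Qed.

Lemma Ew_two (s t : R) :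
  Ew amu (fun x : att => \prod_a (if x a then s else t)) = (p * s + (1 - p) * t) ^+ m.
Proof. by rewrite (Ew_amu_prod (fun _ b => if b then s else t)) prod_const. Qed.

Notation a := (1 - p).
Notation Q1 := (1 - p ^+ 2).
(* [uf x] is (1-p)^|x|, the conditional probability of not meeting x; [qf] is
   1 - phat, and [mk k ^+ m] is the k-th moment of [uf]. *)
Definition uf (x : att) : R := \prod_(k < m) (if x k then a else 1).
Definition qf : R := Q1 ^+ m.
Definition mk (k : nat) : R := p * a ^+ k + a.

Lemma meetE x y : meet x y = 1 - \prod_(k < m) (if x k && y k then 0 else 1).
Proof.
rewrite /meet; case: ifPn => [/existsP[k hk]|/existsPn h].
  by rewrite (bigD1 k)//= hk mul0r subr0.
by rewrite big1 ?subrr// => k _; rewrite (negbTE (h k)).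
Qed.

Lemma deg1_meet x : deg1 amu meet x = 1 - uf x.
Proof.
rewrite /deg1 (eq_Ew _ (meetE x)) EwB (Ew_cst amu_prob); congr (_ - _).
rewrite (Ew_amu_prod (fun k b => if x k && b then 0 else 1)).
by apply: eq_bigr => k _; case: (x k) => /=; ring.
Qed.

Lemma uf_pow k : Ew amu (fun x => uf x ^+ k) = mk k ^+ m.
Proof.
rewrite (eq_Ew _ (g := fun x : att => \prod_j (if x j then a ^+ k else 1))).
  by rewrite Ew_two mulr1.
move=> x; rewrite /uf -prodrXl; apply: eq_bigr => j _.
by case: (x j); rewrite ?expr1n.
Qed.

Lemma mk1 : mk 1 = Q1. Proof. by rewrite /mk; ring. Qed.

Lemma Ew_uf : Ew amu uf = qf.
Proof. by rewrite /qf -mk1 -uf_pow; apply: eq_Ew => x; rewrite expr1. Qed.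

Lemma gam_meet : gam amu meet = 1 - qf.
Proof. by rewrite /gam (eq_Ew _ deg1_meet) EwB (Ew_cst amu_prob) Ew_uf. Qed.

Lemma cdeg_meet x : cdeg amu meet x = qf - uf x.
Proof. by rewrite /cdeg deg1_meet gam_meet; ring. Qed.

Lemma vdeg_meet x : vdeg amu meet x = uf x * (1 - uf x).
Proof.
rewrite /vdeg (eq_Ew _ (g := fun y => (meet x y - Ew amu (meet x)) ^+ 2))//.
rewrite (Ew_var amu_prob) (eq_Ew _ (g := meet x)) -/(deg1 amu meet x) ?deg1_meet; first by ring.
by move=> y; rewrite /meet; case: ifP; rewrite ?expr1n ?expr0n.
Qed.

(** A third vertex misses y and z exactly if it misses their union, which gives the product over
    [y k || z k]. *)
Lemma cov_meet y z : cov amu meet y z =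
  \prod_(k < m) (if y k || z k then a else 1) - uf y * uf z.
Proof.
rewrite /cov !deg1_meet.
rewrite (eq_Ew _ (g := fun x : att => 1 - \prod_(k < m) (if y k && x k then 0 else 1)
  - \prod_(k < m) (if z k && x k then 0 else 1)
  + \prod_(k < m) (if (y k || z k) && x k then 0 else 1))).
  rewrite EwD !EwB (Ew_cst amu_prob).
  rewrite (Ew_amu_prod (fun k b => if y k && b then 0 else 1)).
  rewrite (Ew_amu_prod (fun k b => if z k && b then 0 else 1)).
  rewrite (Ew_amu_prod (fun k b => if (y k || z k) && b then 0 else 1)).
  have E (v : 'I_m -> bool) : \prod_k (p * (if v k && true then 0 else 1) +
      (1 - p) * (if v k && false then 0 else 1)) = \prod_k (if v k then a else 1).
    by apply: eq_bigr => k _; case: (v k) => /=; ring.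
  by rewrite (E y) (E z) (E (fun k => y k || z k)) /uf; ring.
move=> x; rewrite !meetE.
rewrite (_ : \prod_(k < m) (if (y k || z k) && x k then 0 else 1) =
  \prod_(k < m) (if y k && x k then 0 else 1) * \prod_(k < m) (if z k && x k then 0 else 1)); first by ring.
rewrite -big_split; apply: eq_bigr => k _ /=.
by case: (y k); case: (z k); case: (x k); rewrite ?mul0r ?mulr0 ?mul1r.
Qed.

Lemma tau_meet y : tau amu meet y =
  \prod_(k < m) (if y k then a else Q1) - qf * uf y.
Proof.
rewrite /tau (eq_Ew _ (cov_meet y)) EwB EwZ Ew_uf mulrC; congr (_ - _).
rewrite (Ew_amu_prod (fun k b => if y k || b then a else 1)).
by apply: eq_bigr => k _; case: (y k) => /=; ring.
Qed.

Lemma cov1_meet : cov1 amu meet = mk 2 ^+ m - qf ^+ 2.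
Proof.
rewrite /cov1 (eq_Ew _ tau_meet) EwB EwZ Ew_uf Ew_two expr2; congr (_ ^+ m - _).
by rewrite /mk; ring.
Qed.

Lemma Ew_cdeg2 : Ew amu (fun x => cdeg amu meet x ^+ 2) = cov1 amu meet.
Proof.
rewrite cov1_meet (eq_Ew _ (g := fun x => uf x ^+ 2 + ((- 2 * qf) * uf x + qf ^+ 2))).
  by rewrite !EwD EwZ (Ew_cst amu_prob) Ew_uf uf_pow; ring.
by move=> x; rewrite cdeg_meet; ring.
Qed.

(** Law of total variance for an edge indicator. *)
Lemma Ew_vdeg : Ew amu (vdeg amu meet) = qf * (1 - qf) - cov1 amu meet.
Proof.
rewrite (eq_Ew _ (g := fun x => uf x - uf x ^+ 2)); last by move=> x; rewrite vdeg_meet; ring.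
by rewrite EwB Ew_uf uf_pow cov1_meet; ring.
Qed.

Lemma Q1_exp k : (Q1 ^+ k) ^+ m = qf ^+ k.
Proof. by rewrite /qf -!exprM mulnC. Qed.

Lemma uf01 x : 0 <= uf x <= 1.
Proof.
have /andP[? ?] := p01; apply/andP; split; first by apply: prodr_ge0 => k _; case: ifP => _; lra.
by apply: prodr_ile1 => k; case: ifP => _ _; apply/andP; split; lra.
Qed.

Lemma qf01 : 0 <= qf <= 1.
Proof.
have /andP[? ?] := p01; have Q0 : 0 <= Q1 by nra.
by rewrite /qf exprn_ge0//= exprn_ile1//; nra.
Qed.

(** u (1-u) is 1-Lipschitz on [0, 1], so it stays within |u - q| of q (1-q), and the squared
    deviation averages to [cov1]. *)
Lemma Ew_vdeg2 : Ew amu (fun x => vdeg amu meet x ^+ 2) <=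
  2 * (qf * (1 - qf)) ^+ 2 + 2 * cov1 amu meet.
Proof.
rewrite -Ew_cdeg2 -EwZ -[2 * (qf * _) ^+ 2](Ew_cst amu_prob) -EwD.
apply: Ew_le => [|x]; first exact: amu_prob.
rewrite vdeg_meet cdeg_meet.
have /andP[q0 q1] := qf01; have /andP[u0 u1] := uf01 x.
move: (uf x) qf u0 u1 q0 q1 => u q u0 u1 q0 q1.
have h : (u * (1 - u) - q * (1 - q)) ^+ 2 <= (q - u) ^+ 2.
  rewrite (_ : u * (1 - u) - q * (1 - q) = (u - q) * (1 - u - q)); last by ring.
  rewrite exprMn (_ : (u - q) ^+ 2 = (q - u) ^+ 2); last by ring.
  by rewrite ler_piMr ?sqr_ge0//; nra.
have := sqr_ge0 (u * (1 - u) - 2 * (q * (1 - q))); nra.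
Qed.

Lemma Ew_cdeg4 : Ew amu (fun x => cdeg amu meet x ^+ 4) =
  mk 4 ^+ m - 4 * (mk 3 * Q1) ^+ m + 6 * (mk 2 * Q1 ^+ 2) ^+ m - 3 * (Q1 ^+ 4) ^+ m.
Proof.
rewrite (eq_Ew _ (g := fun x => uf x ^+ 4 + ((- 4 * qf) * uf x ^+ 3 + (6 * qf ^+ 2 * uf x ^+ 2 +
  ((- 4 * qf ^+ 3) * uf x + qf ^+ 4))))).
  rewrite !EwD !EwZ (Ew_cst amu_prob) Ew_uf !uf_pow (exprMn m (mk 3) Q1)
    (exprMn m (mk 2) (Q1 ^+ 2)) !Q1_exp -/qf.
  by move: qf (_ ^+ m) (_ ^+ m) (_ ^+ m) => Q x y z; ring.
by move=> x; rewrite cdeg_meet; ring.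
Qed.

Lemma Ew_cov2 : Ew amu (fun y => Ew amu (fun z => cov amu meet y z ^+ 2)) =
  (a ^+ 2 * (1 + 2 * p - p ^+ 2)) ^+ m - 2 * (a ^+ 2 + 2 * p * a ^+ 3 + p ^+ 2 * a ^+ 3) ^+ m
  + (mk 2 ^+ 2) ^+ m.
Proof.
rewrite (eq_Ew _ (g := fun y : att => \prod_(k < m) (if y k then a ^+ 2 else a + p * a ^+ 2)
   - 2 * \prod_(k < m) (if y k then a ^+ 3 + p * a ^+ 3 else a + p * a ^+ 2) * 1
   + \prod_(k < m) (if y k then mk 2 * a ^+ 2 else mk 2))).
  rewrite EwD EwB EwZr EwZ !Ew_two mulr1; congr (_ ^+ m - 2 * (_ ^+ m) + _ ^+ m); rewrite /mk; ring.
move=> y; rewrite (eq_Ew _ (g := fun z : att => \prod_(k < m) (if y k || z k then a ^+ 2 else 1)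
   - 2 * \prod_(k < m) (if y k || z k then (if y k && z k then a ^+ 3 else a ^+ 2) else 1)
   + \prod_(k < m) ((if y k then a ^+ 2 else 1) * (if z k then a ^+ 2 else 1)))).
  rewrite EwD EwB EwZ.
  rewrite (Ew_amu_prod (fun k b => if y k || b then a ^+ 2 else 1)).
  rewrite (Ew_amu_prod (fun k b => if y k || b then (if y k && b then a ^+ 3 else a ^+ 2) else 1)).
  rewrite (Ew_amu_prod (fun k b => (if y k then a ^+ 2 else 1) * (if b then a ^+ 2 else 1))).
  rewrite mulr1; congr (_ - 2 * _ + _); apply: eq_bigr => k _; rewrite /mk; case: (y k) => /=; ring.
move=> z; rewrite cov_meet sqrrB -!prodrXl -[uf y * uf z]big_split -prodrXl -big_split.
rewrite -[X in _ - X + _]mulr_natl; congr (_ - _ * _ + _); apply: eq_bigr => k _ /=.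
- by case: (y k); case: (z k); rewrite /= ?expr1n.
- by case: (y k); case: (z k) => /=; ring.
- by case: (y k); case: (z k) => /=; ring.
Qed.

Lemma Ew_tau2 : Ew amu (fun y => tau amu meet y ^+ 2) =
  (p * a ^+ 2 + a * Q1 ^+ 2) ^+ m - 2 * (Q1 * (p * a ^+ 2 + a * Q1)) ^+ m
  + (Q1 ^+ 2 * mk 2) ^+ m.
Proof.
rewrite (eq_Ew _ (g := fun y : att => \prod_(k < m) (if y k then a ^+ 2 else Q1 ^+ 2)
   - 2 * qf * \prod_(k < m) (if y k then a ^+ 2 else Q1)
   + qf ^+ 2 * uf y ^+ 2)).
  rewrite EwD EwB !EwZ !Ew_two uf_pow (exprMn m Q1) (exprMn m (Q1 ^+ 2)) !Q1_exp -/qf.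
  by move: qf (_ ^+ m) (_ ^+ m) (_ ^+ m) => Q x y z; ring.
move=> y; rewrite tau_meet sqrrB -!prodrXl exprMn -[uf y ^+ 2]prodrXl; congr (_ - _ + _).
- by apply: eq_bigr => k _; case: (y k).
- rewrite (_ : _ * (qf * uf y) *+ 2 = 2 * qf * (\prod_(k < m) (if y k then a else Q1) * uf y)); last by ring.
  congr (_ * _).
  by rewrite /uf -big_split; apply: eq_bigr => k _; case: (y k) => /=; ring.
Qed.

End BernoulliMoments.

(** * Expansion and comparison of the m-th powers *)

Section PowerBounds.
Variable R : realType.

Lemma bernoulli_ineq (b : R) m : 0 <= b -> 1 + m%:R * b <= (1 + b) ^+ m.
Proof.
move=> b0; elim: m => [|m IH]; first by rewrite mul0r addr0 expr0.
rewrite exprS -natr1; apply: le_trans (ler_wpM2l _ IH); last by lra.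
have : 0 <= m%:R * b by rewrite mulr_ge0.
by nra.
Qed.

(** With t = m b, the bound exp t <= 1 + t exp t is used twice, which leaves a second-order
    remainder. *)
Lemma pow_upper (b K : R) m : 0 <= b -> m%:R * b <= K ->
  (1 + b) ^+ m <= 1 + m%:R * b + expR K * (m%:R * b) ^+ 2.
Proof.
move=> b0 hK; set t := m%:R * b in hK *.
have t0 : 0 <= t by rewrite mulr_ge0.
have h1 : (1 + b) ^+ m <= expR t.
  rewrite /t expRM_natl; apply: lerXn2r; rewrite ?nnegrE ?expR_ge0 ?addr_ge0//.
  exact: expR_ge1Dx.
have h2 : expR t <= 1 + t * expR t.
  have := expR_ge1Dx (- t); have := expR_gt0 t; have : expR t * expR (- t) = 1.
    by rewrite -expRD subrr expR0.
  by move: (expR t) (expR (- t)) => x y; nra.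
have h3 : expR t <= expR K by rewrite ler_expR.
have h4 := ler_wpM2l t0 h2; have h5 := ler_wpM2l (sqr_ge0 t) h3.
by apply: le_trans h1 _; lra.
Qed.

Variables (m : nat) (p : R).
Hypothesis p_bnd : 0 < p <= 1 / 10.

Definition E8 : R := expR 8.
Lemma E8_ge1 : 1 <= E8.
Proof. by rewrite /E8 -expR0 ler_expR. Qed.

(** The relative excess is at most 8 p^3, so m times it is at most 8: hence [E8], and 64 = 8^2. *)
Lemma pow_up (Q X : R) : 0 < Q -> Q <= X -> X - Q <= 8 * p ^+ 3 * Q -> m%:R * p ^+ 3 <= 1 ->
  X ^+ m <= Q ^+ m * (1 + m%:R * ((X - Q) / Q) + 64 * E8 * (m%:R * p ^+ 3) ^+ 2).
Proof.
move=> Q0 QX XQ mp; have /andP[p0 _] := p_bnd.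
have [b [b0 b8 bE ->]] : exists b, [/\ 0 <= b, b <= 8 * p ^+ 3, (X - Q) / Q = b & X = Q * (1 + b)].
  exists ((X - Q) / Q); split => //; last by field; rewrite gt_eqF.
    by rewrite divr_ge0 ?subr_ge0// ltW.
  by rewrite ler_pdivrMr.
have -> : (Q * (1 + b) - Q) / Q = b by field; rewrite gt_eqF.
rewrite exprMn; apply: ler_wpM2l; first by rewrite exprn_ge0// ltW.
have mb : m%:R * b <= 8 * (m%:R * p ^+ 3).
  by rewrite [leRHS]mulrCA; apply: ler_wpM2l.
have mb0 : 0 <= m%:R * b by apply: mulr_ge0.
have mb8 : m%:R * b <= 8 by apply: le_trans mb _; lra.
apply: le_trans (pow_upper b0 mb8) _; rewrite lerD2l -/E8.
rewrite (_ : 64 * E8 * _ = E8 * (8 * (m%:R * p ^+ 3)) ^+ 2); last by ring.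
apply: ler_wpM2l; first by have := E8_ge1; lra.
by apply: lerXn2r => //; rewrite nnegrE//; apply: le_trans mb.
Qed.

(** Terms with a negative sign need only a lower bound, for which Bernoulli's inequality has no
    error term. *)
Lemma pow_low (Q Y : R) : 0 < Q -> Q <= Y ->
  Q ^+ m * (1 + m%:R * ((Y - Q) / Q)) <= Y ^+ m.
Proof.
move=> Q0 QY; set b := (Y - Q) / Q.
have b0 : 0 <= b by rewrite divr_ge0 ?subr_ge0// ltW.
have -> : Y = Q * (1 + b) by rewrite /b; field; rewrite gt_eqF.
by rewrite exprMn ler_wpM2l ?exprn_ge0 ?(ltW Q0)//; exact: bernoulli_ineq.
Qed.

Notation a := (1 - p).
Notation Q1 := (1 - p ^+ 2).
Notation Q := (Q1 ^+ 4).
Notation mkp := (mk p).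
Notation q := (qf m p).
Notation mu := (@amu R m p).
Notation e := (@meet R m).
Notation s1 := (cov1 mu e).

Let p0 : 0 < p. Proof. by case/andP: p_bnd. Qed.
Let p1 : p <= 1 / 10. Proof. by case/andP: p_bnd. Qed.
Let p2 : p ^+ 2 <= p / 10. Proof. by move: p0 p1; nra. Qed.
Let p3 : p ^+ 3 <= p / 100.
Proof. have := p2; have := p0; have : p ^+ 3 <= p ^+ 2 / 10 by move: p0 p1; nra. lra. Qed.
Let p30 : 0 < p ^+ 3. Proof. by rewrite exprn_gt0. Qed.
Let p20 : 0 < p ^+ 2. Proof. by rewrite exprn_gt0. Qed.
Let p5 : 0 <= p ^+ 5 <= p ^+ 3 / 100.
Proof. by rewrite exprn_ge0 ?(ltW p0)//=; move: p0 p1 p2 p30; nra. Qed.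
Let Q1b : 99 / 100 <= Q1 <= 1. Proof. by apply/andP; split; move: p0 p1 p2 p20; lra. Qed.
Let Q12b : 98 / 100 <= Q1 ^+ 2 <= 1. Proof. by move: Q1b => /andP[? ?]; apply/andP; split; nra. Qed.
Let Qb : 96 / 100 <= Q <= 1.
Proof.
move: Q12b => /andP[? ?]; rewrite (_ : Q = Q1 ^+ 2 * Q1 ^+ 2); last by ring.
by apply/andP; split; nra.
Qed.
Let Q0 : 0 < Q. Proof. by move: Qb => /andP[? ?]; lra. Qed.
Let m2b : 98 / 100 <= mkp 2 <= 1.
Proof. by rewrite /mk; apply/andP; split; move: p0 p1 p2 p20 p30; nra. Qed.

Lemma dm2 : mkp 2 - Q1 ^+ 2 = p ^+ 3 * a. Proof. by rewrite /mk; ring. Qed.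

(** Every base below is Q plus p^3 times a bounded polynomial; 7 suffices because 8 Q >= 8 * 0.96 >
    7. *)
Let factor_bounds (X c : R) (hX : X - Q = p ^+ 3 * c) (hc : 0 <= c <= 7) :
  Q <= X /\ X - Q <= 8 * p ^+ 3 * Q.
Proof.
have /andP[c0 c7] := hc; rewrite -subr_ge0 hX mulr_ge0 ?(ltW p30)//; split => //.
have /andP[? ?] := Qb; rewrite (_ : 8 * _ * _ = p ^+ 3 * (8 * Q)); last by ring.
apply: ler_wpM2l; first exact: ltW.
by lra.
Qed.

Let b_m4 : Q <= mkp 4 /\ mkp 4 - Q <= 8 * p ^+ 3 * Q.
Proof.
apply: (@factor_bounds _ (6 - 10 * p + p ^+ 2 + 4 * p ^+ 3 - p ^+ 5)).
  by rewrite /mk; ring.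
have /andP[? ?] := p5; apply/andP; split; move: p0 p1 p2 p3 p20 p30; lra.
Qed.

Let b_m3 : Q <= mkp 3 * Q1.
Proof.
rewrite -subr_ge0 (_ : _ - _ = Q1 * (p ^+ 3 * (3 - 4 * p + p ^+ 3))); last first.
  by rewrite /mk; ring.
have /andP[? ?] := Q1b; apply: mulr_ge0; first by lra.
by apply: mulr_ge0; [exact: ltW|move: p0 p1 p30; lra].
Qed.

Let b_m2 : Q <= mkp 2 * Q1 ^+ 2 /\ mkp 2 * Q1 ^+ 2 - Q <= 8 * p ^+ 3 * Q.
Proof.
apply: (@factor_bounds _ (Q1 ^+ 2 * a)); first by rewrite /mk; ring.
have /andP[? ?] := Q12b; have ? := p0; have ? := p1.
by apply/andP; split; [rewrite mulr_ge0//; lra|nra].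
Qed.

Let b_A1 : Q <= a ^+ 2 * (1 + 2 * p - p ^+ 2) /\ a ^+ 2 * (1 + 2 * p - p ^+ 2) - Q <= 8 * p ^+ 3 * Q.
Proof.
apply: (@factor_bounds _ (4 - 7 * p + 4 * p ^+ 3 - p ^+ 5)); first by ring.
have /andP[? ?] := p5; apply/andP; split; move: p0 p1 p2 p3 p20 p30; lra.
Qed.

Let b_A2 : Q <= a ^+ 2 + 2 * p * a ^+ 3 + p ^+ 2 * a ^+ 3.
Proof.
apply: (@factor_bounds _ (3 - 5 * p - p ^+ 2 + 4 * p ^+ 3 - p ^+ 5) _ _).1; first by ring.
have /andP[? ?] := p5; apply/andP; split; move: p0 p1 p2 p3 p20 p30; lra.
Qed.

Let b_A3 : Q <= mkp 2 ^+ 2 /\ mkp 2 ^+ 2 - Q <= 8 * p ^+ 3 * Q.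
Proof.
apply: (@factor_bounds _ (a * (mkp 2 + Q1 ^+ 2))); first by rewrite /mk; ring.
have /andP[? ?] := Q12b; have /andP[? ?] := m2b; have ? := p0; have ? := p1.
by apply/andP; split; [rewrite mulr_ge0//; lra|nra].
Qed.

Let b_X : Q <= p * a ^+ 2 + a * Q1 ^+ 2 /\ p * a ^+ 2 + a * Q1 ^+ 2 - Q <= 8 * p ^+ 3 * Q.
Proof.
apply: (@factor_bounds _ (3 - 5 * p - p ^+ 2 + 4 * p ^+ 3 - p ^+ 5)); first by ring.
have /andP[? ?] := p5; apply/andP; split; move: p0 p1 p2 p3 p20 p30; lra.
Qed.

Let b_Y : Q <= Q1 * (p * a ^+ 2 + a * Q1).
Proof.
rewrite -subr_ge0 (_ : _ - _ = Q1 * (p ^+ 3 * (2 - 3 * p + p ^+ 3))); last by ring.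
have /andP[? ?] := Q1b; apply: mulr_ge0; first by lra.
by apply: mulr_ge0; [exact: ltW|move: p0 p1 p30; lra].
Qed.

Let QmE : Q ^+ m = q ^+ 4. Proof. exact: Q1_exp. Qed.
Let a01 : 0 <= a <= 1. Proof. by apply/andP; split; move: p0 p1; lra. Qed.

Section SmallP.
Hypothesis mp : m%:R * p ^+ 3 <= 1.
Let S := (m%:R * p ^+ 3) ^+ 2.
Let m0 : 0 <= (m%:R : R). Proof. exact: ler0n. Qed.

(* Second-order expansion of powers close to Q ^+ m: only the first-order term
   of the signed combination matters, up to (m p^3)^2. *)
Let comb (X Y Z D c : R) : X - 2 * Y + Z = D -> D <= c * Q -> 0 <= c ->
  (Q <= X /\ X - Q <= 8 * p ^+ 3 * Q) -> Q <= Y -> (Q <= Z /\ Z - Q <= 8 * p ^+ 3 * Q) ->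
  X ^+ m - 2 * Y ^+ m + Z ^+ m <= q ^+ 4 * (m%:R * c + 128 * E8 * S).
Proof.
move=> hD hc c0 [x1 x2] y1 [z1 z2].
have hx := pow_up Q0 x1 x2 mp; have hz := pow_up Q0 z1 z2 mp; have hy := pow_low Q0 y1.
rewrite -QmE.
have e1 : Q ^+ m * (1 + m%:R * ((X - Q) / Q) + 64 * E8 * S) - 2 * (Q ^+ m * (1 + m%:R * ((Y - Q) / Q)))
  + Q ^+ m * (1 + m%:R * ((Z - Q) / Q) + 64 * E8 * S) = Q ^+ m * (m%:R * (D / Q) + 128 * E8 * S).
  rewrite -hD; have := lt0r_neq0 Q0; move: (Q ^+ m) => W; move: (Q) => V V0.
  by field.
have h1 : D / Q <= c by rewrite ler_pdivrMr.
have h2 : Q ^+ m * (m%:R * (D / Q) + 128 * E8 * S) <= Q ^+ m * (m%:R * c + 128 * E8 * S).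
  apply: ler_wpM2l; first by rewrite exprn_ge0// ltW.
  by rewrite lerD2r; apply: ler_wpM2l.
rewrite -/S in hx hz; lra.
Qed.

(** The p^3 coefficients 4, 3, 2 of the three bases cancel in 4 - 2*3 + 2, so the first-order term
    starts at p^4. For [small_tau2] and [small_cdeg4] the p^4 terms cancel as well. *)
Lemma small_cov2 : Ew mu (fun y => Ew mu (fun z => cov mu e y z ^+ 2)) <=
  q ^+ 4 * (m%:R * (2 * p ^+ 4) + 128 * E8 * S).
Proof.
rewrite Ew_cov2//; apply: (comb (D := p ^+ 4 * a ^+ 2) _ _ _ b_A1 b_A2 b_A3).
- by rewrite /mk; ring.
- have /andP[? ?] := a01; have /andP[? ?] := Qb.
  rewrite (_ : 2 * _ * Q = p ^+ 4 * (2 * Q)); last by ring.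
  by apply: ler_wpM2l; [rewrite exprn_ge0// ltW|nra].
- by apply: mulr_ge0 => //; rewrite exprn_ge0// ltW.
Qed.

Lemma small_tau2 : Ew mu (fun y => tau mu e y ^+ 2) <=
  q ^+ 4 * (m%:R * (2 * p ^+ 5) + 128 * E8 * S).
Proof.
have bZ : Q <= Q1 ^+ 2 * mkp 2 /\ Q1 ^+ 2 * mkp 2 - Q <= 8 * p ^+ 3 * Q.
  by rewrite (mulrC (Q1 ^+ 2)); exact: b_m2.
rewrite Ew_tau2//; apply: (comb (D := p ^+ 5 * a ^+ 2) _ _ _ b_X b_Y bZ).
- by rewrite /mk; ring.
- have /andP[? ?] := a01; have /andP[? ?] := Qb.
  rewrite (_ : 2 * _ * Q = p ^+ 5 * (2 * Q)); last by ring.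
  by apply: ler_wpM2l; [rewrite exprn_ge0// ltW|nra].
- by apply: mulr_ge0 => //; rewrite exprn_ge0// ltW.
Qed.

Lemma small_cdeg4 : Ew mu (fun x => cdeg mu e x ^+ 4) <=
  q ^+ 4 * (m%:R * (2 * p ^+ 5) + 448 * E8 * S).
Proof.
rewrite Ew_cdeg4//.
have h4 := pow_up Q0 b_m4.1 b_m4.2 mp; have h2 := pow_up Q0 b_m2.1 b_m2.2 mp.
have h3 := pow_low Q0 b_m3.
rewrite -QmE.
have e1 : Q ^+ m * (1 + m%:R * ((mkp 4 - Q) / Q) + 64 * E8 * S)
   - 4 * (Q ^+ m * (1 + m%:R * ((mkp 3 * Q1 - Q) / Q)))
   + 6 * (Q ^+ m * (1 + m%:R * ((mkp 2 * Q1 ^+ 2 - Q) / Q) + 64 * E8 * S)) - 3 * Q ^+ m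
   = Q ^+ m * (m%:R * (p ^+ 5 * (a ^+ 4 + a * p ^+ 3) / Q) + 448 * E8 * S).
  have -> : p ^+ 5 * (a ^+ 4 + a * p ^+ 3) = mkp 4 - 4 * (mkp 3 * Q1) + 6 * (mkp 2 * Q1 ^+ 2) - 3 * Q.
    by rewrite /mk; ring.
  have := lt0r_neq0 Q0; move: (Q ^+ m) (mkp 4) (mkp 3 * Q1) (mkp 2 * Q1 ^+ 2) => W x y z.
  by move: (Q) => V V0; field.
have h5 : p ^+ 5 * (a ^+ 4 + a * p ^+ 3) / Q <= 2 * p ^+ 5.
  rewrite ler_pdivrMr// (_ : 2 * _ * Q = p ^+ 5 * (2 * Q)); last by ring.
  apply: ler_wpM2l; first by case/andP: p5.
  have /andP[? ?] := a01; have /andP[? ?] := Qb.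
  have : a ^+ 4 <= 1 by rewrite exprn_ile1.
  have : a * p ^+ 3 <= p ^+ 3 by rewrite ler_piMl// ltW.
  by move: p3 p1; lra.
have h6 : Q ^+ m * (m%:R * (p ^+ 5 * (a ^+ 4 + a * p ^+ 3) / Q) + 448 * E8 * S) <=
    Q ^+ m * (m%:R * (2 * p ^+ 5) + 448 * E8 * S).
  apply: ler_wpM2l; first by rewrite exprn_ge0// ltW.
  by rewrite lerD2r; apply: ler_wpM2l.
rewrite -/S in h4 h2; lra.
Qed.

End SmallP.

(** Bernoulli's inequality with relative excess p^3 (1-p) / Q1^2, which is at least 9/10 p^3 as p <=
    1/10. *)
Lemma cov1_lower : q ^+ 2 * (9 / 10 * (m%:R * p ^+ 3)) <= s1.
Proof.
have Q20 : 0 < Q1 ^+ 2 by have /andP[? ?] := Q12b; lra.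
have h : Q1 ^+ 2 <= mkp 2.
  by rewrite -subr_ge0 dm2 mulr_ge0 ?(ltW p30)//; case/andP: a01.
have := pow_low Q20 h; rewrite Q1_exp cov1_meet// dm2 => hl.
have h2 : 9 / 10 * p ^+ 3 <= p ^+ 3 * a / Q1 ^+ 2.
  rewrite ler_pdivlMr//; have /andP[? ?] := Q12b; have := p30; have := p1; nra.
have h3 : q ^+ 2 * (m%:R * (9 / 10 * p ^+ 3)) <= q ^+ 2 * (m%:R * (p ^+ 3 * a / Q1 ^+ 2)).
  by rewrite !ler_wpM2l// sqr_ge0.
lra.
Qed.

Section LargeP.
Hypothesis mp : 1 <= m%:R * p ^+ 3.
Notation M4 := (mkp 4 ^+ m).
Notation M2 := (mkp 2 ^+ m).

(** When m p^3 >= 1 no cancellation is exploited: negative terms are dropped and every positive base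
    is at most [mk 4]. *)
Let powle (X : R) : 0 <= X -> X <= mkp 4 -> X ^+ m <= M4.
Proof. by move=> X0 X4; rewrite lerXn2r ?nnegrE//; apply: le_trans X4. Qed.

Let m2Q_le : 0 <= mkp 2 * Q1 ^+ 2 <= mkp 4.
Proof.
apply/andP; split; first by apply: le_trans b_m2.1; exact: ltW.
rewrite -subr_ge0 (_ : _ - _ = p ^+ 3 * (6 - 10 * p + p ^+ 2 + 4 * p ^+ 3 - p ^+ 5 - Q1 ^+ 2 * a)); last first.
  by rewrite /mk; ring.
rewrite mulr_ge0 ?(ltW p30)//.
have /andP[? ?] := p5; have /andP[? ?] := Q12b; have /andP[? ?] := a01.
have : Q1 ^+ 2 * a <= 1 by nra.
by move: p0 p1 p2 p3 p20 p30; lra.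
Qed.

Lemma large_cdeg4 : Ew mu (fun x => cdeg mu e x ^+ 4) <= 7 * M4.
Proof.
rewrite Ew_cdeg4//.
have /andP[h0 h1] := m2Q_le; have := powle h0 h1.
have : 0 <= (mkp 3 * Q1) ^+ m by rewrite exprn_ge0//; apply: le_trans b_m3; exact: ltW.
have : 0 <= Q ^+ m by rewrite exprn_ge0// ltW.
lra.
Qed.

Lemma large_tau2 : Ew mu (fun y => tau mu e y ^+ 2) <= 2 * M4.
Proof.
rewrite Ew_tau2// (mulrC (Q1 ^+ 2)).
have /andP[h0 h1] := m2Q_le; have := powle h0 h1.
have hx0 : 0 <= p * a ^+ 2 + a * Q1 ^+ 2 by apply: le_trans b_X.1; exact: ltW.
have hx1 : p * a ^+ 2 + a * Q1 ^+ 2 <= mkp 4.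
  rewrite -subr_ge0 (_ : _ - _ = p ^+ 3 * (3 - 5 * p + 2 * p ^+ 2)); last by rewrite /mk; ring.
  by rewrite mulr_ge0 ?(ltW p30)//; move: p0 p1 p20; lra.
have := powle hx0 hx1.
have : 0 <= (Q1 * (p * a ^+ 2 + a * Q1)) ^+ m.
  by rewrite exprn_ge0//; apply: le_trans b_Y; exact: ltW.
lra.
Qed.

Lemma large_cov2 : Ew mu (fun y => Ew mu (fun z => cov mu e y z ^+ 2)) <= 2 * M4.
Proof.
rewrite Ew_cov2//.
have hx0 : 0 <= a ^+ 2 * (1 + 2 * p - p ^+ 2) by apply: le_trans b_A1.1; exact: ltW.
have hx1 : a ^+ 2 * (1 + 2 * p - p ^+ 2) <= mkp 4.
  rewrite -subr_ge0 (_ : _ - _ = p ^+ 3 * (2 - 3 * p + p ^+ 2)); last by rewrite /mk; ring.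
  by rewrite mulr_ge0 ?(ltW p30)//; move: p0 p1 p20; lra.
have := powle hx0 hx1.
have hz1 : mkp 2 ^+ 2 <= mkp 4.
  rewrite -subr_ge0 (_ : _ - _ = p ^+ 3 * (4 - 8 * p + 5 * p ^+ 2 - p ^+ 3)); last by rewrite /mk; ring.
  by rewrite mulr_ge0 ?(ltW p30)//; move: p0 p1 p20 p3; lra.
have := powle (sqr_ge0 _) hz1.
have : 0 <= (a ^+ 2 + 2 * p * a ^+ 3 + p ^+ 2 * a ^+ 3) ^+ m.
  by rewrite exprn_ge0//; apply: le_trans b_A2; exact: ltW.
lra.
Qed.

(** Here [cov1_lower] gives s1 >= 9/10 q^2 while s1 = M2 - q^2, so s1 >= 9/19 M2. *)
Lemma large_cov1 : 2 / 5 * M2 <= s1.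
Proof.
have := cov1_lower; rewrite cov1_meet// => h.
have : q ^+ 2 * (9 / 10) <= q ^+ 2 * (9 / 10 * (m%:R * p ^+ 3)).
  by apply: ler_wpM2l; [exact: sqr_ge0|move: mp; lra].
have := sqr_ge0 q; move: h; lra.
Qed.

(** It suffices to compare the bases: [mk 4] exceeds [mk 2 ^+ 2] by at most 4 p^3, whereas the
    factor 1 - p^2 gains order p^2, which wins for p <= 1/10. *)
Lemma M4_le : M4 ^+ 2 * q <= M2 ^+ 4.
Proof.
rewrite -!exprM ![(m * _)%N]mulnC !exprM -exprMn; apply: lerXn2r.
- rewrite nnegrE mulr_ge0 ?sqr_ge0//; have /andP[? ?] := Q1b; lra.
- by rewrite nnegrE exprn_ge0//; have /andP[? ?] := m2b; lra.
have h : mkp 4 - mkp 2 ^+ 2 <= 4 * p ^+ 3.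
  rewrite (_ : _ - _ = p ^+ 3 * (4 - 8 * p + 5 * p ^+ 2 - p ^+ 3)); last by rewrite /mk; ring.
  rewrite mulrC ler_wpM2r ?(ltW p30)//; move: p0 p1 p2 p20 p30; lra.
have /andP[h1 h2] := m2b.
have s96 : 96 / 100 <= mkp 2 ^+ 2 by nra.
have s1 : mkp 2 ^+ 2 <= 1 by nra.
rewrite (_ : mkp 2 ^+ 4 = (mkp 2 ^+ 2) ^+ 2); last by ring.
have hm4 : 0 <= mkp 4 by apply: le_trans b_m4.1; exact: ltW.
move: (mkp 2 ^+ 2) (mkp 4) h s96 s1 hm4 => s x h s96 s1 x0.
have k1 : x ^+ 2 <= (s + 4 * p ^+ 3) ^+ 2 by rewrite lerXn2r ?nnegrE//; have := p30; lra.
have Q1pos : 0 <= Q1 by have /andP[? ?] := Q1b; lra.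
apply: le_trans (ler_wpM2r Q1pos k1) _.
have k2 : 8 * s * p + 16 * p ^+ 4 <= s ^+ 2.
  have : p ^+ 4 <= 1 / 1000 by have := p3; have := p0; have := p1; nra.
  by have := p0; have := p1; nra.
have k3 := ler_wpM2l (ltW p20) k2.
have k4 : 0 <= p ^+ 2 * (8 * s * p ^+ 3 + 16 * p ^+ 6).
  by rewrite mulr_ge0 ?(ltW p20)// addr_ge0 ?mulr_ge0 ?exprn_ge0 ?(ltW p0)//; lra.
nra.
Qed.

End LargeP.
End PowerBounds.

(** * The fluctuation bound against the squared variance *)

Section QuadraticBounds.
Variables (R : realType) (n m : nat) (p : R).
Hypothesis p_bnd : 0 < p <= 1 / 10.
Hypothesis n_ge4 : (4 <= n)%N.
Hypothesis m_gt0 : (0 < m)%N.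

Notation q := (qf m p).
Notation mu := (@amu R m p).
Notation e := (@meet R m).
Notation s1 := (cov1 mu e).
Notation N := (n%:R : R).
Notation M := (m%:R : R).

(* Up to constants, the contributions to the variance of the edge count of the
   single pairs and of the pairs of pairs sharing a vertex. *)
Definition al : R := N ^+ 2 * (q * (1 - q)).
Definition be : R := N ^+ 3 * s1.

Let p0 : 0 < p. Proof. by case/andP: p_bnd. Qed.
Let p1 : p <= 1 / 10. Proof. by case/andP: p_bnd. Qed.
Let N4 : 4 <= N. Proof. by rewrite (ler_nat R 4 n). Qed.
Let M1 : 1 <= M. Proof. by rewrite ler1n. Qed.
Let Q1b : 0 < 1 - p ^+ 2 < 1. Proof. by apply/andP; split; move: p0 p1; nra. Qed.

Let mp3 : 0 <= M * p ^+ 3.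
Proof. by apply: mulr_ge0; [exact: ler0n|exact: exprn_ge0 (ltW p0)]. Qed.

Lemma qf_gt0 : 0 < q.
Proof. by rewrite exprn_gt0//; case/andP: Q1b. Qed.

Lemma qf_lin : q * (1 + M * p ^+ 2) <= 1.
Proof.
have h := @bernoulli_ineq R (p ^+ 2) m (sqr_ge0 p).
apply: le_trans (ler_wpM2l (ltW qf_gt0) h) _.
have p20 := sqr_ge0 p; have /andP[h0 h1] := Q1b.
rewrite /qf -exprMn; apply: exprn_ile1; first by apply: mulr_ge0; lra.
by have := sqr_ge0 (p ^+ 2); lra.
Qed.

Lemma qf_ge : 1 - M * p ^+ 2 <= q.
Proof.
rewrite /qf; elim: (m) => [|k IH]; first by rewrite mul0r subr0 expr0.
have /andP[h0 h1] := Q1b.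
rewrite (exprS _ k) -(natr1 k); apply: (le_trans _ (ler_wpM2l (ltW h0) IH)).
have : 0 <= k%:R * (p ^+ 2 * p ^+ 2) by rewrite mulr_ge0// -expr2 sqr_ge0.
lra.
Qed.

Lemma qf_lt1 : q < 1.
Proof.
have M0 : 0 < M by move: M1; lra.
by have := mulr_gt0 qf_gt0 (mulr_gt0 M0 (exprn_gt0 2 p0)); have := qf_lin; lra.
Qed.

Lemma al_gt0 : 0 < al.
Proof.
rewrite /al; apply: mulr_gt0; first by rewrite exprn_gt0//; move: N4; lra.
by apply: mulr_gt0; [exact: qf_gt0|rewrite subr_gt0 qf_lt1].
Qed.

Lemma s1_ge0 : 0 <= s1.
Proof.
apply: le_trans (cov1_lower m p_bnd).
by apply: (mulr_ge0 (sqr_ge0 _)); apply: (mulr_ge0 _ mp3); lra.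
Qed.

Lemma be_ge0 : 0 <= be.
Proof. by rewrite mulr_ge0 ?exprn_ge0 ?s1_ge0. Qed.

Lemma sig2E : sig2 n mu e = 2^-1 * (N * (N - 1) * (q * (1 - q) + 2 * (N - 2) * s1)).
Proof.
rewrite sig2_Vconst; [|exact: amu_prob|exact: meet_sym].
rewrite /Vconst /Uconst Ew_vdeg// -subn1 natrB; last by apply: leq_trans n_ge4.
ring.
Qed.

Lemma sig2_lower : (al + be) / 4 <= sig2 n mu e.
Proof.
rewrite sig2E /al /be.
have := s1_ge0; have : 0 <= q * (1 - q) by rewrite mulr_ge0 ?subr_ge0 ?(ltW qf_gt0) ?(ltW qf_lt1).
move: N4 (q * (1 - q)) s1 => h b c b0 c0.
have k1 : 3 / 4 * N ^+ 2 <= N * (N - 1) by nra.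
have k2 : N <= 2 * (N - 2) by lra.
have k3 : b + N * c <= b + 2 * (N - 2) * c by rewrite lerD2l ler_wpM2r.
have N0 : 0 <= N by lra.
have k4 : 0 <= b + N * c by rewrite addr_ge0// mulr_ge0.
have k6 : 0 <= 3 / 4 * N ^+ 2 by rewrite mulr_ge0// sqr_ge0.
have k5 := ler_pM k6 k4 k1 k3.
have k7 : 0 <= N ^+ 2 * (b + N * c) by rewrite mulr_ge0// sqr_ge0.
lra.
Qed.

Lemma sig2_upper : sig2 n mu e <= al + be.
Proof.
rewrite sig2E /al /be.
have := s1_ge0; have : 0 <= q * (1 - q) by rewrite mulr_ge0 ?subr_ge0 ?(ltW qf_gt0) ?(ltW qf_lt1).
move: N4 (q * (1 - q)) s1 => h b c b0 c0.
have N0 : 0 <= N by lra.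
have k1 : N * (N - 1) <= N ^+ 2 by nra.
have k3 : b + 2 * (N - 2) * c <= b + 2 * N * c by rewrite lerD2l ler_wpM2r//; lra.
have k4 : 0 <= b + 2 * (N - 2) * c by rewrite addr_ge0// mulr_ge0//; lra.
have k6 : 0 <= N * (N - 1) by nra.
have k5 := ler_pM k6 k4 k1 k3.
have k7 : 0 <= N ^+ 2 * b by rewrite mulr_ge0// sqr_ge0.
have k8 : 0 <= N ^+ 3 * c by rewrite mulr_ge0// exprn_ge0.
lra.
Qed.

Lemma sig2_gt0 : 0 < sig2 n mu e.
Proof. by apply: lt_le_trans sig2_lower; have := al_gt0; have := be_ge0; lra. Qed.

(** The last three terms are written as quadratic monomials in [al] and [be] divided by N or [al],
    ready for comparison with (al + be)^2 times 1/N or 1/al. *)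
Lemma Qall_split (G C T : R) :
  Ew mu (fun x => cdeg mu e x ^+ 4) <= G ->
  Ew mu (fun y => Ew mu (fun z => cov mu e y z ^+ 2)) <= C ->
  Ew mu (fun y => tau mu e y ^+ 2) <= T ->
  Qall n mu e <= N ^+ 5 * (G + T) + N ^+ 4 * C +
    (2 * al ^+ 2 / N + 2 * al * be / al + al ^+ 2 / al).
Proof.
move=> hG hC hT; rewrite /Qall /Qfluct.
have n5 := exprn_ge0 5 (ler0n R n); have n4 := exprn_ge0 4 (ler0n R n).
have n3 := exprn_ge0 3 (ler0n R n); have n2 := exprn_ge0 2 (ler0n R n).
have g1 := ler_wpM2l n5 hG; have g2 := ler_wpM2l n4 hC; have g3 := ler_wpM2l n5 hT.
have g4 := ler_wpM2l n3 (Ew_vdeg2 m p_bnd).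
have g5 : N ^+ 2 * Ew mu (vdeg mu e) <= al.
  by rewrite Ew_vdeg// /al ler_wpM2l// lerBlDr lerDl s1_ge0.
have a0 := lt0r_neq0 al_gt0.
have N0 : N != 0 by apply: lt0r_neq0; move: N4; lra.
have -> : al ^+ 2 / al = al by field.
have -> : 2 * al * be / al = 2 * be by field.
have -> : 2 * al ^+ 2 / N = 2 * (N ^+ 3 * (q * (1 - q)) ^+ 2) by rewrite /al; field.
rewrite /be; lra.
Qed.

(** The error that the p^4 and p^5 terms of the expansions produce relative to (al + be)^2; [y_sqr]
    then trades it for 1/M and 1/al. *)
Let y := (N * M * p)^-1.

Lemma y_gt0 : 0 < y.
Proof. by rewrite invr_gt0 !mulr_gt0//; move: N4 M1; lra. Qed.

Lemma y_sqr : y ^+ 2 <= M^-1 * al^-1.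
Proof.
have N0 : 0 < N by move: N4; lra. have M0 : 0 < M by move: M1; lra.
have P1 : 0 < (N * M * p) ^+ 2 by rewrite exprn_gt0// !mulr_gt0.
have P2 : 0 < M * al by rewrite mulr_gt0// al_gt0.
rewrite /y exprVn -invfM lef_pV2 ?posrE//.
have h : al <= N ^+ 2 * (M * p ^+ 2).
  rewrite /al ler_wpM2l ?sqr_ge0//; have := qf_ge; have := qf_gt0; have := qf_lt1; nra.
by have := ler_wpM2l (ltW M0) h; lra.
Qed.

Section SmallP.
Hypothesis mp : M * p ^+ 3 <= 1.

Definition Kq : R := 900 * expR 8.

Lemma Kq_ge0 : 0 <= Kq.
Proof. by apply: mulr_ge0; [exact: ler0n|exact: expR_ge0]. Qed.

(** N^3 t is a lower bound for [be] up to 9/10, and the terms (m p^3)^2 q^4 equal t^2; every term is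
    thus measured against [al] and [be]. *)
Lemma Qall_small : Qall n mu e <= Kq * ((al + be) ^+ 2 * (al^-1 + N^-1 + y)).
Proof.
have := Qall_split (small_cdeg4 p_bnd mp) (small_cov2 p_bnd mp) (small_tau2 p_bnd mp).
rewrite /E8 /Kq; set E := expR 8; have E1 : 1 <= E := E8_ge1 R.
move/le_trans; apply.
have N0 : 0 < N by move: N4; lra. have M0 : 0 < M by move: M1; lra.
have be0 := be_ge0; have al0 := al_gt0; have y0 := y_gt0.
pose t := q ^+ 2 * (M * p ^+ 3).
have t0 : 0 <= t := mulr_ge0 (sqr_ge0 _) mp3.
have hb : 9 / 10 * (N ^+ 3 * t) <= be.
  have := ler_wpM2l (exprn_ge0 3 (ltW N0)) (cov1_lower m p_bnd); rewrite /be /t; lra.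
have hb2 : 81 / 100 * (N ^+ 3 * t) ^+ 2 <= be ^+ 2.
  have h0 : 0 <= 9 / 10 * (N ^+ 3 * t) by apply: mulr_ge0; [lra|apply: mulr_ge0 => //; exact: exprn_ge0 (ltW N0)].
  have : (9 / 10 * (N ^+ 3 * t)) ^+ 2 <= be ^+ 2 by rewrite lerXn2r ?nnegrE.
  by lra.
have bb : 0 <= be ^+ 2 := sqr_ge0 be.
have ab : 0 <= al * be by rewrite mulr_ge0// ltW.
have yE : y * (N * M * p) = 1 by rewrite mulVf// !mulf_neq0 ?lt0r_neq0.
have i1 : N ^+ 5 * t ^+ 2 <= 5 / 4 * be ^+ 2 / N.
  rewrite ler_pdivlMr//; have -> : N ^+ 5 * t ^+ 2 * N = (N ^+ 3 * t) ^+ 2 by ring.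
  by lra.
have i2 : N ^+ 4 * t ^+ 2 <= N ^+ 5 * t ^+ 2.
  by rewrite ler_wpM2r ?sqr_ge0// ler_weXn2l//; move: N4; lra.
have i3 : N ^+ 5 * (q ^+ 4 * (M * p ^+ 5)) <= 5 / 4 * be ^+ 2 * y.
  have -> : N ^+ 5 * (q ^+ 4 * (M * p ^+ 5)) = (N ^+ 3 * t) ^+ 2 * y.
    rewrite -[LHS]mulr1 -yE /t; ring.
  by rewrite ler_wpM2r ?(ltW y0)//; lra.
(* One factor is paid by [al] rather than [be]: q M p^2 <= 1 - q turns N^2 q (q M p^2) into at most
   [al]. *)
have i4 : N ^+ 4 * (q ^+ 4 * (M * p ^+ 4)) <= 5 / 4 * (al * be) * y.
  have qq : q * (M * p ^+ 2) <= 1 - q by have := qf_lin; lra.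
  have -> : N ^+ 4 * (q ^+ 4 * (M * p ^+ 4)) =
      (N ^+ 2 * (q * (q * (M * p ^+ 2)))) * (N ^+ 3 * t) * y.
    by rewrite /t; move: yE; move: y q => Y q' E'; rewrite -[LHS]mulr1 -[X in _ * X]E'; ring.
  rewrite ler_wpM2r ?(ltW y0)//.
  have h1 : N ^+ 2 * (q * (q * (M * p ^+ 2))) <= al.
    by rewrite /al ler_wpM2l ?sqr_ge0// ler_wpM2l// ltW ?qf_gt0.
  have h2 : 0 <= N ^+ 3 * t by rewrite mulr_ge0 ?exprn_ge0 ?(ltW N0).
  have h3 := ler_wpM2r h2 h1.
  have h4 := ler_wpM2l (ltW al0) hb; lra.
have -> : N ^+ 5 * (q ^+ 4 * (M * (2 * p ^+ 5) + 448 * E * (M * p ^+ 3) ^+ 2) +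
   q ^+ 4 * (M * (2 * p ^+ 5) + 128 * E * (M * p ^+ 3) ^+ 2)) +
   N ^+ 4 * (q ^+ 4 * (M * (2 * p ^+ 4) + 128 * E * (M * p ^+ 3) ^+ 2)) =
   4 * (N ^+ 5 * (q ^+ 4 * (M * p ^+ 5))) + 576 * (E * (N ^+ 5 * t ^+ 2)) +
   2 * (N ^+ 4 * (q ^+ 4 * (M * p ^+ 4))) + 128 * (E * (N ^+ 4 * t ^+ 2)).
  by rewrite /t; ring.
have E0 : 0 <= E by lra.
have j1 := ler_wpM2l E0 i1; have j2 := ler_wpM2l E0 i2.
move: (al^-1) (N^-1) (invr_gt0 al) (invr_gt0 N) j1 i3 i4 => ia iN.
rewrite al0 N0 => ia0 iN0 j1 i3 i4.
have E1' : 0 <= E - 1 by lra.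
have mono (X z : R) : 0 <= X -> 0 <= z -> 0 <= X * z /\ X * z <= E * (X * z).
  move=> X0 z0; have h : 0 <= X * z by rewrite mulr_ge0.
  by split => //; rewrite ler_peMl.
have aa : 0 <= al ^+ 2 := sqr_ge0 al.
have [a1 a2] := mono _ _ aa (ltW ia0); have [a3 a4] := mono _ _ aa (ltW iN0).
have [a5 a6] := mono _ _ aa (ltW y0); have [b1 b2] := mono _ _ ab (ltW ia0).
have [b3 b4] := mono _ _ ab (ltW iN0); have [b5 b6] := mono _ _ ab (ltW y0).
have [c1 c2] := mono _ _ bb (ltW ia0); have [c3 c4] := mono _ _ bb (ltW iN0).
have [c5 c6] := mono _ _ bb (ltW y0).
have -> : 900 * E * ((al + be) ^+ 2 * (ia + iN + y)) =
  900 * (E * (al ^+ 2 * ia) + E * (al ^+ 2 * iN) + E * (al ^+ 2 * y)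
   + 2 * (E * (al * be * ia)) + 2 * (E * (al * be * iN)) + 2 * (E * (al * be * y))
   + E * (be ^+ 2 * ia) + E * (be ^+ 2 * iN) + E * (be ^+ 2 * y)) by ring.
have -> : 2 * al ^+ 2 * iN + 2 * al * be * ia + al ^+ 2 * ia =
  2 * (al ^+ 2 * iN) + 2 * (al * be * ia) + al ^+ 2 * ia by ring.
have j1' : E * (N ^+ 5 * t ^+ 2) <= 5 / 4 * (E * (be ^+ 2 * iN)) by lra.
have i3' : N ^+ 5 * (q ^+ 4 * (M * p ^+ 5)) <= 5 / 4 * (be ^+ 2 * y) by lra.
have i4' : N ^+ 4 * (q ^+ 4 * (M * p ^+ 4)) <= 5 / 4 * (al * be * y) by lra.
clear - j1' i3' i4' j2 a1 a2 a3 a4 a5 a6 b1 b2 b3 b4 b5 b6 c1 c2 c3 c4 c5 c6.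
lra.
Qed.

Lemma Qall_small_m : Qall n mu e <= 2 * Kq * ((al + be) ^+ 2 * (al^-1 + N^-1 + M^-1)).
Proof.
apply: le_trans Qall_small _.
have ia0 : 0 < al^-1 by rewrite invr_gt0 al_gt0.
have iM0 : 0 < M^-1 by rewrite invr_gt0; move: M1; lra.
have iN0 : 0 < N^-1 by rewrite invr_gt0; move: N4; lra.
(* Geometric mean against sum, from [y_sqr]. *)
have hy : y <= M^-1 + al^-1.
  have h := y_sqr; have uv := mulr_ge0 (ltW iM0) (ltW ia0).
  have su := sqr_ge0 M^-1; have sv := sqr_ge0 al^-1.
  have y0 := ltW y_gt0; have w0 := addr_ge0 (ltW iM0) (ltW ia0).
  rewrite -ler_sqr ?nnegrE//; move: h uv su sv.
  by move: (M^-1) (al^-1) y => u v w; lra.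
have E0 : 0 <= Kq := Kq_ge0.
rewrite (_ : 2 * Kq * _ = Kq * ((al + be) ^+ 2 * (2 * (al^-1 + N^-1 + M^-1)))); last by ring.
by apply: (ler_wpM2l E0); apply: (ler_wpM2l (sqr_ge0 _)); lra.
Qed.

End SmallP.

Lemma sqrt_inv_al : Num.sqrt al^-1 ^+ 2 = al^-1.
Proof. by rewrite sqr_sqrtr// invr_ge0 ltW ?al_gt0. Qed.

(** For al >= 1 each of 1/al, 1/N and y is at most rho = al^(-1/2). For m p^3 >= 1 the excess over
    [be ^+ 2] lies in [M4], which [M4_le] and al <= N^2 q bound by N M2^2 rho. *)
Lemma Qall_root : 1 <= al -> Qall n mu e <= 3 * Kq * ((al + be) ^+ 2 * Num.sqrt al^-1).
Proof.
move=> al1; set rho := Num.sqrt al^-1.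
have rho2 : rho ^+ 2 = al^-1 := sqrt_inv_al.
have ia0 : 0 < al^-1 by rewrite invr_gt0 al_gt0.
have rho0 : 0 < rho by rewrite sqrtr_gt0.
have ia1 : al^-1 <= 1 by rewrite invf_le1 ?al_gt0.
have rho1 : rho <= 1 by rewrite -sqrtr1 ler_wsqrtr.
have r1 : al^-1 <= rho by rewrite -rho2 expr2 ler_piMl// ltW.
have N0 : 0 < N by move: N4; lra.
have r2 : N^-1 <= rho.
  rewrite -ler_sqr ?nnegrE ?invr_ge0 ?(ltW N0) ?(ltW rho0)// rho2.
  rewrite exprVn lef_pV2 ?posrE ?al_gt0 ?exprn_gt0// /al.
  rewrite ler_piMr ?sqr_ge0//; have := qf_gt0; have := qf_lt1; nra.
have E0 : 0 <= Kq := Kq_ge0.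
have [mp|/ltW mp] := leP (M * p ^+ 3) 1.
  apply: le_trans (Qall_small mp) _.
  have r3 : y <= rho.
    rewrite -ler_sqr ?nnegrE ?(ltW y_gt0) ?(ltW rho0)// rho2; apply: le_trans y_sqr _.
    by rewrite ler_piMl ?(ltW ia0)// invf_le1//; move: M1; lra.
  rewrite (_ : 3 * Kq * _ = Kq * ((al + be) ^+ 2 * (3 * rho))); last by ring.
  by apply: (ler_wpM2l E0); apply: (ler_wpM2l (sqr_ge0 _)); lra.
have := Qall_split (large_cdeg4 m p_bnd) (large_cov2 m p_bnd) (large_tau2 m p_bnd).
move/le_trans; apply.
set M4 := mk p 4 ^+ m; set M2 := mk p 2 ^+ m.
have mk0 k : 0 <= mk p k.
  by rewrite /mk addr_ge0 ?mulr_ge0 ?exprn_ge0 ?(ltW p0)//; move: p1; lra.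
have M40 : 0 <= M4 by rewrite exprn_ge0.
have M20 : 0 <= M2 by rewrite exprn_ge0.
have hM : M4 <= N * M2 ^+ 2 * rho.
  rewrite -ler_sqr ?nnegrE ?mulr_ge0 ?sqr_ge0 ?(ltW N0) ?(ltW rho0)//.
  rewrite exprMn rho2 ler_pdivlMr ?al_gt0// /al.
  have h := M4_le m p_bnd; rewrite -/M4 -/M2 in h.
  rewrite (_ : (N * M2 ^+ 2) ^+ 2 = N ^+ 2 * M2 ^+ 4); last by ring.
  rewrite mulrCA; apply: ler_wpM2l; first exact: sqr_ge0.
  apply: le_trans h; apply: ler_wpM2l; first exact: sqr_ge0.
  by rewrite ler_piMr ?(ltW qf_gt0)//; have := qf_gt0; lra.
have hbe : 2 / 5 * (N ^+ 3 * M2) <= be.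
  have := ler_wpM2l (exprn_ge0 3 (ltW N0)) (large_cov1 p_bnd mp); rewrite /be -/M2; lra.
have hb2 : 4 / 25 * (N ^+ 3 * M2) ^+ 2 <= be ^+ 2.
  have h0 : 0 <= 2 / 5 * (N ^+ 3 * M2) by apply: mulr_ge0; [lra|apply: mulr_ge0 => //; exact: exprn_ge0 (ltW N0)].
  have : (2 / 5 * (N ^+ 3 * M2)) ^+ 2 <= be ^+ 2 by rewrite lerXn2r ?nnegrE ?be_ge0.
  by lra.
have k1 : N ^+ 5 * M4 <= 25 / 4 * (be ^+ 2 * rho).
  apply: le_trans (ler_wpM2l (exprn_ge0 5 (ltW N0)) hM) _.
  have -> : N ^+ 5 * (N * M2 ^+ 2 * rho) = (N ^+ 3 * M2) ^+ 2 * rho by ring.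
  by rewrite mulrA ler_wpM2r ?(ltW rho0)//; lra.
have k2 : N ^+ 4 * M4 <= N ^+ 5 * M4.
  by rewrite ler_wpM2r// ler_weXn2l//; move: N4; lra.
have al0 := al_gt0; have be0 := be_ge0.
have aa : 0 <= al ^+ 2 := sqr_ge0 al.
have ab : 0 <= al * be by rewrite mulr_ge0// ltW.
have bb : 0 <= be ^+ 2 := sqr_ge0 be.
have k3 : al ^+ 2 * N^-1 <= al ^+ 2 * rho by rewrite ler_wpM2l.
have k4 : al ^+ 2 * al^-1 <= al ^+ 2 * rho by rewrite ler_wpM2l.
have k5 : al * be * al^-1 <= al * be * rho by rewrite ler_wpM2l.
have c1 : 0 <= al ^+ 2 * rho by rewrite mulr_ge0// ltW.
have c2 : 0 <= al * be * rho by rewrite mulr_ge0// ltW.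
have c3 : 0 <= be ^+ 2 * rho by rewrite mulr_ge0// ltW.
have KE : 900 <= Kq.
  by have := E8_ge1 R; rewrite /Kq -/(E8 R); move: (E8 R) => E ?; lra.
apply: le_trans (_ : 900 * ((al + be) ^+ 2 * rho) <= _); last first.
  by rewrite ler_wpM2r ?mulr_ge0 ?sqr_ge0 ?(ltW rho0)//; lra.
clear - k1 k2 k3 k4 k5 c1 c2 c3.
lra.
Qed.

End QuadraticBounds.

(** * Normal approximation and convergence *)

Section Bridge.
Variables (R : realType) (n m : nat) (p : R).
Notation att := {ffun 'I_m -> bool}.
Notation Ex := (Ew (prod_weight (@amu R m p))).
Notation e := (@meet R m).

Definition curry_out (w : rig_outcome n m) : {ffun 'I_n -> att} :=
  [ffun i => [ffun k => w (i, k)]].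
Definition uncurry_out (v : {ffun 'I_n -> att}) : rig_outcome n m :=
  [ffun x => v x.1 x.2].

Lemma curry_outK : cancel curry_out uncurry_out.
Proof. by move=> w; apply/ffunP => -[i k]; rewrite !ffunE. Qed.

Lemma uncurry_outK : cancel uncurry_out curry_out.
Proof. by move=> v; apply/ffunP => i; apply/ffunP => k; rewrite !ffunE. Qed.

Lemma rig_weight_curry (w : rig_outcome n m) :
  rig_weight p w = prod_weight (@amu R m p) (curry_out w).
Proof.
rewrite /rig_weight /prod_weight /amu /prod_weight.
transitivity (\prod_(x : 'I_n * 'I_m) (if w (x.1, x.2) then p else 1 - p)).
  by apply: eq_bigr => -[i k].
rewrite -(pair_bigA _ (fun i k => if w (i, k) then p else 1 - p)) /=.
by apply: eq_bigr => i _; apply: eq_bigr => k _; rewrite /bern !ffunE.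
Qed.

Lemma rig_E_curry (X : {ffun 'I_n -> att} -> R) :
  rig_E p (fun w => X (curry_out w)) = Ex X.
Proof.
rewrite /rig_E /Ew (reindex curry_out) /=; last first.
  by exists uncurry_out => w _; [exact: curry_outK|exact: uncurry_outK].
by apply: eq_bigr => w _; rewrite rig_weight_curry.
Qed.

Lemma eq_rig_E (X Y : rig_outcome n m -> R) : X =1 Y -> rig_E p X = rig_E p Y.
Proof. by move=> XY; apply: eq_bigr => w _; rewrite XY. Qed.

Lemma rig_NE_curry (w : rig_outcome n m) : rig_NE R w = Ncount e (curry_out w).
Proof.
set v := curry_out w; set f := fun i j => e (v i) (v j).
have eS : rig_NE R w = \sum_(i < n) \sum_(j < n | (i < j)%N) f i j.
  rewrite /rig_NE /rig_edges -sum1_card natr_sum.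
  rewrite (eq_bigl (fun x : 'I_n * 'I_n => (x.1 < x.2)%N && [exists k, w (x.1, k) && w (x.2, k)])); last first.
    by move=> x; apply/idP/idP; rewrite in_setE.
  rewrite big_mkcondr /= pair_big_dep /=; apply: eq_bigr => -[i j] _ /=.
  rewrite /f /meet /v; congr (if _ then _ else _).
  by apply: eq_existsb => k; rewrite !ffunE.
rewrite /Ncount -/f.
rewrite (eq_bigr (fun i : 'I_n => \sum_(j < n | (i < j)%N) f i j + \sum_(j < n | (j < i)%N) f i j)); last first.
  move=> i _; rewrite (bigID (fun j : 'I_n => (i < j)%N)) /=; congr (_ + _); apply: eq_bigl => j.
    by rewrite andbC; case: ltnP => //= ij; rewrite neq_ltn ij orbT.
  by rewrite -leqNgt -val_eqE /= ltn_neqAle.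
rewrite big_split /= [X in _ + X](exchange_big_dep predT) //= eS.
rewrite [X in _ + X](_ : _ = \sum_(i < n) \sum_(j < n | (i < j)%N) f i j).
  by move: (\sum_(i < n) _) => S; field.
by apply: eq_bigr => i _; apply: eq_bigr => j _; rewrite /f meet_sym.
Qed.

Lemma rig_mean_curry : @rig_mean R n m p = Ex (@Ncount R n _ e).
Proof. by rewrite /rig_mean -rig_E_curry; apply: eq_rig_E => w; rewrite rig_NE_curry. Qed.

Lemma rig_var_curry : @rig_var R n m p = sig2 n (@amu R m p) e.
Proof.
rewrite /rig_var /sig2 -rig_E_curry; apply: eq_rig_E => w.
by rewrite rig_NE_curry rig_mean_curry.
Qed.

Notation sg := (Num.sqrt (sig2 n (@amu R m p) e)).

Notation Wz := (@Wc R n _ (@amu R m p) e sg).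

Lemma rig_Z_curry (w : rig_outcome n m) :
  rig_Z p w = Wz (curry_out w).
Proof. by rewrite /rig_Z /Wc /Fc rig_var_curry rig_NE_curry rig_mean_curry. Qed.

Lemma rig_cdf_curry t : rig_cdf n m p t = Ex (fun w => ind t (Wz w)).
Proof. by rewrite /rig_cdf -rig_E_curry; apply: eq_rig_E => w; rewrite rig_Z_curry. Qed.

Lemma rig_E_phi_curry (phi : R -> R) :
  rig_E p (fun w : rig_outcome n m => phi (rig_Z p w)) =
  Ex (fun w => phi (Wz w)).
Proof. by rewrite -rig_E_curry; apply: eq_rig_E => w; rewrite rig_Z_curry. Qed.

Hypothesis p_bnd : 0 < p <= 1 / 10.
Let amuP := amu_prob m p_bnd.
Let Pex := prod_weight_prob 'I_n amuP.

(** 220 = 46 * 2 + 64 * 2 serves the Kolmogorov distance, where f' and H are bounded by 2; the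
    second summand serves the Wasserstein distance. *)
Definition Kd : R := 220 + (46 * lipB R + 97 * lipL R).

Let A0 : 0 <= abs_moment R.
Proof. by apply: Rintegral_ge0 => t _; rewrite mulr_ge0 ?gpdf_ge0. Qed.

Lemma lipL_ge0 : 0 <= lipL R.
Proof. by have := mulr_ge0 A0 (mills_ge0 (0 : R)); rewrite /lipL; move: A0; lra. Qed.

Lemma Kd_ge : 220 <= Kd /\ 46 * lipB R + 97 * lipL R <= Kd.
Proof.
have := lipL_ge0; have : 0 <= lipB R by rewrite /lipB; move: A0; lra.
by rewrite /Kd; split; lra.
Qed.

Section NormalApprox.
Hypothesis n_ge4 : (4 <= n)%N.
Hypothesis m_gt0 : (0 < m)%N.
Notation s2 := (sig2 n (@amu R m p) e).

Let s2_gt0 : 0 < s2 := sig2_gt0 p_bnd n_ge4 m_gt0.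
Let n2 : (2 <= n)%N. Proof. exact: leq_trans n_ge4. Qed.
Let sg_gt0 : 0 < sg. Proof. by rewrite sqrtr_gt0. Qed.
Let sg_sqr : sg ^+ 2 = s2. Proof. by rewrite sqr_sqrtr// ltW. Qed.

Lemma dKW_le (c : R) : (forall t, `|rig_cdf n m p t - Phi t| <= c) ->
  (forall phi (d : R), lipschitz1 phi -> normal_expect phi = d%:E ->
    `|phi 0 - d| <= abs_moment R -> `|Ex (fun w => phi (Wz w)) - d| <= c) ->
  (dKW_rig n m p <= c%:E)%E.
Proof.
move=> hK hW; rewrite /dKW_rig ge_max; apply/andP; split.
  by apply: ge_ereal_sup => _ [t _ <-]; rewrite lee_fin.
apply: ge_ereal_sup => _ [phi hl <-].
have [d [ed [hd _]]] := normal_expect_lipschitz hl.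
by rewrite ed -EFinB abse_EFin lee_fin rig_E_phi_curry; exact: hW.
Qed.

Lemma dKW_stein (r : R) : 0 < r -> Qall n (@amu R m p) e <= r ^+ 2 ->
  (dKW_rig n m p <= (Kd * (r / s2))%:E)%E.
Proof.
move=> r0 hr; have [k1 k2] := Kd_ge.
have rs0 : 0 <= r / s2 by rewrite divr_ge0// ltW.
apply: dKW_le => [t|phi d hl ed _].
- rewrite rig_cdf_curry.
  have := @stein_kolmogorov _ _ _ _ amuP _ (@meet_sym R m) (@meet01 R m) n2 sg r sg_gt0 sg_sqr r0 hr
    (sol t) (solp t) 2 (solp_bound t) (solH t) 2 (sol_remainder t) (solH_bound t).
  rewrite sg_sqr (eq_Ew _ (g := fun w => ind t (Wz w) - Phi t)); last first.
    by move=> w; rewrite /solp; ring.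
  rewrite EwB (Ew_cst Pex) => /le_trans; apply.
  by apply: ler_wpM2r => //; lra.
- have [c [f [fp [ec hf hfp hrem _]]]] := stein_lipschitz hl.
  have dc : d = c by move: ec; rewrite ed => -[].
  have := @stein_wasserstein _ _ _ _ amuP _ (@meet_sym R m) (@meet01 R m) n2 sg r sg_gt0 sg_sqr r0 hr
    f fp (lipB R) hfp (lipL R) lipL_ge0 hrem.
  rewrite sg_sqr (eq_Ew _ (g := fun w => phi (Wz w) - c)); last first.
    by move=> w; rewrite hf.
  rewrite EwB (Ew_cst Pex) -dc => /le_trans; apply.
  by apply: ler_wpM2r.
Qed.

Lemma Ew_ind01 t : 0 <= Ex (fun w => ind t (Wz w)) <= 1.
Proof.
apply/andP; split; first by apply: Ew_ge0 => [|w]; [exact: Pex|case/andP: (ind01 t (Wz w))].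
rewrite -[leRHS](Ew_cst Pex); apply: Ew_le => [|w]; first exact: Pex.
by case/andP: (ind01 t (Wz w)).
Qed.

(** Covers al < 1, where the claimed bound exceeds a constant. The Wasserstein part uses E|W| <= 1,
    as W has second moment 1. *)
Lemma dKW_trivial : (dKW_rig n m p <= (2 + abs_moment R)%:E)%E.
Proof.
apply: dKW_le => [t|phi d hl ed hd].
- rewrite rig_cdf_curry; have /andP[a b] := Ew_ind01 t.
  have c := Phi_ge0 t; have d := Phi_le1 t.
  by rewrite ler_norml; apply/andP; split; move: A0; lra.
- rewrite -[X in _ - X](Ew_cst Pex) -EwB; apply: le_trans (Ew_norm Pex _) _.
  apply: le_trans (_ : Ex (fun w => `|Wz w| + abs_moment R) <= _).
    apply: Ew_le => [|w]; first exact: Pex.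
    have := hl (Wz w) 0; rewrite subr0 => h.
    have := ler_normD (phi (Wz w) - phi 0) (phi 0 - d).
    by rewrite addrA subrK; lra.
  rewrite EwD (Ew_cst Pex) lerD2r; apply: le_trans (_ : 1 <= _); last by lra.
  apply: (Ex_abs_le amuP) => //.
  rewrite (eq_Ew _ (g := fun w => s2^-1 * @Fc R n _ (@amu R m p) e w ^+ 2)); last first.
    by move=> w; rewrite /Wc exprMn exprVn sg_sqr mulrC.
  by rewrite EwZ mulVf ?gt_eqF// expr1n.
Qed.

End NormalApprox.
End Bridge.

(** * Explicit distance bounds and the lattice argument *)

Section FinalBounds.
Variables (R : realType) (n m : nat) (p : R).
Hypothesis p_bnd : 0 < p <= 1 / 10.
Hypothesis n_ge4 : (4 <= n)%N.
Hypothesis m_gt0 : (0 < m)%N.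
Notation e := (@meet R m).
Notation s2 := (sig2 n (@amu R m p) e).
Notation aln := (al n m p).
Notation ben := (be n m p).

Let al0 : 0 < aln := al_gt0 p_bnd n_ge4 m_gt0.
Let be0 : 0 <= ben := be_ge0 n m p_bnd.

Lemma alE : n%:R ^+ 2 * phat m p * (1 - phat m p) = aln.
Proof. by rewrite /al /phat subKr /qf; ring. Qed.

Lemma Kd_gt0 : 0 < Kd R.
Proof. by have [h _] := Kd_ge R; lra. Qed.

(** Takes r = sqrt(K Y) (al + be); dividing by the variance, at least (al + be)/4, leaves the factor
    4. *)
Lemma dKW_of_Q (K Y : R) : 0 < K -> 0 < Y ->
  Qall n (@amu R m p) e <= K * ((aln + ben) ^+ 2 * Y) ->
  (dKW_rig n m p <= (4 * Kd R * Num.sqrt K * Num.sqrt Y)%:E)%E.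
Proof.
move=> K0 Y0 hQ; set k := Num.sqrt K; set z := Num.sqrt Y.
have k0 : 0 < k by rewrite sqrtr_gt0.
have z0 : 0 < z by rewrite sqrtr_gt0.
have S0 : 0 < aln + ben by rewrite ltr_wpDr.
have r0 : 0 < k * z * (aln + ben) by rewrite !mulr_gt0.
have hr : Qall n (@amu R m p) e <= (k * z * (aln + ben)) ^+ 2.
  rewrite !exprMn sqr_sqrtr ?(ltW K0)// sqr_sqrtr ?(ltW Y0)//.
  by apply: le_trans hQ _; rewrite le_eqVlt; apply/orP; left; apply/eqP; ring.
apply: le_trans (dKW_stein p_bnd n_ge4 m_gt0 r0 hr) _; rewrite lee_fin.
have s20 := sig2_gt0 p_bnd n_ge4 m_gt0.
rewrite (_ : 4 * _ * _ * _ = Kd R * (4 * k * z)); last by ring.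
apply: ler_wpM2l; first exact/ltW/Kd_gt0.
rewrite ler_pdivrMr//.
rewrite (_ : 4 * k * z * s2 = (k * z) * (4 * s2)); last by ring.
apply: ler_wpM2l; first by rewrite ltW// mulr_gt0.
by have := sig2_lower p_bnd n_ge4 m_gt0; lra.
Qed.

Definition Cmain : R := 4 * Kd R * Num.sqrt (3 * Kq R) + (2 + abs_moment R).

Let Kq_gt0 : 0 < Kq R.
Proof. by apply: mulr_gt0; [exact: ltr0n|exact: expR_gt0]. Qed.

Let A0 : 0 <= abs_moment R.
Proof. by apply: Rintegral_ge0 => t _; rewrite mulr_ge0 ?gpdf_ge0. Qed.

Lemma Cmain_gt0 : 0 < Cmain.
Proof.
have k0 := Kd_gt0; have := sqrtr_ge0 (3 * Kq R) => s0.
have : 0 <= 4 * Kd R * Num.sqrt (3 * Kq R) by rewrite mulr_ge0//; lra.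
by rewrite /Cmain; move: A0; lra.
Qed.

Lemma dKW_main : (dKW_rig n m p <= (Cmain * Num.sqrt (Num.sqrt aln^-1))%:E)%E.
Proof.
set rho := Num.sqrt aln^-1.
have ia0 : 0 < aln^-1 by rewrite invr_gt0.
have rho0 : 0 < rho by rewrite sqrtr_gt0.
have c1 : 0 <= 4 * Kd R * Num.sqrt (3 * Kq R).
  by have k0 := Kd_gt0; have s0 := sqrtr_ge0 (3 * Kq R); rewrite mulr_ge0//; lra.
have [al1|al1] := leP 1 aln.
  have K30 : 0 < 3 * Kq R by rewrite mulr_gt0.
  apply: le_trans (dKW_of_Q K30 rho0 (Qall_root p_bnd n_ge4 m_gt0 al1)) _.
  rewrite lee_fin; apply: ler_wpM2r; first exact: sqrtr_ge0.
  by rewrite /Cmain lerDl; move: A0; lra.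
apply: le_trans (dKW_trivial p_bnd n_ge4 m_gt0) _; rewrite lee_fin.
have h1 : 1 <= aln^-1 by rewrite invf_ge1// ltW.
have h2 : 1 <= rho by rewrite -[leLHS]sqrtr1 ler_wsqrtr.
have h3 : 1 <= Num.sqrt rho by rewrite -[leLHS]sqrtr1 ler_wsqrtr.
have C0 := Cmain_gt0; apply: le_trans (_ : Cmain * 1 <= _); last by rewrite ler_wpM2l// ltW.
by rewrite mulr1 /Cmain lerDr.
Qed.

Lemma dKW_small : m%:R * p ^+ 3 <= 1 ->
  (dKW_rig n m p <= (Cmain * Num.sqrt (aln^-1 + n%:R^-1 + m%:R^-1))%:E)%E.
Proof.
move=> mp.
have K20 : 0 < 2 * Kq R by rewrite mulr_gt0.
have Y0 : 0 < aln^-1 + n%:R^-1 + m%:R^-1.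
  by rewrite !addr_gt0 ?invr_gt0 ?ltr0n//; apply: leq_trans n_ge4.
apply: le_trans (dKW_of_Q K20 Y0 (Qall_small_m p_bnd n_ge4 m_gt0 mp)) _.
rewrite lee_fin; apply: ler_wpM2r; first exact: sqrtr_ge0.
have h : Num.sqrt (2 * Kq R) <= Num.sqrt (3 * Kq R).
  by rewrite ler_wsqrtr// ler_wpM2r ?(ltW Kq_gt0)//; lra.
have k0 : 0 <= 4 * Kd R by have := Kd_gt0; lra.
by have := ler_wpM2l k0 h; rewrite /Cmain; move: A0; lra.
Qed.

Lemma subrX_le (x y : R) k : 0 <= y -> y <= x -> x <= 1 -> x ^+ k - y ^+ k <= k%:R * (x - y).
Proof.
move=> y0 yx x1; elim: k => [|k IH]; first by rewrite !expr0 mul0r subrr.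
rewrite (exprS x) (exprS y) -(natr1 k).
rewrite (_ : _ - _ = x * (x ^+ k - y ^+ k) + y ^+ k * (x - y)); last by ring.
have yk : 0 <= y ^+ k <= 1 by rewrite exprn_ge0//= exprn_ile1//; apply: le_trans x1.
have xy : 0 <= x - y by rewrite subr_ge0.
have : y ^+ k * (x - y) <= 1 * (x - y) by apply: ler_wpM2r => //; case/andP: yk.
have d0 : 0 <= x ^+ k - y ^+ k.
  by rewrite subr_ge0 lerXn2r ?nnegrE//; apply: le_trans yx.
have : x * (x ^+ k - y ^+ k) <= 1 * (x ^+ k - y ^+ k) by apply: ler_wpM2r.
lra.
Qed.

Lemma le_of_sqr (z c : R) : z ^+ 2 <= c -> z <= 1 + c.
Proof. by have := sqr_ge0 (z - 1); have := sqr_ge0 z; nra. Qed.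

(** For q <= 1/2, n^2 q is bounded and Var u is at most q^(3/2); for q > 1/2, n^2 m p^2 is bounded
    and Var u is at most m p^3. Either way be^2 is at most the cube of the bounded quantity. *)
Lemma be_bound (K : R) : aln <= K -> ben <= 1 + 64 * K ^+ 3.
Proof.
move=> hK; have K0 : 0 < K := lt_le_trans al0 hK.
have /andP[p0 p1] := p_bnd.
have q0 := qf_gt0 m p_bnd; have q1 := qf_lt1 p_bnd m_gt0.
have N0 : 0 < (n%:R : R) by rewrite ltr0n; apply: leq_trans n_ge4.
have M1 : 1 <= (m%:R : R) by rewrite ler1n.
have K3 : 0 < K ^+ 3 by rewrite exprn_gt0.
apply: le_of_sqr.
have [qs|qs] := leP (qf m p) (1 / 2).
  have h : n%:R ^+ 2 * qf m p <= 2 * K.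
    have : n%:R ^+ 2 * (qf m p * (1 / 2)) <= aln.
      by rewrite /al; apply: (ler_wpM2l (sqr_ge0 _)); apply: (ler_wpM2l (ltW q0)); lra.
    by lra.
  have mk2 : 0 <= mk p 2 by rewrite /mk addr_ge0 ?mulr_ge0 ?sqr_ge0 ?(ltW p0)//; lra.
  have s1M : cov1 (@amu R m p) e <= mk p 2 ^+ m.
    by rewrite cov1_meet// gerBl sqr_ge0.
  (* The m-th power of [mk p 2 ^+ 2 <= (1 - p ^+ 2) ^+ 3]. *)
  have s1q : cov1 (@amu R m p) e ^+ 2 <= qf m p ^+ 3.
    have s0 : 0 <= cov1 (@amu R m p) e := s1_ge0 m p_bnd.
    apply: le_trans (_ : (mk p 2 ^+ m) ^+ 2 <= _).
      by rewrite lerXn2r ?nnegrE ?exprn_ge0.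
    rewrite /qf -!exprM ![(m * _)%N]mulnC !exprM; apply: lerXn2r.
    - by rewrite nnegrE sqr_ge0.
    - by rewrite nnegrE exprn_ge0//; nra.
    rewrite -subr_ge0 (_ : _ - _ = p ^+ 2 * (1 - 2 * p - p ^+ 2 + 4 * p ^+ 3 - 2 * p ^+ 4)); last first.
      by rewrite /mk; ring.
    apply: (mulr_ge0 (sqr_ge0 _)).
    have p2 : p ^+ 2 <= 1 / 100 by nra.
    have p4 : p ^+ 4 <= p ^+ 3 by rewrite ler_wiXn2l ?(ltW p0)//; lra.
    have p3 : 0 <= p ^+ 3 by rewrite exprn_ge0// ltW.
    by lra.
  have -> : ben ^+ 2 = (n%:R ^+ 2) ^+ 3 * cov1 (@amu R m p) e ^+ 2 by rewrite /be; ring.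
  apply: le_trans (ler_wpM2l _ s1q) _; first by rewrite exprn_ge0 ?sqr_ge0.
  rewrite -exprMn; apply: le_trans (_ : (2 * K) ^+ 3 <= _).
    by rewrite lerXn2r ?nnegrE ?mulr_ge0 ?sqr_ge0 ?(ltW q0) ?(ltW K0).
  by rewrite exprMn; lra.
have h1 : n%:R ^+ 2 * (m%:R * p ^+ 2) <= 4 * K.
  have mp0 : 0 <= m%:R * p ^+ 2 by rewrite mulr_ge0 ?sqr_ge0.
  have h2 : 1 / 4 * (m%:R * p ^+ 2) <= qf m p * (1 - qf m p).
    by have := qf_lin m p_bnd; nra.
  have : n%:R ^+ 2 * (1 / 4 * (m%:R * p ^+ 2)) <= aln.
    by rewrite /al; apply: (ler_wpM2l (sqr_ge0 _)).
  by lra.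
have s1b : cov1 (@amu R m p) e <= m%:R * p ^+ 3.
  have Q0 : 0 <= (1 - p ^+ 2) ^+ 2 by exact: sqr_ge0.
  have p30 : 0 <= p ^+ 3 by rewrite exprn_ge0// ltW.
  have d := dm2 p.
  have Q2 : (1 - p ^+ 2) ^+ 2 <= mk p 2.
    by rewrite -subr_ge0 d; apply: mulr_ge0 => //; lra.
  have m21 : mk p 2 <= 1 by rewrite /mk; nra.
  have := subrX_le m Q0 Q2 m21; rewrite Q1_exp -cov1_meet// d.
  move=> h; apply: le_trans h _; apply: ler_wpM2l => //.
  by rewrite ler_piMr//; lra.
have s0 : 0 <= cov1 (@amu R m p) e := s1_ge0 m p_bnd.
apply: le_trans (_ : (n%:R ^+ 3 * (m%:R * p ^+ 3)) ^+ 2 <= _).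
  rewrite lerXn2r ?nnegrE// ?mulr_ge0 ?exprn_ge0 ?(ltW p0)//.
  by rewrite /be ler_wpM2l// exprn_ge0.
apply: le_trans (_ : (4 * K) ^+ 3 <= _); last by rewrite exprMn; lra.
apply: le_trans (_ : (n%:R ^+ 2 * (m%:R * p ^+ 2)) ^+ 3 <= _); last first.
  by rewrite lerXn2r ?nnegrE ?mulr_ge0 ?exprn_ge0 ?(ltW p0) ?(ltW K0).
rewrite (_ : (n%:R ^+ 2 * (m%:R * p ^+ 2)) ^+ 3 = (n%:R ^+ 3 * (m%:R * p ^+ 3)) ^+ 2 * m%:R); last by ring.
by rewrite ler_peMr// sqr_ge0.
Qed.

Lemma cdf_lt_exists (s t : R) : rig_cdf n m p s < rig_cdf n m p t ->
  exists w : rig_outcome n m, s < rig_Z p w <= t.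
Proof.
apply: contraPP => /forallNP h; apply/negP; rewrite -leNgt.
have P := prod_weight_prob 'I_n (amu_prob m p_bnd).
rewrite /rig_cdf /rig_E; apply: ler_sum => w _.
rewrite rig_weight_curry; apply: ler_wpM2l; first exact: P.1.
by have := h w; case: (leP (rig_Z p w) t) => zt; case: (leP (rig_Z p w) s) => zs.
Qed.

(** Edge counts are integers, so distinct normalised values differ by at least one over the standard
    deviation. *)
Lemma lattice (w w' : rig_outcome n m) (v : R) : 0 < v -> s2 <= v ^+ 2 ->
  rig_Z p w < rig_Z p w' -> rig_Z p w + v^-1 <= rig_Z p w'.
Proof.
move=> v0 hv; rewrite /rig_Z rig_var_curry.
have s20 := sig2_gt0 p_bnd n_ge4 m_gt0.
have sg0 : 0 < Num.sqrt s2 by rewrite sqrtr_gt0.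
have sgv : Num.sqrt s2 <= v.
  by rewrite -[leRHS]gtr0_norm// -sqrtr_sqr ler_wsqrtr.
rewrite ltr_pM2r ?invr_gt0// ltrD2r /rig_NE ltr_nat => hlt.
have h : (rig_edges w)%:R + 1 <= (rig_edges w')%:R :> R by rewrite natr1 ler_nat.
have vi : v^-1 <= (Num.sqrt s2)^-1 by rewrite lef_pV2 ?posrE.
apply: le_trans (lerD (lexx _) vi) _.
rewrite -[X in _ + X]mul1r -mulrDl ler_wpM2r ?invr_ge0 ?(ltW sg0)//; lra.
Qed.

(** If [al] were below K, the spacing would be at least 1/v; but both (0, 1/(2v)] and (1/(2v), 1/v]
    carry mass, giving two distinct values less than 1/v apart. *)
Lemma al_large (K v : R) : 0 < v -> K + (1 + 64 * K ^+ 3) <= v ^+ 2 ->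
  rig_cdf n m p 0 < rig_cdf n m p ((2 * v)^-1) ->
  rig_cdf n m p ((2 * v)^-1) < rig_cdf n m p (v^-1) -> K <= aln.
Proof.
move=> v0 hv c1 c2; rewrite leNgt; apply/negP => hK.
have [w /andP[w1 w2]] := cdf_lt_exists c1.
have [w' /andP[w1' w2']] := cdf_lt_exists c2.
have s2v : s2 <= v ^+ 2.
  apply: le_trans (sig2_upper p_bnd n_ge4 m_gt0) _; apply: le_trans hv.
  by apply: lerD; [exact: ltW|apply: be_bound; exact: ltW].
have := lattice v0 s2v (le_lt_trans w2 w1').
lra.
Qed.

End FinalBounds.

(** * Limit statements from the explicit bounds *)

Section Limits.
Variable R : realType.

Lemma powR_quarter (x : R) : 0 <= x -> x `^ (4^-1) = Num.sqrt (Num.sqrt x).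
Proof.
move=> x0; rewrite -!powR12_sqrt ?powR_ge0// -powRrM; congr (_ `^ _).
by rewrite -invfM; congr (_^-1); ring.
Qed.

Lemma rig_cdf_dist (n m : nat) (p c t : R) : (dKW_rig n m p <= c%:E)%E ->
  `|rig_cdf n m p t - Phi t| <= c.
Proof.
move=> h; rewrite -lee_fin; apply: le_trans h.
rewrite /dKW_rig le_max; apply/orP; left.
by apply: ereal_sup_ubound; exists t.
Qed.

Variables (m : nat -> nat) (p : nat -> R).
Hypothesis m_cvgy : ((m n)%:R : R) @[n --> \oo] --> +oo.
Hypothesis p_bnd : forall n, 0 < p n <= 1 / 10.

Let nearm : \forall n \near \oo, (0 < m n)%N.
Proof.
have /cvgryPge/(_ 1) h := m_cvgy; near=> n.
by rewrite -(ler_nat R); near: n.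
Unshelve. all: by end_near. Qed.

Let nearn : \forall n \near \oo, (4 <= n)%N.
Proof. exact: nbhs_infty_ge. Qed.

Lemma cdf_cvg_variance :
  (forall t : R, rig_cdf n (m n) (p n) t @[n --> \oo] --> Phi t) ->
  (n%:R ^+ 2 * phat (m n) (p n) * (1 - phat (m n) (p n))) @[n --> \oo] --> +oo.
Proof.
move=> hc; apply/cvgryPge => K.
(* Any v >= 1 above the variance bound works, as v <= v^2; it depends on K alone, so the three test
   points stay fixed as n grows. *)
pose v := 1 + `|K + (1 + 64 * K ^+ 3)|.
have v1 : 1 <= v by rewrite lerDl.
have v0 : 0 < v by lra.
have hv : K + (1 + 64 * K ^+ 3) <= v ^+ 2.
  apply: le_trans (_ : v <= _); last by rewrite expr2 ler_peMr// ltW.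
  by apply: le_trans (ler_norm _) _; rewrite lerDr.
have gap (s t : R) : s < t -> \forall n \near \oo, rig_cdf n (m n) (p n) s < rig_cdf n (m n) (p n) t.
  move=> st.
  have h : rig_cdf n (m n) (p n) t - rig_cdf n (m n) (p n) s @[n --> \oo] --> Phi t - Phi s.
    exact: cvgB (hc t) (hc s).
  have d0 : 0 < Phi t - Phi s by rewrite subr_gt0 Phi_lt.
  have pos : \forall n \near \oo,
      0 < rig_cdf n (m n) (p n) t - rig_cdf n (m n) (p n) s by exact: cvgr_gt h 0 d0.
  by near do rewrite -subr_gt0.
have v2 : 0 < (2 * v)^-1 by rewrite invr_gt0 mulr_gt0.
have v3 : (2 * v)^-1 < v^-1 by rewrite ltf_pV2 ?posrE ?mulr_gt0//; lra.
have g1 := gap _ _ v2; have g2 := gap _ _ v3.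
near=> n; rewrite alE.
have n4 : (4 <= n)%N by near: n.
have m1 : (0 < m n)%N by near: n.
by apply: (al_large (p_bnd n) n4 m1 v0 hv); near: n.
Unshelve. all: by end_near. Qed.

Lemma variance_cdf_cvg :
  (n%:R ^+ 2 * phat (m n) (p n) * (1 - phat (m n) (p n))) @[n --> \oo] --> +oo ->
  forall t : R, rig_cdf n (m n) (p n) t @[n --> \oo] --> Phi t.
Proof.
move=> /cvgryPge h t; apply/cvgrPdist_le => eps eps0.
have C0 := Cmain_gt0 R.
(* The bound is [Cmain R] times al^(-1/4), so al >= x^(-4) is what has to hold eventually. *)
pose x := eps / Cmain R.
have x0 : 0 < x by rewrite divr_gt0.
near=> n; rewrite distrC.
have n4 : (4 <= n)%N by near: n.
have m1 : (0 < m n)%N by near: n.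
apply: le_trans (rig_cdf_dist t (dKW_main (p_bnd n) n4 m1)) _.
have a0 := al_gt0 (p_bnd n) n4 m1.
have hA : (x ^+ 4)^-1 <= al n (m n) (p n) by rewrite -alE; near: n; exact: h.
have hi : (al n (m n) (p n))^-1 <= (x ^+ 2) ^+ 2.
  by rewrite -exprM -[leRHS]invrK lef_pV2 ?posrE ?invr_gt0 ?exprn_gt0.
have x2 : 0 <= x ^+ 2 by rewrite exprn_ge0 ?(ltW x0).
have s1 : Num.sqrt (al n (m n) (p n))^-1 <= x ^+ 2.
  by rewrite -[leRHS]ger0_norm// -sqrtr_sqr ler_wsqrtr.
have s2 : Num.sqrt (Num.sqrt (al n (m n) (p n))^-1) <= x.
  by rewrite -[leRHS]gtr0_norm// -sqrtr_sqr ler_wsqrtr.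
by apply: le_trans (ler_wpM2l (ltW C0) s2) _; rewrite /x mulrCA mulfV ?mulr1// gt_eqF.
Unshelve. all: by end_near. Qed.

End Limits.

Theorem theorem2p2 (R : realType) :
  (forall (m : nat -> nat) (p : nat -> R),
     ((m n)%:R : R) @[n --> \oo] --> +oo ->
     (forall n, 0 < p n <= 1 / 10) ->
     ((forall t : R, rig_cdf n (m n) (p n) t @[n --> \oo] --> Phi t) <->
      ((n%:R) ^+ 2 * phat (m n) (p n) * (1 - phat (m n) (p n)))
        @[n --> \oo] --> +oo)) /\
  (exists (C : R) (n0 m0 : nat),
     0 < C /\ (0 < n0)%N /\ (0 < m0)%N /\
     forall (n m : nat) (p : R),
       (n0 <= n)%N -> (m0 <= m)%N -> 0 < p <= 1 / 10 ->
       (dKW_rig n m p <=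
          (C * ((n%:R ^+ 2 * phat m p * (1 - phat m p))^-1) `^ (4^-1))%:E)%E /\
       (m%:R * p ^+ 3 <= 1 ->
        (dKW_rig n m p <=
          (C * ((n%:R ^+ 2 * phat m p * (1 - phat m p))^-1
                + n%:R^-1 + m%:R^-1) `^ (2^-1))%:E)%E)).
Proof.
split=> [m p hm hp|].
  by split; [exact: cdf_cvg_variance|exact: variance_cdf_cvg].
(* n >= 4 serves the lower variance bound, through N <= 2 (N - 2) and 3/4 N^2 <= N (N - 1); m >= 1
   makes [phat], hence the variance, positive. *)
exists (Cmain R), 4%N, 1%N; split; first exact: Cmain_gt0.
split=> //; split=> // n m p n4 m1 hp.
have a0 : 0 <= (al n m p)^-1 by rewrite invr_ge0 ltW// (al_gt0 hp n4 m1).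
rewrite alE; split=> [|mp].
  by rewrite powR_quarter//; exact: (dKW_main hp n4 m1).
rewrite powR12_sqrt; last by rewrite !addr_ge0// invr_ge0.
exact: (dKW_small hp n4 m1 mp).
Qed.
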